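(* Let $0<p<\infty$ and $g\in H(\mathbb{D})$. Then $M_{g}:\mathcal{D}^{p}_{p-1}\rightarrow F(p,p-1,1)$ is bounded if and only if $g\in H^{\infty}$. Moreover, $$\|M_{g}\|_{\mathcal{D}^{p}_{p-1}\rightarrow F(p,p-1,1)}\approx\|g\|_{\infty}.$$
   Context: $\mathbb{D}$ is the open unit disc of $\mathbb{C}$, $H(\mathbb{D})$ the space of analytic functions on $\mathbb{D}$, and $dA(z)=\frac1\pi\,dx\,dy$ the normalized area measure. Multiplication operator: $M_gf(z)=f(z)g(z)$ for $f\in H(\mathbb{D})$, $z\in\mathbb{D}$. $H^\infty$ is the set of $f\in H(\mathbb{D})$ with $\|f\|_\infty=\sup_{z\in\mathbb{D}}|f(z)|<\infty$. Dirichlet type space: $\mathcal{D}^{p}_{p-1}$ is the set of $f\in H(\mathbb{D})$ with $$\|f\|_{\mathcal{D}^{p}_{p-1}}=\Big(|f(0)|^{p}+\int_{\mathbb{D}}|f'(z)|^{p}(1-|z|^{2})^{p-1}dA(z)\Big)^{1/p}<\infty.$$ $F(p,q,s)$ space ($0<p<\infty$, $q>-2$, $0<s<\infty$): the set of $f\in H(\mathbb{D})$ with $$\|f\|_{F(p,q,s)}^{p}=|f(0)|^{p}+\sup_{a\in\mathbb{D}}\int_{\mathbb{D}}|f'(z)|^{p}(1-|z|^{2})^{q}(1-|\sigma_{a}(z)|^{2})^{s}dA(z)<\infty,\qquad \sigma_a(z)=\frac{a-z}{1-\overline{a}z}.$$ $\|T\|_{X\to Y}$ denotes the operator (quasi-)norm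 $\sup\{\|Tf\|_Y:\|f\|_X\le1\}$. $A\approx B$ means $C^{-1}B\le A\le CB$ for a constant $C>0$ depending only on $p$ (not on $g$). *)

(* Defs.v *)
From HB Require Import structures.
From mathcomp Require Import all_boot all_order all_algebra.
From mathcomp Require Import complex.
From mathcomp Require Import all_classical all_reals all_analysis.

Set Implicit Arguments.
Unset Strict Implicit.
Unset Printing Implicit Defensive.

Import Order.TTheory GRing.Theory Num.Theory.
Import numFieldNormedType.Exports.
Import Normc.

Local Open Scope classical_set_scope.
Local Open Scope complex_scope.
Local Open Scope ring_scope.

(* Complex analysis over R[i], R : realType. The modulus is the R-valued
   [normc], not the R[i]-valued [`| _ |]. Functions on the disc are total
   functions R[i] -> R[i] of which only the values on the disc matter. *)

Definition disc (R : realType) : set R[i] := [set z | normc z < 1].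

(* R[i]^o is R[i] as a normed space over the field R[i] itself, so [derivable]
   and ['D_1] along the vector 1 are complex differentiability and the complex
   derivative. *)
Definition holomorphic_disc (R : realType) (f : R[i] -> R[i]) : Prop :=
  forall z, disc z -> derivable (f : R[i]^o -> R[i]^o) z 1.

Definition cderiv (R : realType) (f : R[i] -> R[i]) (z : R[i]) : R[i] :=
  'D_1 (f : R[i]^o -> R[i]^o) z.

(* The integral of h over the disc against dA = dx dy / pi. *)
Definition disc_integral (R : realType) (h : R[i] -> R) : \bar R :=
  ((pi^-1)%:E *
   \int[@lebesgue_measure R \x @lebesgue_measure R]_(w in
        [set w : R * R | disc (w.1 +i* w.2)%C])
      (h (w.1 +i* w.2)%C)%:E)%E.

Definition sigma (R : realType) (a z : R[i]) : R[i] :=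
  (a - z) / (1 - a^* * z).

(* The "norms" below are extended-real valued and defined on all functions;
   the space attached to N consists of the f in H(D) where N is finite. *)
Definition space_of (R : realType) (N : (R[i] -> R[i]) -> \bar R) :
    set (R[i] -> R[i]) :=
  [set f | holomorphic_disc f /\ (N f < +oo)%E].

Definition Hinf_norm (R : realType) (f : R[i] -> R[i]) : \bar R :=
  ereal_sup [set (normc (f z))%:E | z in @disc R].

Definition Hinf (R : realType) : set (R[i] -> R[i]) :=
  space_of (@Hinf_norm R).

Definition dirichlet_norm (R : realType) (p : R) (f : R[i] -> R[i]) : \bar R :=
  (((normc (f 0) `^ p)%:E +
    disc_integral (fun z =>
      (normc (cderiv f z) `^ p * (1 - normc z ^+ 2) `^ (p - 1))%R))
   `^ (p^-1))%E.

Definition F_norm (R : realType) (p q s : R) (f : R[i] -> R[i]) : \bar R :=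
  (((normc (f 0) `^ p)%:E +
    ereal_sup [set disc_integral (fun z =>
      (normc (cderiv f z) `^ p * (1 - normc z ^+ 2) `^ q *
       (1 - normc (sigma a z) ^+ 2) `^ s)%R) | a in @disc R])
   `^ (p^-1))%E.

Definition mulop (R : realType) (g f : R[i] -> R[i]) : R[i] -> R[i] :=
  fun z => f z * g z.

Definition bounded_operator (R : realType) (NX NY : (R[i] -> R[i]) -> \bar R)
    (T : (R[i] -> R[i]) -> (R[i] -> R[i])) : Prop :=
  (forall f, space_of NX f -> space_of NY (T f)) /\
  exists c : R, forall f, space_of NX f -> (NY (T f) <= c%:E * NX f)%E.

Definition operator_norm (R : realType) (NX NY : (R[i] -> R[i]) -> \bar R)
    (T : (R[i] -> R[i]) -> (R[i] -> R[i])) : \bar R :=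
  ereal_sup [set NY (T f) | f in [set f | space_of NX f /\ (NX f <= 1)%E]].

(* Main.v *)
Require Import Defs.
From HB Require Import structures.
From mathcomp Require Import all_boot all_order all_algebra.
From mathcomp Require Import complex.
From mathcomp Require Import all_classical all_reals all_analysis.
From mathcomp Require Import measurable_realfun ring lra.

(* Write |f|_D and |h|_F for the two norms.

   If |g| <= G, then |g'(z)| <= 8 G / (1 - |z|) by Cauchy's estimate, and
   1 - |sigma_a(z)|^2 = (1 - |a|^2) (1 - |z|^2) / |1 - conj(a) z|^2 <= 1. So the
   F-integral of (f g)' = f' g + f g' is at most a constant times G^p times the
   sum of the Dirichlet integral of f and the integral of |f|^p against
   (1 - |a|^2) / |1 - conj(a) z|^2 dA. These measures are Carleson measures for
   the Dirichlet type space, uniformly in a: |f(z)|^p is dominated by |f(0)|^p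
   plus (1 - |z|)^(-1/2) times the integral of |f'(w)|^p (1 - |w|)^(p - 3/2) over
   1 - |z| <= 2 (1 - |w|); after exchanging the integrals it remains to see that
   the kernel |1 - conj(a) z|^-2 has integral O(rho / (1 - |a|)) over the shell
   1 - |z| <= rho.

   Conversely, the sub-mean-value property of |h'|^p around w turns the term
   a = w of the supremum defining |h|_F into
   |h'(w)| <= C |h|_F (1 - |w|)^(-1 - 1/p), whence
   |h(a)| <= C |h|_F (1 - |a|)^(-1/p). Applied to h = f g with
   f(z) = c (1 - |a|)^(n - 1/p) / (1 - conj(a) z)^n, n p > 2, whose Dirichlet norm
   is at most 1 for a suitable c, this bounds |g(a)| by a constant times the norm
   of M_g. *)

Set Implicit Arguments.
Unset Strict Implicit.
Unset Printing Implicit Defensive.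

Import Order.TTheory GRing.Theory Num.Theory.
Import numFieldNormedType.Exports.
Import Normc.

Local Open Scope classical_set_scope.
Local Open Scope complex_scope.
Local Open Scope ring_scope.

Local Notation Re := (@complex.Re _).
Local Notation Im := (@complex.Im _).

(** * The complex derivative *)

Section ComplexModulus.
Variable R : realType.
Implicit Types (z w h : R[i]) (x y : R).

(** The complex analysis starts from the mere existence of f' and uses no contour integral formula,
    power series or polar coordinates. The maximum principle comes from a second-order expansion,
    which a function with one derivative does not offer. Goursat's bisection therefore supplies a
    primitive F of f; its difference quotients are twice differentiable and tend to f. A
    Schwarz-type Lipschitz bound for them passes to f, and by the same device to f'. This gives
    Cauchy's estimate and the continuity of f' on which measurability rests. The kernel integral
    over a shell is the mean of a Poisson kernel in disguise. Averaging over rotations of order 2^m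
    turns |1 - conj(a) z|^-2 into a factor at most 1 / (1 - |a|) times a bounded function. In the
    Carleson estimate the exponent 1/2 lies strictly between 0 and 1: at 0 the radial integration
    would produce a logarithm, at 1 the sum over the shells would diverge. *)

Lemma normc_ge0 z : 0 <= normc z.
Proof. by case: z => a b; exact: sqrtr_ge0. Qed.

Lemma normCE z : `|z| = (normc z)%:C.
Proof. by rewrite normc_def; case: z. Qed.

Lemma sqr_normcE z : normc z ^+ 2 = Re z ^+ 2 + Im z ^+ 2.
Proof. by case: z => a b /=; rewrite sqr_sqrtr ?addr_ge0 ?sqr_ge0. Qed.

Lemma normc_real x : normc x%:C = `|x|.
Proof. by rewrite /= expr0n addr0 sqrtr_sqr. Qed.

Lemma normc_eq0 z : (normc z == 0) = (z == 0).
Proof.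
by apply/eqP/eqP => [/eq0_normc//|->]; exact: normc0.
Qed.

Lemma normc_gt0 z : (0 < normc z) = (z != 0).
Proof. by rewrite lt0r normc_ge0 andbT normc_eq0. Qed.

Lemma normcX z n : normc (z ^+ n) = normc z ^+ n.
Proof.
elim: n => [|n IH]; first by rewrite !expr0; exact: normc1.
by rewrite !exprS normcM IH.
Qed.

Lemma normc_conj z : normc z^* = normc z.
Proof. by apply: complexI; rewrite -!normCE norm_conjC. Qed.

Lemma normc_dist z w : normc (z - w) = normc (w - z).
Proof. by rewrite -normcN opprB. Qed.

Lemma le_normcB z w : normc z - normc w <= normc (z - w).
Proof. by rewrite lerBlDr -{1}(subrK w z) le_normcD. Qed.

Lemma le_normc_dist z w : `|normc z - normc w| <= normc (z - w).
Proof.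
by rewrite ler_norml lerNl opprB {1}normc_dist !le_normcB.
Qed.

Lemma Re_le_normc z : `|Re z| <= normc z.
Proof.
rewrite -[leLHS]sqrtr_sqr; case: z => a b /=.
by apply: ler_wsqrtr; rewrite lerDl sqr_ge0.
Qed.

Lemma Im_le_normc z : `|Im z| <= normc z.
Proof.
rewrite -[leLHS]sqrtr_sqr; case: z => a b /=.
by apply: ler_wsqrtr; rewrite lerDr sqr_ge0.
Qed.

Lemma normc_le_ReIm z : normc z <= `|Re z| + `|Im z|.
Proof.
rewrite -(@ler_pXn2r _ 2) ?nnegrE ?normc_ge0 ?addr_ge0 //.
rewrite sqr_normcE sqrrD !real_normK ?num_real //.
by rewrite addrAC lerDl mulrn_wge0 // mulr_ge0.
Qed.

(** This is how bounds on a modulus are reduced to bounds on the real part of a rotated function. *)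
Lemma normc_rotate z : exists2 u : R[i], normc u = 1 & Re (u * z) = normc z.
Proof.
have [->|z0] := eqVneq z 0.
  by exists 1; [exact: normc1|rewrite mulr0 normc0].
exists (z^* / (normc z)%:C).
  rewrite normcM normcV normc_real ger0_norm ?normc_ge0// normc_conj divff//.
  by rewrite normc_eq0.
rewrite mulrAC mulrC -[z^* * z]mulrC -normCK normCE -rmorphXn -fmorphV -rmorphM.
by rewrite /= expr2 mulKf// normc_eq0.
Qed.

End ComplexModulus.

Section ComplexDerivative.
Variable R : realType.
Implicit Types (f g : R[i] -> R[i]) (z w h d : R[i]).

(** A first-order expansion with a real-valued error: there is no quotient by [h], the case [h = 0]
    is harmless, and every estimate is an inequality between reals. *)
Definition has_cderiv f z d := forall e : R, 0 < e ->
  exists2 t : R, 0 < t &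
    forall h, normc h < t -> normc (f (z + h) - f z - d * h) <= e * normc h.

Lemma posC_real (e : R[i]) : 0 < e -> exists2 r : R, 0 < r & e = r%:C.
Proof.
by case: e => a b; rewrite ltcE /= => /andP[/eqP -> a0]; exists a.
Qed.

Lemma nbhsC0P (P : R[i]^o -> Prop) :
  (\forall h \near (0 : R[i]^o), P h) <->
  exists2 t : R, 0 < t & forall h, normc h < t -> P h.
Proof.
split.
  move=> /nbhs_ballP[e /= /posC_real[r r0 ->]] H; exists r => // h hr.
  by apply: H; rewrite -ball_normE /= sub0r normrN normCE ltcR.
move=> [t t0 H]; apply/nbhs_ballP; exists t%:C => /=; first by rewrite ltcR.
by move=> h; rewrite -ball_normE /= sub0r normrN normCE ltcR => /H.
Qed.

Lemma has_cderivP f z d :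
  has_cderiv f z d <-> derivable (f : R[i]^o -> R[i]^o) z 1 /\ cderiv f z = d.
Proof.
have key : has_cderiv f z d <->
    h^-1 *: (((f : R[i]^o -> R[i]^o) \o shift z) (h *: (1 : R[i]^o)) - f z)
      @[h --> (0 : R[i]^o)^'] --> (d : R[i]^o).
  split.
    move=> H; apply/cvgrPdist_le => _ /posC_real[e e0 ->].
    have [t t0 ht] := H _ e0.
    apply/(@nbhsC0P (fun h => h != 0 -> _)); exists t => // h hlt h0 /=.
    rewrite normCE lecR normc_dist.
    have -> : h^-1 *: (f (h *: 1 + z) - f z) - d =
              h^-1 * (f (z + h) - f z - d * h).
      by rewrite /GRing.scale /= mulr1 (addrC h z) [RHS]mulrBr [h^-1 * (d * h)]mulrCA
        mulVf// mulr1.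
    rewrite normcM normcV mulrC ler_pdivrMr ?normc_gt0//; exact: ht.
  move=> H e e0; move/cvgrPdist_le: H => /(_ e%:C).
  rewrite ltcR => /(_ e0) /(@nbhsC0P (fun h => h != 0 -> _))[t t0 H].
  exists t => // h ht; have [->|h0] := eqVneq h 0.
    by rewrite addr0 subrr mulr0 subrr normc0 mulr0.
  have := H h ht h0; rewrite normCE lecR normc_dist /=.
  have -> : h^-1 *: (f (h *: 1 + z) - f z) - d =
              h^-1 * (f (z + h) - f z - d * h).
    by rewrite /GRing.scale /= mulr1 (addrC h z) [RHS]mulrBr [h^-1 * (d * h)]mulrCA
        mulVf// mulr1.
  by rewrite normcM normcV mulrC ler_pdivrMr ?normc_gt0.
split.
  move=> /key H; split; first by apply/cvg_ex; exists d.
  by apply: (cvg_lim _ H); exact: norm_hausdorff.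
by move=> [H E]; apply/key; rewrite -E; exact: H.
Qed.

Lemma cderivE f z d : has_cderiv f z d -> cderiv f z = d.
Proof. by move=> /has_cderivP[]. Qed.

Lemma holomorphic_discP f : holomorphic_disc f <->
  forall z, disc z -> has_cderiv f z (cderiv f z).
Proof.
split=> H z /H; first by move=> Hz; apply/has_cderivP.
by move=> /has_cderivP[].
Qed.

Lemma has_cderiv_cst (c : R[i]) z : has_cderiv (fun=> c) z 0.
Proof.
move=> e e0; exists 1 => // h _.
by rewrite subrr mul0r subr0 normc0 mulr_ge0 ?normc_ge0 // ltW.
Qed.

Lemma has_cderiv_id z : has_cderiv id z 1.
Proof.
move=> e e0; exists 1 => // h _.
have -> : id (z + h) - id z - 1 * h = 0 by rewrite /=; ring.
by rewrite normc0 mulr_ge0 ?normc_ge0 // ltW.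
Qed.

Lemma has_cderivZ (c : R[i]) f z d :
  has_cderiv f z d -> has_cderiv (fun w => c * f w) z (c * d).
Proof.
move=> Hf e e0; have c0 : 0 < normc c + 1 by rewrite ltr_wpDl ?normc_ge0.
have [t t0 H] := Hf (e / (normc c + 1)) (divr_gt0 e0 c0).
exists t => // h /H le.
have -> : c * f (z + h) - c * f z - c * d * h = c * (f (z + h) - f z - d * h).
  by ring.
rewrite normcM.
apply: (le_trans (ler_wpM2l (normc_ge0 _) le)).
rewrite [leLHS](_ : _ = e * normc h * (normc c / (normc c + 1))); last by ring.
by rewrite ler_piMr ?mulr_ge0 ?normc_ge0 ?(ltW e0)// ler_pdivrMr// mul1r lerDl.
Qed.

Lemma has_cderivD f g z d d' : has_cderiv f z d -> has_cderiv g z d' ->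
  has_cderiv (fun w => f w + g w) z (d + d').
Proof.
move=> Hf Hg e e0; have e20 : 0 < e / 2 by rewrite divr_gt0.
have [t t0 H] := Hf _ e20; have [t' t0' H'] := Hg _ e20.
exists (Num.min t t') => [|h]; first by rewrite lt_min t0.
rewrite lt_min => /andP[/H h1 /H' h2].
have -> : f (z + h) + g (z + h) - (f z + g z) - (d + d') * h =
  (f (z + h) - f z - d * h) + (g (z + h) - g z - d' * h) by ring.
by apply: le_trans (le_normcD _ _) _; lra.
Qed.

Lemma has_cderivM f g z d d' : has_cderiv f z d -> has_cderiv g z d' ->
  has_cderiv (fun w => f w * g w) z (d * g z + f z * d').
Proof.
move=> /has_cderivP[df <-] /has_cderivP[dg <-]; apply/has_cderivP.
have H := @derivableM _ _ (f : R[i]^o -> R[i]^o) g z 1 df dg.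
split; first exact: H.
have E := @deriveM _ _ (f : R[i]^o -> R[i]^o) g z 1 df dg.
by rewrite /cderiv [LHS]E addrC; congr (_ + _); exact: mulrC.
Qed.

Lemma has_cderiv_shift f z c d :
  has_cderiv f (z + c) d -> has_cderiv (fun w => f (w + c)) z d.
Proof.
move=> H e /H[t t0 Ht]; exists t => // h /Ht.
by rewrite (addrAC z h c).
Qed.

Lemma has_cderivV f z d : has_cderiv f z d -> f z != 0 ->
  has_cderiv (fun w => (f w)^-1) z (- d / f z ^+ 2).
Proof.
move=> /has_cderivP[df <-] f0; apply/has_cderivP.
have H := @derivableV _ _ (f : R[i]^o -> R[i]^o) z 1 f0 df.
split; first exact: H.
have E := @deriveV _ _ (f : R[i]^o -> R[i]^o) z 1 f0 df.
rewrite /cderiv [LHS]E mulNr mulrC -mulNr; exact: erefl.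
Qed.

Lemma has_cderivX f z d n : has_cderiv f z d ->
  has_cderiv (fun w => f w ^+ n.+1) z (n.+1%:R * f z ^+ n * d).
Proof.
move=> H; elim: n => [|n IH].
  by rewrite expr0 mulr1 mul1r; under eq_fun do rewrite expr1.
under eq_fun do rewrite exprS.
have := has_cderivM H IH; congr has_cderiv.
by rewrite !exprS (mulrSr 1 n.+1); ring.
Qed.

Lemma has_cderiv_continuous f z d : has_cderiv f z d ->
  forall e : R, 0 < e -> exists2 t : R, 0 < t &
    forall w, normc (w - z) < t -> normc (f w - f z) < e.
Proof.
move=> H e e0; have [t t0 Ht] := H 1 ltr01.
have k0 : 0 < 2 + normc d by rewrite ltr_wpDr ?normc_ge0.
exists (Num.min t (e / (2 + normc d))) => [|w].
  by rewrite lt_min t0 divr_gt0.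
rewrite lt_min => /andP[lt1 h2].
have h1 := Ht _ lt1; rewrite [z + _]addrC subrK in h1.
have := le_normcD (f w - f z - d * (w - z)) (d * (w - z)).
rewrite subrK normcM => /le_lt_trans; apply.
rewrite mul1r in h1; rewrite ltr_pdivlMr// in h2.
have := normc_ge0 (w - z); nra.
Qed.

End ComplexDerivative.

(** * Complex-valued functions of a real parameter and the mean value inequality *)

Section RealParameter.
Variable R : realType.
Implicit Types (p : R -> R[i]) (q : R -> R) (t s : R).

Definition has_rderiv p t (d : R[i]) := forall e : R, 0 < e ->
  exists2 r : R, 0 < r & forall s, `|s| < r ->
    normc (p (t + s) - p t - d * s%:C) <= e * `|s|.

Lemma nbhsR0P (P : R -> Prop) :
  (\forall h \near (0 : R), P h) <->
  exists2 t : R, 0 < t & forall h, `|h| < t -> P h.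
Proof.
split.
  move=> /nbhs_ballP[e /= e0 H]; exists e => // h hr.
  by apply: H; rewrite -ball_normE /= sub0r normrN.
move=> [t t0 H]; apply/nbhs_ballP; exists t => //=.
by move=> h; rewrite -ball_normE /= sub0r normrN => /H.
Qed.

Lemma is_derive_epsP q t d : is_derive t 1 q d <->
  (forall e : R, 0 < e -> exists2 r : R, 0 < r & forall s, `|s| < r ->
    `|q (t + s) - q t - d * s| <= e * `|s|).
Proof.
have E h : h != 0 -> h^-1 *: (q (h *: 1 + t) - q t) - d =
              h^-1 * (q (t + h) - q t - d * h).
  move=> h0; rewrite /GRing.scale /= mulr1 (addrC h t) [RHS]mulrBr.
  by rewrite [h^-1 * (d * h)]mulrCA mulVf// mulr1.
have key : (forall e : R, 0 < e -> exists2 r : R, 0 < r & forall s, `|s| < r ->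
    `|q (t + s) - q t - d * s| <= e * `|s|) <->
    h^-1 *: ((q \o shift t) (h *: 1) - q t) @[h --> (0 : R)^'] --> d.
  split.
    move=> H; apply/cvgrPdist_le => e e0.
    have [r r0 ht] := H _ e0.
    apply/(@nbhsR0P (fun h => h != 0 -> _)); exists r => // h hlt h0 /=.
    rewrite distrC E// normrM normfV mulrC ler_pdivrMr ?normr_gt0//.
    exact: ht.
  move=> H e e0; move/cvgrPdist_le: H => /(_ e e0).
  move=> /(@nbhsR0P (fun h => h != 0 -> _))[r r0 H].
  exists r => // h ht; have [->|h0] := eqVneq h 0.
    by rewrite addr0 subrr mulr0 subrr normr0 mulr0.
  have := H h ht h0; rewrite distrC /= E// normrM normfV mulrC.
  by rewrite ler_pdivrMr ?normr_gt0.
split.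
  by move=> [H D]; apply/key; rewrite -D; exact: H.
move=> /key H; split; first by apply/cvg_ex; exists d.
by apply: (cvg_lim _ H); exact: norm_hausdorff.
Qed.

Lemma is_derive_Re p t d (u : R[i]) : has_rderiv p t d ->
  is_derive t 1 (fun s => Re (u * p s)) (Re (u * d)).
Proof.
move=> H; apply/is_derive_epsP => e e0.
have c0 : 0 < normc u + 1 by rewrite ltr_wpDl ?normc_ge0.
have [r r0 Hr] := H (e / (normc u + 1)) (divr_gt0 e0 c0).
exists r => // s /Hr le.
have -> : Re (u * p (t + s)) - Re (u * p t) - Re (u * d) * s =
    Re (u * (p (t + s) - p t - d * s%:C)).
  move: (p (t + s)) (p t) d u {H Hr le c0} => [a1 b1] [a2 b2] [a3 b3] [a b] /=; ring.
apply: (le_trans (Re_le_normc _)); rewrite normcM.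
apply: (le_trans (ler_wpM2l (normc_ge0 _) le)).
rewrite [leLHS](_ : _ = e * `|s| * (normc u / (normc u + 1))); last by ring.
by rewrite ler_piMr ?mulr_ge0 ?(ltW e0)// ler_pdivrMr// mul1r lerDl.
Qed.

(* Rotating so that the increment of p becomes a nonnegative real reduces this
   to the monotonicity of a real function. *)
Lemma normc_increment_le p (dp : R -> R[i]) q (dq : R -> R) a b : a <= b ->
  (forall t, a <= t <= b -> has_rderiv p t (dp t)) ->
  (forall t, a <= t <= b -> is_derive t 1 q (dq t)) ->
  (forall t, a <= t <= b -> normc (dp t) <= dq t) ->
  normc (p b - p a) <= q b - q a.
Proof.
move=> ab Hp Hq le.
have [u u1 <-] := normc_rotate (p b - p a).
pose k s := q s - Re (u * p s).
have dk t : a <= t <= b -> is_derive t 1 k (dq t - Re (u * dp t)).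
  by move=> tab; apply: is_deriveB; [exact: Hq|exact: is_derive_Re (Hp _ tab)].
suff : k a <= k b.
  have -> : Re (u * (p b - p a)) = Re (u * p b) - Re (u * p a).
    by move: (p a) (p b) u {u1 k dk} => [a1 b1] [a2 b2] [a3 b3] /=; ring.
  by rewrite /k; lra.
apply: (@ger0_derive1_le_cc _ k a b) => //.
- by move=> x; rewrite in_itv /= => /andP[/ltW ax /ltW xb]; case: (dk x); rewrite ?ax.
- move=> x; rewrite in_itv /= => /andP[/ltW ax /ltW xb].
  have xab : a <= x <= b by rewrite ax.
  rewrite derive1E; case: (dk x xab) => _ ->; rewrite subr_ge0.
  apply: le_trans (le x xab); apply: le_trans (ler_norm _) _.
  by apply: (le_trans (Re_le_normc _)); rewrite normcM u1 mul1r.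
- apply: derivable_within_continuous => x; rewrite in_itv /= => xab.
  by case: (dk x xab).
- by rewrite in_itv /= lexx.
- by rewrite in_itv /= lexx andbT.
Qed.

Lemma has_rderivZ_id (c : R[i]) t : has_rderiv (fun s => c * s%:C) t c.
Proof.
move=> e e0; exists 1 => // s _.
have -> : c * (t + s)%:C - c * t%:C - c * s%:C = 0 by rewrite rmorphD /=; ring.
by rewrite normc0 mulr_ge0 // ltW.
Qed.

Lemma has_rderivD p1 p2 t d1 d2 : has_rderiv p1 t d1 -> has_rderiv p2 t d2 ->
  has_rderiv (fun s => p1 s + p2 s) t (d1 + d2).
Proof.
move=> Hf Hg e e0; have e20 : 0 < e / 2 by rewrite divr_gt0.
have [r r0 H] := Hf _ e20; have [r' r0' H'] := Hg _ e20.
exists (Num.min r r') => [|h]; first by rewrite lt_min r0.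
rewrite lt_min => /andP[/H h1 /H' h2].
have -> : p1 (t + h) + p2 (t + h) - (p1 t + p2 t) - (d1 + d2) * h%:C =
  (p1 (t + h) - p1 t - d1 * h%:C) + (p2 (t + h) - p2 t - d2 * h%:C) by ring.
by apply: le_trans (le_normcD _ _) _; lra.
Qed.

Lemma has_rderivN p t d : has_rderiv p t d -> has_rderiv (fun s => - p s) t (- d).
Proof.
move=> H e /H[r r0 Hr]; exists r => // s /Hr.
by rewrite -normcN !opprD !opprK mulNr opprK.
Qed.

Lemma has_rderivB p1 p2 t d1 d2 : has_rderiv p1 t d1 -> has_rderiv p2 t d2 ->
  has_rderiv (fun s => p1 s - p2 s) t (d1 - d2).
Proof. by move=> H1 /has_rderivN H2; exact: has_rderivD H1 H2. Qed.

(** The mean value inequality for [p] minus the linear function of slope [c]; it stands in for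
    integrating [dp - c]. *)
Lemma normc_increment_near p (dp : R -> R[i]) (c : R[i]) (K a b : R) : a <= b ->
  (forall t, a <= t <= b -> has_rderiv p t (dp t)) ->
  (forall t, a <= t <= b -> normc (dp t - c) <= K) ->
  normc (p b - p a - c * (b - a)%:C) <= K * (b - a).
Proof.
move=> ab Hp le.
have := @normc_increment_le (fun s => p s - c * s%:C) (fun s => dp s - c)
  (fun s => K * s) (fun=> K) a b ab.
rewrite -mulrBr.
have -> : p b - c * b%:C - (p a - c * a%:C) = p b - p a - c * (b - a)%:C.
  by rewrite rmorphB /=; ring.
apply => // t tab.
  by apply: has_rderivB; [exact: Hp|exact: has_rderivZ_id].
apply/is_derive_epsP => e e0; exists 1 => // s _.
have -> : K * (t + s) - K * t - K * s = 0 by ring.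
by rewrite normr0 mulr_ge0 // ltW.
Qed.

Lemma normc_increment_near_sym p (dp : R -> R[i]) (c : R[i]) (K a h : R) :
  (forall s, `|s| <= `|h| -> has_rderiv p (a + s) (dp (a + s))) ->
  (forall s, `|s| <= `|h| -> normc (dp (a + s) - c) <= K) ->
  normc (p (a + h) - p a - c * h%:C) <= K * `|h|.
Proof.
move=> Hp le; case: (lerP 0 h) => h0.
  rewrite ger0_norm // in Hp le *.
  have := @normc_increment_near p dp c K a (a + h).
  have -> : a + h - a = h by ring.
  apply; first by rewrite lerDl.
    move=> t /andP[at_ th]; rewrite (_ : t = a + (t - a)); last (by ring); apply: Hp.
    by rewrite ger0_norm ?subr_ge0 // lerBlDl.
  move=> t /andP[at_ th]; rewrite (_ : t = a + (t - a)); last (by ring); apply: le.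
  by rewrite ger0_norm ?subr_ge0 // lerBlDl.
rewrite ltr0_norm // in Hp le *.
have := @normc_increment_near p dp c K (a + h) a.
have -> : a - (a + h) = - h by ring.
have -> : p a - p (a + h) - c * (- h)%:C = - (p (a + h) - p a - c * h%:C).
  by rewrite rmorphN /=; ring.
rewrite normcN; apply; first by lra.
  move=> t /andP[at_ th]; rewrite (_ : t = a + (t - a)); last (by ring); apply: Hp.
  by rewrite ler_norml; lra.
move=> t /andP[at_ th]; rewrite (_ : t = a + (t - a)); last (by ring); apply: le.
by rewrite ler_norml; lra.
Qed.

End RealParameter.

(** * Primitives on a square *)

Section Primitive.
Variable R : realType.
Implicit Types (f : R[i] -> R[i]) (z d : R[i]) (x y t s : R).

Lemma has_rderiv_ReIm (q1 q2 : R -> R) t (d1 d2 : R) :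
  is_derive t 1 q1 d1 -> is_derive t 1 q2 d2 ->
  has_rderiv (fun s => q1 s +i* q2 s) t (d1 +i* d2).
Proof.
move=> /is_derive_epsP H1 /is_derive_epsP H2 e e0.
have e20 : 0 < e / 2 by rewrite divr_gt0.
have [r r0 h1] := H1 _ e20; have [r' r0' h2] := H2 _ e20.
exists (Num.min r r') => [|s]; first by rewrite lt_min r0.
rewrite lt_min => /andP[/h1 {}h1 /h2 {}h2].
apply: (le_trans (normc_le_ReIm _)) => /=.
rewrite mulr0 subr0 mulr0 add0r; lra.
Qed.

Lemma antiderivative_real (q : R -> R) (l : R) : continuous q ->
  exists Q : R -> R, forall t, l < t -> is_derive t 1 Q (q t).
Proof.
move=> cq; exists (fun x => \int[@lebesgue_measure R]_(t in `[l, x]) q t)%R => t lt.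
have tu : t < t + 1 by rewrite ltrDl.
have [] := @continuous_FTC1_closed R q l t (t + 1) tu _ lt (cq t).
  apply: continuous_compact_integrable; first exact: segment_compact.
  exact: continuous_subspaceT.
by rewrite derive1E => dF <-; split.
Qed.

Lemma antiderivative (p : R -> R[i]) (l : R) :
  (forall t e, 0 < e -> exists2 r : R, 0 < r & forall s, `|s - t| < r ->
    normc (p s - p t) < e) ->
  exists P : R -> R[i], forall t, l < t -> has_rderiv P t (p t).
Proof.
move=> cp.
have cRe : continuous (fun t => Re (p t)).
  move=> t; apply/cvgrPdist_lt => e e0; have [r r0 H] := cp t e e0.
  apply/nbhs_ballP; exists r => // s; rewrite /ball_ /= distrC => /H.
  apply: le_lt_trans; rewrite distrC; apply: le_trans (Re_le_normc _).
  by case: (p s) (p t) => [a b] [c d].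
have cIm : continuous (fun t => Im (p t)).
  move=> t; apply/cvgrPdist_lt => e e0; have [r r0 H] := cp t e e0.
  apply/nbhs_ballP; exists r => // s; rewrite /ball_ /= distrC => /H.
  apply: le_lt_trans; rewrite distrC; apply: le_trans (Im_le_normc _).
  by case: (p s) (p t) => [a b] [c d].
have [Q1 H1] := antiderivative_real l cRe.
have [Q2 H2] := antiderivative_real l cIm.
exists (fun t => Q1 t +i* Q2 t) => t lt.
by have := has_rderiv_ReIm (H1 t lt) (H2 t lt); case: (p t).
Qed.

Lemma has_rderiv_mull (c : R[i]) (p : R -> R[i]) t d :
  has_rderiv p t d -> has_rderiv (fun s => c * p s) t (c * d).
Proof.
move=> Hf e e0; have c0 : 0 < normc c + 1 by rewrite ltr_wpDl ?normc_ge0.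
have [r r0 H] := Hf (e / (normc c + 1)) (divr_gt0 e0 c0).
exists r => // h /H le.
have -> : c * p (t + h) - c * p t - c * d * h%:C = c * (p (t + h) - p t - d * h%:C).
  by ring.
rewrite normcM.
apply: (le_trans (ler_wpM2l (normc_ge0 _) le)).
rewrite [leLHS](_ : _ = e * `|h| * (normc c / (normc c + 1))); last by ring.
by rewrite ler_piMr ?mulr_ge0 ?(ltW e0)// ler_pdivrMr// mul1r lerDl.
Qed.

Lemma nested_intervals (x : nat -> R) (w : R) : 0 <= w ->
  (forall n, x n <= x n.+1) ->
  (forall n, x n.+1 + w / 2 ^+ n.+1 <= x n + w / 2 ^+ n) ->
  exists l, forall n, x n <= l <= x n + w / 2 ^+ n.
Proof.
move=> w0 x1 x2.
have up n k : x n <= x (n + k)%N.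
  elim: k => [|k IH]; first by rewrite addn0.
  by rewrite addnS (le_trans IH).
have dn n k : x (n + k)%N + w / 2 ^+ (n + k) <= x n + w / 2 ^+ n.
  elim: k => [|k IH]; first by rewrite addn0.
  by rewrite addnS (le_trans (x2 _)).
have pos n : 0 <= w / 2 ^+ n by rewrite divr_ge0 ?exprn_ge0.
have cross m n : x m <= x n + w / 2 ^+ n.
  case: (leqP m n) => mn.
    have H := up m (n - m)%N; rewrite subnKC// in H.
    by apply: le_trans H _; rewrite lerDl.
  have H := dn n (m - n)%N; rewrite subnKC 1?ltnW// in H.
  by apply: le_trans H; rewrite lerDl.
exists (sup (range x)) => n; apply/andP; split.
  apply: ub_le_sup; last by exists n.
  by exists (x n + w / 2 ^+ n) => _ [m _ <-].
apply: ge_sup; first by exists (x 0%N); exists 0%N.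
by move=> _ [m _ <-].
Qed.

(* The bisection argument of Goursat's lemma: D x y w h is the defect of the
   rectangle with corner (x, y) and sides w, h. *)
Lemma bisection_le0 (D : R -> R -> R -> R -> R) (x0 y0 w0 h0 : R) :
  0 <= w0 -> 0 <= h0 ->
  (forall x y w h, 0 <= w -> 0 <= h ->
     x0 <= x -> y0 <= y -> x + w <= x0 + w0 -> y + h <= y0 + h0 ->
     D x y w h <= D x y (w / 2) (h / 2) + D (x + w / 2) y (w / 2) (h / 2)
       + D x (y + h / 2) (w / 2) (h / 2)
       + D (x + w / 2) (y + h / 2) (w / 2) (h / 2)) ->
  (forall x1 y1, x0 <= x1 <= x0 + w0 -> y0 <= y1 <= y0 + h0 ->
     forall e, 0 < e -> exists2 r : R, 0 < r &
     forall x y w h, 0 <= w -> 0 <= h ->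
       x0 <= x -> y0 <= y -> x + w <= x0 + w0 -> y + h <= y0 + h0 ->
       w + h < r -> x <= x1 <= x + w -> y <= y1 <= y + h ->
       D x y w h <= e * (w + h) ^+ 2) ->
  D x0 y0 w0 h0 <= 0.
Proof.
move=> w00 h00 quarter local; rewrite leNgt; apply/negP => D0.
(* [ok n p]: the rectangle with corner [p] and sides divided by 2^n lies in the initial one and
   keeps at least the fraction 4^-n of its defect. *)
pose ok n (p : R * R) := [/\ x0 <= p.1, y0 <= p.2,
  p.1 + w0 / 2 ^+ n <= x0 + w0, p.2 + h0 / 2 ^+ n <= y0 + h0 &
  D x0 y0 w0 h0 / 4 ^+ n <= D p.1 p.2 (w0 / 2 ^+ n) (h0 / 2 ^+ n)].
pose W n := w0 / 2 ^+ n; pose H n := h0 / 2 ^+ n.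
have WS n : W n.+1 = W n / 2 by rewrite /W exprSr invfM mulrA.
have HS n : H n.+1 = H n / 2 by rewrite /H exprSr invfM mulrA.
have W0 n : 0 <= W n by rewrite divr_ge0 ?exprn_ge0.
have H0 n : 0 <= H n by rewrite divr_ge0 ?exprn_ge0.
(* The premise [ok] stands under the existential so that [choice] returns a total function. *)
have step (np : nat * (R * R)) : exists p' : R * R, ok np.1 np.2 ->
   ok np.1.+1 p' /\ (p'.1 = np.2.1 \/ p'.1 = np.2.1 + W np.1.+1) /\
     (p'.2 = np.2.2 \/ p'.2 = np.2.2 + H np.1.+1).
  case: np => n [x y] /=.
  have [okn|] := pselect (ok n (x, y)); last by exists (x, y).
  case: (okn) => /= xa ya xb yb Dn.
  have := quarter x y (W n) (H n) (W0 n) (H0 n) xa ya xb yb.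
  rewrite -WS -HS => q.
  have {q} q4 : 4 * (D x0 y0 w0 h0 / 4 ^+ n.+1) <= D x y (W n.+1) (H n.+1) +
      D (x + W n.+1) y (W n.+1) (H n.+1) +
      D x (y + H n.+1) (W n.+1) (H n.+1) +
      D (x + W n.+1) (y + H n.+1) (W n.+1) (H n.+1).
    apply: le_trans q; apply: le_trans Dn.
    by rewrite exprS invfM mulrCA (mulrA 4) divff ?mul1r// pnatr_eq0.
  have wn : x + W n <= x0 + w0 by [].
  have hn : y + H n <= y0 + h0 by [].
  have wS := WS n; have hS := HS n.
  have := W0 n.+1; have := H0 n.+1 => h1 w1.
  set c := D x0 y0 w0 h0 / 4 ^+ n.+1 in q4 *.
  rewrite /ok -/(W n.+1) -/(H n.+1) -/c.
  case: (leP c (D x y (W n.+1) (H n.+1))) => [c1|c1].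
    by exists (x, y) => _ /=; split; [split => //; lra|split; left].
  case: (leP c (D (x + W n.+1) y (W n.+1) (H n.+1))) => [c2|c2].
    by exists (x + W n.+1, y) => _ /=; split; [split => //; lra|split; [right|left]].
  case: (leP c (D x (y + H n.+1) (W n.+1) (H n.+1))) => [c3|c3].
    by exists (x, y + H n.+1) => _ /=; split; [split => //; lra|split; [left|right]].
  exists (x + W n.+1, y + H n.+1) => _ /=; split; [split => //; lra|split; right => //].
have [next nextP] := choice step.
pose s := fix s n := if n is m.+1 then next (m, s m) else (x0, y0).
have okS n : ok n (s n).
  elim: n => [|n IH]; first by split; rewrite /= ?expr0 ?divr1 //.
  by have [] := nextP (n, s n) IH.
have nS n := (nextP (n, s n) (okS n)).2.
have [x1 x1P] : exists l, forall n, (s n).1 <= l <= (s n).1 + w0 / 2 ^+ n.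
  apply: nested_intervals => // n; have [/= [] -> _] := nS n; rewrite ?lerDl//;
  by rewrite -/(W n) -/(W n.+1); have := W0 n.+1; have := WS n; lra.
have [y1 y1P] : exists l, forall n, (s n).2 <= l <= (s n).2 + h0 / 2 ^+ n.
  apply: nested_intervals => // n; have [/= _ [] ->] := nS n; rewrite ?lerDl//;
  by rewrite -/(H n) -/(H n.+1); have := H0 n.+1; have := HS n; lra.
have x1b : x0 <= x1 <= x0 + w0 by have := x1P 0%N; rewrite /= expr0 divr1.
have y1b : y0 <= y1 <= y0 + h0 by have := y1P 0%N; rewrite /= expr0 divr1.
(* With this [e] the local bound for a rectangle of generation n is less than half of the fraction
   4^-n of the defect; the added 1 keeps the denominator positive for a degenerate rectangle. *)
have e0 : 0 < D x0 y0 w0 h0 / (2 * ((w0 + h0) ^+ 2 + 1)).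
  by rewrite divr_gt0// mulr_gt0// ltr_wpDl// sqr_ge0.
have [r r0 Hr] := local x1 y1 x1b y1b _ e0.
have [n nr] : exists n : nat, (w0 + h0) / 2 ^+ n < r.
  exists (Num.bound ((w0 + h0) / r)); rewrite ltr_pdivrMr ?exprn_gt0// mulrC.
  by rewrite -ltr_pdivrMr//; apply: upper_nthrootP.
have [xa ya xb yb Dn] := okS n.
have := Hr (s n).1 (s n).2 (W n) (H n) (W0 n) (H0 n) xa ya xb yb.
rewrite /W /H -mulrDl => /(_ nr (x1P n) (y1P n)) => {}Hr.
have := le_trans Dn Hr.
have -> : (4 : R) ^+ n = (2 ^+ n) ^+ 2.
  by rewrite -exprM mulnC exprM; congr (_ ^+ n); ring.
rewrite expr_div_n.
rewrite mulrA ler_pM2r ?invr_gt0 ?exprn_gt0//.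
rewrite mulrAC ler_pdivlMr ?mulr_gt0 ?ltr_wpDl ?sqr_ge0//.
rewrite ler_pM2l// => ?; have := sqr_ge0 (w0 + h0); lra.
Qed.

End Primitive.

(** * Goursat's lemma and the primitive of a differentiable function on a square *)

Section Goursat.
Variable R : realType.
Variables (f df : R[i] -> R[i]) (s : R).
Hypothesis s0 : 0 < s.
Hypothesis fd : forall x y : R, `|x| <= s -> `|y| <= s ->
  has_cderiv f (x +i* y) (df (x +i* y)).

(** The projection of the line onto [-s, s]. Composing with it extends [f] continuously to the whole
    plane, since [antiderivative] asks for continuity everywhere. *)
Let clip (t : R) := Num.max (- s) (Num.min t s).

Let clip_id t : `|t| <= s -> clip t = t.
Proof.
rewrite ler_norml /clip => /andP[h1 h2].
by rewrite min_l// max_r.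
Qed.

Let clip_le t : `|clip t| <= s.
Proof.
rewrite ler_norml /clip le_max lexx /= ge_max ge_min lexx orbT andbT.
by have := s0; lra.
Qed.

Let clip_lip t u : `|clip t - clip u| <= `|t - u|.
Proof.
have h1 := ler_norm (t - u); have h2 := ler_norm (u - t).
rewrite distrC in h2; have s0' := s0; rewrite ler_norml /clip /Num.min.
case: (ltP t s) => ?; case: (ltP u s) => ?; rewrite /Num.max; do 2! case: ltP => ?; lra.
Qed.

Let ft (x y : R) := f (clip x +i* clip y).

Let ft_id x y : `|x| <= s -> `|y| <= s -> ft x y = f (x +i* y).
Proof. by move=> hx hy; rewrite /ft !clip_id. Qed.

Let ft_cont x y e : 0 < e -> exists2 r : R, 0 < r & forall x' y',
   `|x' - x| + `|y' - y| < r -> normc (ft x' y' - ft x y) < e.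
Proof.
move=> e0.
have [r r0 H] := has_cderiv_continuous (fd (clip_le x) (clip_le y)) e0.
exists r => // x' y' lt; apply: H; apply: le_lt_trans lt.
by apply: (le_trans (normc_le_ReIm _)) => /=; apply: lerD; exact: clip_lip.
Qed.

Lemma primitive_square : exists F : R[i] -> R[i], forall x y : R,
  `|x| < s -> `|y| < s -> has_cderiv F (x +i* y) (f (x +i* y)).
Proof.
(* Primitives along each horizontal line, and below along each vertical one; the margin 1 puts [- s]
   in the interior, so that the derivative there is two-sided. *)
have hA y : exists P : R -> R[i], forall t, - s - 1 < t -> has_rderiv P t (ft t y).
  apply: (@antiderivative R (fun t => ft t y) (- s - 1)) => t e e0.
  have [r r0 H] := ft_cont t y e0; exists r => // u ur; apply: H.
  by rewrite subrr normr0 addr0.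
have hB x : exists P : R -> R[i], forall t, - s - 1 < t ->
    has_rderiv P t ('i * ft x t).
  have [P HP] : exists P : R -> R[i], forall t, - s - 1 < t -> has_rderiv P t (ft x t).
    apply: (@antiderivative R (fun t => ft x t) (- s - 1)) => t e e0.
    have [r r0 H] := ft_cont x t e0; exists r => // u ur; apply: H.
    by rewrite subrr normr0 add0r.
  by exists (fun t => 'i * P t) => t /HP; exact: has_rderiv_mull.
have [A HA] := choice hA; have [B HB] := choice hB.
(* The primitives are fixed on each line only up to a constant, which the second difference of [E]
   cancels: [D x y w h] is the modulus of the integral of [ft] around the rectangle. *)
pose E x y := B x y - A y x.
pose D x y w h := normc (E (x + w) (y + h) - E (x + w) y - E x (y + h) + E x y).
have inside (a x w t : R) : 0 <= a -> - a <= x -> x + w <= a -> x <= t <= x + w -> `|t| <= a.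
  by move=> a0 h1 h2 /andP[h3 h4]; rewrite ler_norml; lra.
have D0 w h : 0 <= w -> 0 <= h -> w <= 2 * s -> h <= 2 * s ->
    D (- s) (- s) w h = 0.
  move=> w0 h0 ws hs; apply/eqP; rewrite eq_le normc_ge0 andbT.
  apply: (@bisection_le0 R D (- s) (- s) w h) => //.
    move=> x y u v _ _ _ _ _ _; rewrite /D.
    rewrite (_ : x + u / 2 + u / 2 = x + u); last by lra.
    rewrite (_ : y + v / 2 + v / 2 = y + v); last by lra.
    rewrite [leLHS](_ : _ = normc
      ((E (x + u / 2) (y + v / 2) - E (x + u / 2) y - E x (y + v / 2) + E x y)
      + (E (x + u) (y + v / 2) - E (x + u) y - E (x + u / 2) (y + v / 2) + E (x + u / 2) y)
      + (E (x + u / 2) (y + v) - E (x + u / 2) (y + v / 2) - E x (y + v) + E x (y + v / 2))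
      + (E (x + u) (y + v) - E (x + u) (y + v / 2) - E (x + u / 2) (y + v)
         + E (x + u / 2) (y + v / 2)))); last by congr normc; ring.
    by do 3! (apply: le_trans (le_normcD _ _) _; rewrite lerD2r).
  move=> x1 y1 /andP[x1a x1b] /andP[y1a y1b] e e0.
  have hx1 : `|x1| <= s by rewrite ler_norml; lra.
  have hy1 : `|y1| <= s by rewrite ler_norml; lra.
  have e40 : 0 < e / 4 by rewrite divr_gt0.
  have [r r0 Hr] := fd hx1 hy1 e40; exists r => // x y u v u0 v0 xa ya xb yb uvr xx1 yy1.
  set d := df _ in Hr.
  have loc t t' : x <= t <= x + u -> y <= t' <= y + v ->
    normc (ft t t' - f (x1 +i* y1) - d * ((t - x1) +i* (t' - y1))) <= e / 4 * (u + v).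
    move=> /[dup] tx /andP[tx1 tx2] /[dup] ty /andP[ty1 ty2].
    have tle : normc ((t - x1) +i* (t' - y1)) <= u + v.
      apply: (le_trans (normc_le_ReIm _)) => /=; apply: lerD; rewrite ler_norml;
      by move/andP: xx1 yy1 => [? ?] /andP[? ?]; lra.
    have := Hr _ (le_lt_trans tle uvr).
    have -> : (x1 +i* y1) + ((t - x1) +i* (t' - y1)) = t +i* t'.
      by apply/eqP; rewrite eq_complex /=; apply/andP; split; apply/eqP; ring.
    have ts : `|t| <= s by apply: (inside s x u) => //; [exact: ltW|lra].
    have t's : `|t'| <= s by apply: (inside s y v) => //; [exact: ltW|lra].
    rewrite ft_id//.
    by move=> /le_trans; apply; rewrite ler_wpM2l // ltW.
  (* The horizontal sides together contribute ['i * d * u * v] up to the error; by [V] the vertical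
     sides contribute the same, so the affine part of [f] drops out of the defect. *)
  have U : normc ((A (y + v) (x + u) - A y (x + u)) - (A (y + v) x - A y x)
      - 'i * d * v%:C * u%:C) <= e / 2 * (u + v) * u.
    have := @normc_increment_near R (fun t => A (y + v) t - A y t)
      (fun t => ft t (y + v) - ft t y) ('i * d * v%:C) (e / 2 * (u + v)) x (x + u).
    rewrite (_ : x + u - x = u); last by lra.
    apply; first by rewrite lerDl.
      by move=> t /andP[ta tb]; apply: has_rderivB; apply: HA; lra.
    move=> t tx.
    have l1 := loc t (y + v) tx; have l2 := loc t y tx.
    rewrite !lexx !lerDl v0 /= in l1 l2.
    have := le_normcD (ft t (y + v) - f (x1 +i* y1) - d * ((t - x1) +i* (y + v - y1)))
      (- (ft t y - f (x1 +i* y1) - d * ((t - x1) +i* (y - y1)))).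
    rewrite normcN => ll.
    have -> : ft t (y + v) - ft t y - 'i * d * v%:C =
        ft t (y + v) - f (x1 +i* y1) - d * ((t - x1) +i* (y + v - y1)) -
        (ft t y - f (x1 +i* y1) - d * ((t - x1) +i* (y - y1))).
      have -> : (t - x1) +i* (y + v - y1) = (t - x1) +i* (y - y1) + 'i * v%:C.
        by apply/eqP; rewrite eq_complex /=; apply/andP; split; apply/eqP; ring.
      by ring.
    by apply: (le_trans ll); have := l1 isT; have := l2 isT; lra.
  have V : normc ((B (x + u) (y + v) - B x (y + v)) - (B (x + u) y - B x y)
      - 'i * d * u%:C * v%:C) <= e / 2 * (u + v) * v.
    have := @normc_increment_near R (fun t => B (x + u) t - B x t)
      (fun t => 'i * ft (x + u) t - 'i * ft x t) ('i * d * u%:C) (e / 2 * (u + v)) y (y + v).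
    rewrite (_ : y + v - y = v); last by lra.
    apply; first by rewrite lerDl.
      by move=> t /andP[ta tb]; apply: has_rderivB; apply: HB; lra.
    move=> t ty.
    have l1 := loc (x + u) t; have l2 := loc x t.
    rewrite !lexx !lerDl u0 /= in l1 l2.
    have := le_normcD (ft (x + u) t - f (x1 +i* y1) - d * ((x + u - x1) +i* (t - y1)))
      (- (ft x t - f (x1 +i* y1) - d * ((x - x1) +i* (t - y1)))).
    rewrite normcN => ll.
    have -> : 'i * ft (x + u) t - 'i * ft x t - 'i * d * u%:C =
        'i * (ft (x + u) t - f (x1 +i* y1) - d * ((x + u - x1) +i* (t - y1)) -
        (ft x t - f (x1 +i* y1) - d * ((x - x1) +i* (t - y1)))).
      have -> : (x + u - x1) +i* (t - y1) = (x - x1) +i* (t - y1) + u%:C.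
        by apply/eqP; rewrite eq_complex /=; apply/andP; split; apply/eqP; ring.
      by ring.
    have i1 : normc ('i : R[i]) = 1 by rewrite /= expr0n expr1n add0r sqrtr1.
    rewrite normcM i1 mul1r.
    by apply: (le_trans ll); have := l1 isT ty; have := l2 isT ty; lra.
  rewrite /D /E.
  set Z := (X in normc X).
  have -> : Z = ((B (x + u) (y + v) - B x (y + v)) - (B (x + u) y - B x y)
      - 'i * d * u%:C * v%:C) + (- ((A (y + v) (x + u) - A y (x + u)) - (A (y + v) x - A y x)
      - 'i * d * v%:C * u%:C)) by rewrite /Z; ring.
  apply: (le_trans (le_normcD _ _)); rewrite normcN.
  have uv2 : 0 <= (u + v) ^+ 2 by rewrite sqr_ge0.
  have euv : 0 <= e * (u + v) ^+ 2 by rewrite mulr_ge0 // ltW.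
  apply: (le_trans (lerD V U)).
  rewrite [leLHS](_ : _ = e * (u + v) ^+ 2 / 2); last by field.
  by lra.
(* Vanishing defects make [E] the sum of a function of [x] and a function of [y]. *)
have E4 x y : `|x| <= s -> `|y| <= s ->
    E x y = E x (- s) + E (- s) y - E (- s) (- s).
  rewrite !ler_norml => /andP[x1 x2] /andP[y1 y2].
  have xs : 0 <= x + s by lra.
  have ys : 0 <= y + s by lra.
  have := D0 (x + s) (y + s) xs ys.
  rewrite /D !(addrC (- s)) !addrK => H.
  have /eq0_normc {}H := H ltac:(lra) ltac:(lra).
  apply/eqP; rewrite -subr_eq0 -[X in _ == X]H; apply/eqP; ring.
(* [A] gives the horizontal derivative; the term [E (- s)] depends on the height alone and, by [E4],
   makes the vertical increments equal to those of [B x]. *)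
exists (fun z => A (Im z) (Re z) + E (- s) (Im z)) => x y xs ys e e0.
have e20 : 0 < e / 2 by rewrite divr_gt0.
have e40 : 0 < e / 2 / 2 by rewrite divr_gt0.
have [r r0 Hr] := ft_cont x y e40.
have xy0 : 0 < Num.min (s - `|x|) (s - `|y|) by rewrite lt_min !subr_gt0 xs.
exists (Num.min (r / 2) (Num.min (s - `|x|) (s - `|y|))).
  by rewrite lt_min xy0 divr_gt0.
move=> h; rewrite !lt_min => /andP[hr /andP[hx hy]].
case: h hr hx hy => u v hr hx hy.
have ul := Re_le_normc (u +i* v); have vl := Im_le_normc (u +i* v); rewrite /= in ul vl.
set n := Num.sqrt _ in ul vl.
rewrite -[normc _]/n in hr hx hy *.
have bnd (a b c : R) : `|a| <= s - `|c| -> `|b| <= `|a| -> `|c + b| <= s.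
  by have := ler_normD c b; lra.
have neg (a : R) : `|a| <= s -> - s - 1 < a by rewrite ler_norml; lra.
have IA : normc (A (y + v) (x + u) - A (y + v) x - ft x y * u%:C) <= e / 2 / 2 * `|u|.
  apply: (@normc_increment_near_sym _ _ (fun t => ft t (y + v))) => t tu.
    by apply: HA; apply: neg; apply: (bnd u) => //; lra.
  apply: ltW; apply: Hr.
  by rewrite !(addrAC _ _ (- _)) !subrr !add0r; lra.
have IB : normc (B x (y + v) - B x y - 'i * ft x y * v%:C) <= e / 2 / 2 * `|v|.
  apply: (@normc_increment_near_sym _ _ (fun t => 'i * ft x t)) => t tv.
    by apply: HB; apply: neg; apply: (bnd v) => //; lra.
  have i1 : normc ('i : R[i]) = 1 by rewrite /= expr0n expr1n add0r sqrtr1.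
  rewrite -mulrBr normcM i1 mul1r.
  apply: ltW; apply: Hr.
  by rewrite !(addrAC _ _ (- _)) !subrr !add0r normr0 add0r; lra.
have hx' : `|x| <= s by exact: ltW.
have yv : `|y + v| <= s by apply: (bnd v) => //; lra.
have ys' : `|y| <= s by exact: ltW.
have e1 := E4 x (y + v) hx' yv; have e2 := E4 x y hx' ys'.
have -> : (x +i* y) + (u +i* v) = (x + u) +i* (y + v) by [].
rewrite /= -ft_id//.
set Z := (X in normc X).
have -> : Z = (A (y + v) (x + u) - A (y + v) x - ft x y * u%:C)
   + (B x (y + v) - B x y - 'i * ft x y * v%:C).
  rewrite /Z; have -> : u +i* v = u%:C + 'i * v%:C.
    by apply/eqP; rewrite eq_complex /=; apply/andP; split; apply/eqP; ring.
  have e3 : E x (y + v) - E x y = E (- s) (y + v) - E (- s) y.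
    by rewrite e1 e2; ring.
  have -> : B x (y + v) - B x y =
     (E x (y + v) - E x y) + (A (y + v) x - A y x) by rewrite /E; ring.
  by rewrite e3; ring.
apply: (le_trans (le_normcD _ _)); apply: (le_trans (lerD IA IB)).
have n0 : 0 <= n by apply: le_trans ul.
have uv2n : `|u| + `|v| <= 2 * n by lra.
rewrite -mulrDr; apply: (le_trans (ler_wpM2l (ltW e40) uv2n)).
rewrite [leLHS](_ : _ = e * n / 2); last by field.
by have := mulr_ge0 (ltW e0) n0; lra.
Qed.

End Goursat.

(** * Maximum principle and Cauchy estimates *)

Section MaximumModulus.
Variable R : realType.
Implicit Types (f F G : R[i] -> R[i]) (z w h c d : R[i]) (u : R[i] -> R).

Definition ucont_at u z := forall e : R, 0 < e ->
  exists2 t : R, 0 < t & forall w, normc (w - z) < t -> `|u w - u z| < e.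

Lemma continuous_pair u (p : R * R) : ucont_at u (p.1 +i* p.2) ->
  {for p, continuous (fun q : R * R => u (q.1 +i* q.2))}.
Proof.
move=> H; apply/cvgrPdist_lt => e e0; have [t t0 Ht] := H _ e0.
have t20 : 0 < t / 2 by rewrite divr_gt0.
exists (ball p.1 (t / 2), ball p.2 (t / 2)).
  by split; exact: nbhsx_ballx.
move=> q [] /=; rewrite -!ball_normE /= => q1 q2; rewrite distrC; apply: Ht.
apply: (le_lt_trans (normc_le_ReIm _)) => /=.
by rewrite (distrC q.1) (distrC q.2); lra.
Qed.

Lemma ucont_normc_sub c z : ucont_at (fun w => normc (w - c)) z.
Proof.
move=> e e0; exists e => // w; apply: le_lt_trans.
apply: le_trans (le_normc_dist _ _) _.
by rewrite opprB addrA subrK.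
Qed.

Lemma ucontD u1 u2 z : ucont_at u1 z -> ucont_at u2 z ->
  ucont_at (fun w => u1 w + u2 w) z.
Proof.
move=> H1 H2 e e0; have e20 : 0 < e / 2 by rewrite divr_gt0.
have [t t0 h1] := H1 _ e20; have [t' t0' h2] := H2 _ e20.
exists (Num.min t t') => [|w]; first by rewrite lt_min t0.
rewrite lt_min => /andP[/h1 {}h1 /h2 {}h2].
rewrite opprD addrACA; apply: le_lt_trans (ler_normD _ _) _; lra.
Qed.

Lemma ucontM u1 u2 z : ucont_at u1 z -> ucont_at u2 z ->
  ucont_at (fun w => u1 w * u2 w) z.
Proof.
move=> H1 H2 e e0.
pose K := `|u1 z| + `|u2 z| + 1.
have K0 : 0 < K by rewrite ltr_wpDl// addr_ge0.
pose e' := Num.min 1 (e / K).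
have e'0 : 0 < e' by rewrite lt_min ltr01 divr_gt0.
have [t t0 h1] := H1 _ e'0; have [t' t0' h2] := H2 _ e'0.
exists (Num.min t t') => [|w]; first by rewrite lt_min t0.
rewrite lt_min => /andP[/h1 {}h1 /h2 {}h2].
have -> : u1 w * u2 w - u1 z * u2 z =
  (u1 w - u1 z) * (u2 w - u2 z) + (u1 w - u1 z) * u2 z + u1 z * (u2 w - u2 z) by ring.
apply: (@le_lt_trans _ _ (`|u1 w - u1 z| * `|u2 w - u2 z| + `|u1 w - u1 z| * `|u2 z|
  + `|u1 z| * `|u2 w - u2 z|)).
  by rewrite -!normrM; do 2! (apply: (le_trans (ler_normD _ _)); rewrite ?lerD2r).
have eK : e' * K <= e by rewrite -ler_pdivlMr// ge_min lexx orbT.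
have e1 : e' <= 1 by rewrite ge_min lexx.
move: h1 h2; set a := `|_|; set b := `|_| => h1 h2.
apply: lt_le_trans eK; rewrite /K.
have a0 : 0 <= a by exact: normr_ge0.
have b0 : 0 <= b by exact: normr_ge0.
have := normr_ge0 (u1 z); have := normr_ge0 (u2 z).
move: `|u1 z| `|u2 z| => x y y0 x0.
have p1 : a * b <= a by rewrite ler_piMr// ltW// (lt_le_trans h2).
have p2 : a * y <= e' * y by rewrite ler_wpM2r// ltW.
have p3 : x * b <= e' * x by rewrite mulrC ler_wpM2r// ltW.
by lra.
Qed.

Lemma ucont_has_cderiv_normc f z d : has_cderiv f z d -> ucont_at (fun w => normc (f w)) z.
Proof.
move=> /has_cderiv_continuous H e /H[t t0 Ht]; exists t => // w /Ht.
exact: le_lt_trans (le_normc_dist _ _).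
Qed.

Lemma disc_max u c (r : R) : 0 <= r ->
  (forall z, normc (z - c) <= r -> ucont_at u z) ->
  exists2 z0, normc (z0 - c) <= r & forall z, normc (z - c) <= r -> u z <= u z0.
Proof.
move=> r0 cu.
pose A := [set p : R * R | normc ((p.1 +i* p.2) - c) <= r].
have A0 : A !=set0.
  by exists (Re c, Im c); rewrite /A /=; case: c {cu A} => a b; rewrite subrr normc0.
have cA : compact A.
  apply: (@subclosed_compact _ _ (`[Re c - r, Re c + r] `*` `[Im c - r, Im c + r])%classic).
  - have -> : A = (fun p : R * R => normc ((p.1 +i* p.2) - c)) @^-1` [set x | x <= r] by [].
    apply: preimage_closed; last exact: closed_le.
    by move=> p _; apply: (@continuous_pair (fun w => normc (w - c))); exact: ucont_normc_sub.
  - by apply: compact_setX; exact: segment_compact.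
  - move=> [x y]; rewrite /A /= => le.
    have := le_trans (Re_le_normc _) le; have := le_trans (Im_le_normc _) le.
    case: c {cu A0 A le} => a b /=.
    by rewrite !ler_norml !in_itv /= => h1 h2; split; lra.
have [] := @compact_EVT_max _ R (fun q : R * R => u (q.1 +i* q.2)) A A0 cA.
  apply: continuous_in_subspaceT => p /set_mem pA.
  by apply: continuous_pair; exact: cu.
move=> [x y] /set_mem xyA H; exists (x +i* y) => // -[a b] abA.
by apply: (H (a, b)); exact: mem_set.
Qed.

Definition twice_cderivable G z := exists G1 : R[i] -> R[i],
  (exists2 t : R, 0 < t & forall w, normc (w - z) < t -> has_cderiv G w (G1 w)) /\
  exists d, has_cderiv G1 z d.

Lemma has_rderiv_line G z h (t : R) d : has_cderiv G (z + t%:C * h) d ->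
  has_rderiv (fun s : R => G (z + s%:C * h)) t (d * h).
Proof.
move=> H e e0; have c0 : 0 < normc h + 1 by rewrite ltr_wpDl ?normc_ge0.
have [r r0 Hr] := H (e / (normc h + 1)) (divr_gt0 e0 c0).
exists (r / (normc h + 1)) => [|s]; first by rewrite divr_gt0.
rewrite ltr_pdivlMr// => sr.
have sh : normc (s%:C * h) = `|s| * normc h by rewrite normcM normc_real.
have := Hr (s%:C * h); rewrite sh => {}Hr.
have -> : z + (t + s)%:C * h = z + t%:C * h + s%:C * h by rewrite rmorphD /=; ring.
have -> : d * h * s%:C = d * (s%:C * h) by ring.
apply: (le_trans (Hr _)).
  by apply: le_lt_trans sr; rewrite ler_wpM2l// lerDl.
rewrite [leLHS](_ : _ = e * `|s| * (normc h / (normc h + 1))); last by ring.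
by rewrite ler_piMr ?mulr_ge0 ?(ltW e0)// ler_pdivrMr// mul1r lerDl.
Qed.

Lemma cderiv_segment_le F f z h (M : R) :
  (forall t : R, 0 <= t <= 1 -> has_cderiv F (z + t%:C * h) (f (z + t%:C * h))) ->
  (forall t : R, 0 <= t <= 1 -> normc (f (z + t%:C * h)) <= M) ->
  normc (F (z + h) - F z) <= M * normc h.
Proof.
move=> HF Hf.
have H : normc (F (z + 1%:C * h) - F (z + 0%:C * h) - 0 * (1 - 0)%:C) <=
    M * normc h * (1 - 0).
  apply: (@normc_increment_near R (fun s => F (z + s%:C * h))
    (fun s => f (z + s%:C * h) * h) 0 (M * normc h) 0 1 ler01) => t t01.
    by apply: has_rderiv_line; exact: HF.
  by rewrite subr0 normcM ler_wpM2r ?normc_ge0//; exact: Hf.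
by move: H; rewrite rmorph1 rmorph0 !mul0r mul1r addr0 !subr0 mulr1.
Qed.

(** The second-order Taylor expansion: [G] minus the candidate polynomial has a derivative of size
    at most [e |w - z|] near [z], and the mean value inequality on the segment turns this into
    [e |h|^2]. *)
Lemma twice_cderivable_jet G z : twice_cderivable G z -> exists A B : R[i],
  forall e : R, 0 < e -> exists2 t : R, 0 < t & forall h, normc h < t ->
    normc (G (z + h) - G z - A * h - B * h ^+ 2) <= e * normc h ^+ 2.
Proof.
move=> [G1 [[t t0 H1] [d H2]]]; exists (G1 z), (d / 2) => e e0.
have [t' t0' H3] := H2 _ e0.
exists (Num.min t t') => [|h]; first by rewrite lt_min t0.
rewrite lt_min => /andP[ht ht'].
have sm (s : R) : 0 <= s <= 1 -> normc (s%:C * h) <= normc h.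
  move=> /andP[s0 s1]; rewrite normcM normc_real ger0_norm//.
  by rewrite ler_piMl ?normc_ge0.
pose K w := G w - G1 z * (w - z) - d / 2 * (w - z) ^+ 2.
rewrite [X in normc X](_ : _ = K (z + h) - K z); last by rewrite /K; ring.
rewrite expr2 mulrA.
apply: (@cderiv_segment_le _ (fun w => G1 w - G1 z - d * (w - z))) => s /sm sh; last first.
  rewrite [_ - z](_ : _ = s%:C * h); last by ring.
  apply: (le_trans (H3 _ (le_lt_trans sh ht'))).
  by rewrite ler_wpM2l// ltW.
set w := z + s%:C * h.
have Hw : has_cderiv G w (G1 w).
  apply: H1; rewrite [_ - z](_ : _ = s%:C * h); last by rewrite /w; ring.
  exact: le_lt_trans ht.
have Hid : has_cderiv (fun w => w - z) w 1.
  by have := has_cderivD (has_cderiv_id w) (has_cderiv_cst (- z) w); rewrite addr0.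
have Hsq := has_cderivX 1 Hid.
have := has_cderivD (has_cderivD Hw (has_cderivZ (- G1 z) Hid)) (has_cderivZ (- (d / 2)) Hsq).
rewrite mulr1 mulr1 expr1.
have -> : - (d / 2) * (2%:R * (w - z)) = - (d * (w - z)) by field.
by under eq_fun do rewrite !mulNr.
Qed.

(* At an interior maximum of Re (u G) + e |z - c|^2, adding the second
   differences in the directions 1 and 'i cancels the quadratic term of the
   holomorphic part and leaves the Laplacian 4 e of the perturbation. *)
Lemma max_modulus G c (r M : R) : 0 < r -> 0 <= M ->
  (forall z, normc (z - c) <= r -> forall e : R, 0 < e ->
     exists2 t : R, 0 < t & forall w, normc (w - z) < t -> normc (G w - G z) < e) ->
  (forall z, normc (z - c) < r -> G z != 0 -> twice_cderivable G z) ->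
  (forall z, normc (z - c) = r -> normc (G z) <= M) ->
  forall z, normc (z - c) <= r -> normc (G z) <= M.
Proof.
move=> r0 M0 cG tG GM z zr; rewrite leNgt; apply/negP => zM.
have [u u1 uE] := normc_rotate (G z).
(* Then [b r^2] is half of the excess |G z| - M. On the circle [V] is at most M + b r^2, which is
   less than [V z], so the maximum of [V] is interior. *)
pose b := (normc (G z) - M) / (2 * r ^+ 2).
have r20 : 0 < r ^+ 2 by rewrite exprn_gt0.
have b0 : 0 < b by rewrite divr_gt0 ?subr_gt0// mulr_gt0.
pose V w := Re (u * G w) + b * (normc (w - c) * normc (w - c)).
have cV w : normc (w - c) <= r -> ucont_at V w.
  move=> /cG cw; apply: ucontD.
    move=> e /cw[t t0 H]; exists t => // w' /H; apply: le_lt_trans.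
    have -> : Re (u * G w') - Re (u * G w) = Re (u * (G w' - G w)).
      by move: (G w') (G w) u {u1 uE V} => [? ?] [? ?] [? ?] /=; ring.
    by apply: (le_trans (Re_le_normc _)); rewrite normcM u1 mul1r.
  apply: ucontM; first by move=> e e0; exists 1 => // w' _; rewrite subrr normr0.
  by apply: ucontM; exact: ucont_normc_sub.
have [z2 z2r z2max] := disc_max (ltW r0) cV.
have Vz : M + b * r ^+ 2 < V z2.
  apply: lt_le_trans (z2max z zr).
  rewrite /V uE; have : 0 <= b * (normc (z - c) * normc (z - c)).
    by rewrite mulr_ge0 ?(ltW b0) ?mulr_ge0 ?normc_ge0.
  have : b * r ^+ 2 = (normc (G z) - M) / 2 by rewrite /b; field; rewrite gt_eqF.
  by lra.
have quad w : normc (w - c) <= r -> b * (normc (w - c) * normc (w - c)) <= b * r ^+ 2.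
  move=> wr; rewrite ler_pM2l// expr2; apply: ler_pM => //; exact: normc_ge0.
have ReG w : Re (u * G w) <= normc (G w).
  by apply: (le_trans (ler_norm _)); apply: (le_trans (Re_le_normc _)); rewrite normcM u1 mul1r.
have M_lt : M < normc (G z2).
  by have := quad _ z2r; have := ReG z2; rewrite /V in Vz; lra.
have z2lt : normc (z2 - c) < r.
  rewrite lt_neqAle z2r andbT; apply/eqP => /GM; by rewrite leNgt M_lt.
(* The maximum point is not a zero of [G], so derivatives off the zeros suffice for the expansion
   there. *)
have G0 : G z2 != 0 by rewrite -normc_gt0; apply: le_lt_trans M_lt.
have [A [B jet]] := twice_cderivable_jet (tG _ z2lt G0).
(* Four remainders of size at most b s^2 / 2 add up to 2 b s^2, which is less than the 4 b s^2
   gained from the perturbation. *)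
have [t t0 Ht] := jet (b / 2) (divr_gt0 b0 (ltr0n _ 2)).
have rz : 0 < r - normc (z2 - c) by rewrite subr_gt0.
pose s := Num.min t (r - normc (z2 - c)) / 2.
have s0 : 0 < s by rewrite divr_gt0// lt_min t0.
have st : s < t.
  by rewrite /s ltr_pdivrMr// gt_min; apply/orP; left; lra.
have sr : normc (z2 - c) + s <= r.
  have : s <= r - normc (z2 - c) by rewrite /s ler_pdivrMr// ge_min; apply/orP; right; lra.
  by lra.
have i1 : normc ('i : R[i]) = 1 by rewrite /= expr0n expr1n add0r sqrtr1.
have dir (k : R[i]) : normc k = 1 ->
   V (z2 + s%:C * k) <= V z2 /\
   normc (G (z2 + s%:C * k) - G z2 - A * (s%:C * k) - B * (s%:C * k) ^+ 2) <= b / 2 * s ^+ 2.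
  move=> k1; have nk : normc (s%:C * k) = s.
    by rewrite normcM k1 normc_real gtr0_norm// mulr1.
  split.
    apply: z2max; rewrite addrAC; apply: le_trans (le_normcD _ _) _.
    by rewrite nk.
  by have := Ht (s%:C * k); rewrite nk => /(_ st).
have [d1 j1] := dir 1 (normc1 _).
have [d2 j2] := dir (-1) (etrans (normcN _) (normc1 _)).
have [d3 j3] := dir 'i i1.
have [d4 j4] := dir (- 'i) (etrans (normcN _) i1).
set r1 := (X in normc X) in j1; set r2 := (X in normc X) in j2.
set r3 := (X in normc X) in j3; set r4 := (X in normc X) in j4.
have sumG : u * G (z2 + s%:C * 1) + u * G (z2 + s%:C * -1) + u * G (z2 + s%:C * 'i) +
  u * G (z2 + s%:C * - 'i) = 4 * (u * G z2) + u * (r1 + r2 + r3 + r4).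
  have ii : ('i : R[i]) * 'i = -1 by rewrite -expr2 sqr_i.
  rewrite /r1 /r2 /r3 /r4 !exprMn !sqrrN !expr2 ii.
  move: (G (z2 + s%:C * 1)) (G (z2 + s%:C * -1)) (G (z2 + s%:C * 'i)) (G (z2 + s%:C * - 'i)) (G z2).
 move=> *; ring.
have sumR : Re (u * G (z2 + s%:C * 1)) + Re (u * G (z2 + s%:C * -1)) +
  Re (u * G (z2 + s%:C * 'i)) + Re (u * G (z2 + s%:C * - 'i)) =
  4 * Re (u * G z2) + Re (u * (r1 + r2 + r3 + r4)).
  have ReD (x y : R[i]) : Re (x + y) = Re x + Re y by case: x y => [? ?] [? ?].
  have Re4 (x : R[i]) : Re (4 * x) = 4 * Re x.
    have -> : (4 : R[i]) = (4 : R)%:C by rewrite rmorph_nat.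
    by case: x => ? ? /=; ring.
  by rewrite -!ReD sumG ReD Re4.
have rs : - (2 * b * s ^+ 2) <= Re (u * (r1 + r2 + r3 + r4)).
  have : `|Re (u * (r1 + r2 + r3 + r4))| <= normc r1 + normc r2 + normc r3 + normc r4.
    apply: (le_trans (Re_le_normc _)); rewrite normcM u1 mul1r.
    by do 3! (apply: (le_trans (le_normcD _ _)); rewrite ?lerD2r).
  by rewrite ler_norml => /andP[+ _]; lra.
have sq (k : R[i]) : normc (z2 + k - c) * normc (z2 + k - c) =
   (Re (z2 - c) + Re k) ^+ 2 + (Im (z2 - c) + Im k) ^+ 2.
  rewrite -expr2 sqr_normcE; move: z2 c k {z zr zM uE b b0 V cV z2r z2max Vz quad ReG M_lt z2lt G0 jet Ht rz s s0 st sr d1 d2 d3 d4 j1 j2 j3 j4 r1 r2 r3 r4 sumG sumR rs dir cG tG GM} => [? ?] [? ?] [? ?] /=; ring.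
have sq0 : normc (z2 - c) * normc (z2 - c) = Re (z2 - c) ^+ 2 + Im (z2 - c) ^+ 2.
  by rewrite -expr2 sqr_normcE.
rewrite /V !sq sq0 /= in d1 d2 d3 d4.
move: (Re (z2 - c)) (Im (z2 - c)) d1 d2 d3 d4 => p q d1 d2 d3 d4.
have bs : 0 < b * s ^+ 2 by rewrite mulr_gt0// exprn_gt0.
move: sumR rs d1 d2 d3 d4 bs; rewrite !expr2; nra.
Qed.

End MaximumModulus.

(** * Schwarz's lemma and Cauchy's estimates through difference quotients *)

Section CauchyEstimates.
Variable R : realType.
Implicit Types (f F G : R[i] -> R[i]) (z w h c d : R[i]).

Lemma twice_cderivableM F G z : twice_cderivable F z -> twice_cderivable G z ->
  twice_cderivable (fun w => F w * G w) z.
Proof.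
move=> [F1 [[t t0 HF] [d Hd]]] [G1 [[t' t0' HG] [d' Hd']]].
have z0 (s : R) : 0 < s -> normc (z - z) < s by rewrite subrr normc0.
exists (fun w => F1 w * G w + F w * G1 w); split.
  exists (Num.min t t') => [|w]; first by rewrite lt_min t0.
  by rewrite lt_min => /andP[/HF h1 /HG h2]; exact: has_cderivM.
eexists; apply: has_cderivD; apply: has_cderivM; [exact: Hd|exact: HG (z0 _ t0')|
  exact: HF (z0 _ t0)|exact: Hd'].
Qed.

Lemma twice_cderivableX F z n : twice_cderivable F z ->
  twice_cderivable (fun w => F w ^+ n) z.
Proof.
move=> H; elim: n => [|n IH].
  exists (fun=> 0); split; last by exists 0; exact: has_cderiv_cst.
  by exists 1 => // w _; exact: has_cderiv_cst.
by under eq_fun do rewrite exprS; exact: twice_cderivableM.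
Qed.

Lemma has_cderiv_subid c z : has_cderiv (fun w => w - c) z 1.
Proof.
by have := has_cderivD (has_cderiv_id z) (has_cderiv_cst (- c) z); rewrite addr0.
Qed.

Lemma twice_cderivable_subid c z : twice_cderivable (fun w => w - c) z.
Proof.
exists (fun=> 1); split; last by exists 0; exact: has_cderiv_cst.
by exists 1 => // w _; exact: has_cderiv_subid.
Qed.

Lemma twice_cderivable_invsub c z : z != c ->
  twice_cderivable (fun w => (w - c)^-1) z.
Proof.
move=> zc; have zc0 : z - c != 0 by rewrite subr_eq0.
exists (fun w => -1 / (w - c) ^+ 2); split.
  exists (normc (z - c)) => [|w wz]; first by rewrite normc_gt0.
  apply: has_cderivV; first exact: has_cderiv_subid.
  apply: contraTneq wz => /eqP; rewrite subr_eq0 => /eqP ->.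
  by rewrite normc_dist ltxx.
eexists; apply: has_cderivM; first exact: has_cderiv_cst.
apply: has_cderivV; last by rewrite expf_neq0.
apply: has_cderivX; exact: has_cderiv_subid.
Qed.

(* Schwarz's lemma: apply the maximum principle to (z - c) q^n, where q is the
   difference quotient of F at c, and let n go to infinity; the factor z - c
   spares us from proving that q extends differentiably through c. *)
Lemma schwarz_lipschitz F f c (r r' M : R) : 0 < r -> r < r' ->
  (forall z, normc (z - c) < r' -> has_cderiv F z (f z)) ->
  (forall z, normc (z - c) < r' -> exists d, has_cderiv f z d) ->
  (forall z, normc (z - c) < r' -> normc (F z) <= M) ->
  forall z, normc (z - c) <= r -> normc (F z - F c) <= 2 * M / r * normc (z - c).
Proof.
move=> r0 rr' HF Hf FM z zr.
have [->|zc] := eqVneq z c; first by rewrite !subrr normc0 mulr0.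
have zc0 : 0 < normc (z - c) by rewrite normc_gt0 subr_eq0.
have c' : normc (c - c) < r' by rewrite subrr normc0 (lt_trans r0).
have M0 : 0 <= M by apply: le_trans (FM _ c'); exact: normc_ge0.
pose q w := (F w - F c) / (w - c).
pose K := 2 * M / r.
have K0 : 0 <= K by rewrite divr_ge0 ?mulr_ge0 ?(ltW r0).
have FB w : normc (w - c) < r' -> normc (F w - F c) <= 2 * M.
  move=> wr; apply: le_trans (le_normcD _ _) _; rewrite normcN.
  by have := FM _ wr; have := FM _ c'; lra.
have tq w : normc (w - c) < r' -> w != c -> twice_cderivable q w.
  move=> wr wc; apply: twice_cderivableM; last exact: twice_cderivable_invsub.
  exists f; split; last exact: Hf.
  exists (r' - normc (w - c)) => [|w' hw']; first by rewrite subr_gt0.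
  rewrite -[f w']addr0; apply: has_cderivD; last exact: has_cderiv_cst.
  apply: HF; rewrite -(subrK w w') -addrA.
  by apply: le_lt_trans (le_normcD _ _) _; rewrite -ltrBrDr.
have tG n w : normc (w - c) < r' -> w != c ->
    twice_cderivable (fun w => (w - c) * q w ^+ n.+1) w.
  move=> wr wc; apply: twice_cderivableM; first exact: twice_cderivable_subid.
  by apply: twice_cderivableX; exact: tq.
have cG n w : normc (w - c) <= r -> forall e : R, 0 < e ->
    exists2 t : R, 0 < t & forall w', normc (w' - w) < t ->
     normc ((w' - c) * q w' ^+ n.+1 - (w - c) * q w ^+ n.+1) < e.
  move=> wr e e0; have [->|wc] := eqVneq w c; last first.
    have wr' := le_lt_trans wr rr'.
    have [G1 [[t t0 HG] _]] := tG n w wr' wc.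
    apply: (has_cderiv_continuous (HG w _)) => //.
    by rewrite subrr normc0.
  have [t t0 Ht] := HF c c' 1 ltr01.
  (* Near [c] the quotient [q] is bounded by [L], so the factor w' - c alone makes the product tend
     to 0. *)
  pose L := normc (f c) + 1.
  have L0 : 0 < L by rewrite ltr_wpDl ?normc_ge0.
  have Ln : 0 < L ^+ n.+1 by rewrite exprn_gt0.
  exists (Num.min t (e / L ^+ n.+1)) => [|w']; first by rewrite lt_min t0 divr_gt0.
  rewrite lt_min => /andP[w't w'e].
  rewrite subrr mul0r subr0 normcM normcX.
  have [->|w'c] := eqVneq w' c; first by rewrite subrr normc0 mul0r.
  have w'c0 : 0 < normc (w' - c) by rewrite normc_gt0 subr_eq0.
  have qL : normc (q w') <= L.
    rewrite normcM normcV ler_pdivrMr//.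
    have := Ht (w' - c) w't; rewrite [c + _]addrC subrK mul1r => h1.
    have := le_normcD (F w' - F c - f c * (w' - c)) (f c * (w' - c)).
    rewrite subrK normcM => /le_trans; apply.
    by rewrite /L mulrDl mul1r addrC lerD2l.
  apply: (@le_lt_trans _ _ (normc (w' - c) * L ^+ n.+1)).
    by rewrite ler_pM2l// lerXn2r ?nnegrE ?normc_ge0 ?(ltW L0).
  by rewrite -ltr_pdivlMr.
have key n : normc (z - c) * normc (q z) ^+ n.+1 <= r * K ^+ n.+1.
  rewrite -normcX -normcM.
  apply: (@max_modulus R (fun w => (w - c) * q w ^+ n.+1) c r) => //.
  - by rewrite mulr_ge0 ?(ltW r0) ?exprn_ge0.
  - exact: cG.
  - move=> w wr; rewrite mulf_eq0 negb_or subr_eq0 => /andP[wc _].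
    by apply: tG => //; exact: lt_trans rr'.
  - move=> w wr; rewrite normcM normcX wr ler_pM2l// lerXn2r ?nnegrE ?normc_ge0//.
    rewrite normcM normcV wr /K ler_pM2r ?invr_gt0//; apply: FB.
    by rewrite wr.
rewrite -/K; have -> : F z - F c = q z * (z - c).
  by rewrite /q divfK// subr_eq0.
rewrite normcM ler_pM2r// leNgt; apply/negP => Kq.
have q0 : 0 < normc (q z) by exact: le_lt_trans Kq.
(* [key] says that |z - c| / r is at most a^(n+1) for every n, which is impossible for [a < 1]. *)
pose a := K / normc (q z).
have a0 : 0 <= a := divr_ge0 K0 (ltW q0).
have a1 : `|a| < 1.
  by rewrite ger0_norm// /a ltr_pdivrMr// mul1r.
have e0 : 0 < normc (z - c) / r by rewrite divr_gt0.
have /cvgrPdist_lt/(_ _ e0) [N _ HN] := cvg_expr a1.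
have := HN N.+1 (leqnSn N); rewrite /= sub0r normrN normrX ger0_norm//.
rewrite /a expr_div_n ltr_pdivrMr ?exprn_gt0// mulrAC ltr_pdivlMr//.
by rewrite [K ^+ _ * r]mulrC ltNge key.
Qed.

Lemma segment_in_disc c z h (t r : R) : 0 <= t <= 1 ->
  normc (z - c) < r -> normc (z + h - c) < r -> normc (z + t%:C * h - c) < r.
Proof.
move=> /andP[t0 t1] h1 h2.
have -> : z + t%:C * h - c = (1 - t)%:C * (z - c) + t%:C * (z + h - c).
  by rewrite rmorphB rmorph1 /=; ring.
apply: le_lt_trans (le_normcD _ _) _; rewrite !normcM !normc_real.
rewrite !ger0_norm ?subr_ge0//.
pose m := Num.max (normc (z - c)) (normc (z + h - c)).
have mr : m < r by rewrite gt_max h1.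
have m1 : 0 <= (1 - t) * (m - normc (z - c)).
  by rewrite mulr_ge0 ?subr_ge0// le_max lexx.
have m2 : 0 <= t * (m - normc (z + h - c)).
  by rewrite mulr_ge0 ?subr_ge0// le_max lexx orbT.
by lra.
Qed.

Lemma lipschitz_limit (A : R -> R[i]) (a : R[i]) (B : R) :
  (exists2 t : R, 0 < t & forall s : R, 0 < s < t -> normc (A s) <= B) ->
  (forall e : R, 0 < e -> exists2 t : R, 0 < t &
     forall s : R, 0 < s < t -> normc (A s - a) <= e) ->
  normc a <= B.
Proof.
move=> [t t0 HB] H; apply/ler_addgt0Pr => e e0.
have [t' t0' HA] := H e e0.
pose s := Num.min t t' / 2.
have m0 : 0 < Num.min t t' by rewrite lt_min t0.
have sm : s < Num.min t t' by rewrite /s; lra.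
have s0 : 0 < s by rewrite /s; lra.
have st : 0 < s < t by rewrite s0 (lt_le_trans sm)// ge_min lexx.
have st' : 0 < s < t' by rewrite s0 (lt_le_trans sm)// ge_min lexx orbT.
have := le_normcB a (A s).
by rewrite normc_dist; have := HB _ st; have := HA _ st'; lra.
Qed.

Lemma diffquot_limit F z d : has_cderiv F z d -> forall e : R, 0 < e ->
  exists2 t : R, 0 < t &
     forall s : R, 0 < s < t -> normc ((F (z + s%:C) - F z) / s%:C - d) <= e.
Proof.
move=> H e /H[t t0 Ht]; exists t => // s /andP[s0 st].
have := Ht s%:C; rewrite normc_real gtr0_norm// => /(_ st) le.
have sC : s%:C != 0 :> R[i] by rewrite -normc_gt0 normc_real normr_gt0 gt_eqF.
rewrite (_ : _ - d = (F (z + s%:C) - F z - d * s%:C) / s%:C); last by field.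
by rewrite normcM normcV normc_real gtr0_norm// ler_pdivrMr.
Qed.

Lemma has_cderiv_diffquot F z h (k a b : R[i]) :
  has_cderiv F (z + h) a -> has_cderiv F z b ->
  has_cderiv (fun w => (F (w + h) - F w) / k) z ((a - b) / k).
Proof.
move=> /has_cderiv_shift H1 /(has_cderivZ (-1)) H2.
have := has_cderivZ k^-1 (has_cderivD H1 H2).
rewrite mulN1r [k^-1 * _]mulrC.
by congr has_cderiv; apply/funext => w; rewrite mulN1r mulrC.
Qed.

(** The maximum principle wants two derivatives and [f] has one. A primitive [F] of [f] has two, and
    so have the difference quotients of [F], which are bounded by [M] and tend to [f].
    [schwarz_lipschitz] applies to them, and its bound survives the limit. *)
Lemma cderivable_lipschitz f f' c (r M : R) : 0 < r ->
  (forall z, normc (z - c) < r -> has_cderiv f z (f' z)) ->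
  (forall z, normc (z - c) < r -> normc (f z) <= M) ->
  forall z, normc (z - c) <= r / 4 ->
    normc (f z - f c) <= 8 * M / r * normc (z - c).
Proof.
move=> r0 Hf fM z zr.
(* Points of the square are at distance at most 2 s = 4 r / 5 < r from [c], and 7 r / 20 + r / 20 =
   s keeps the shifted arguments of the quotients where [F] is a primitive. *)
pose s := 2 * r / 5.
have s0 : 0 < s by rewrite /s; lra.
have Hg (x y : R) : `|x| <= s -> `|y| <= s ->
    has_cderiv (fun w => f (w + c)) (x +i* y) (f' ((x +i* y) + c)).
  move=> xs ys; apply: has_cderiv_shift; apply: Hf; rewrite addrK.
  by apply: (le_lt_trans (normc_le_ReIm _)) => /=; rewrite /s in xs ys; lra.
have [F HF] := @primitive_square R _ (fun w => f' (w + c)) s s0 Hg.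
have HF' w : normc w < s -> has_cderiv F w (f (w + c)).
  case: w => x y xy; apply: HF.
    by apply: le_lt_trans xy; exact: (Re_le_normc (x +i* y)).
  by apply: le_lt_trans xy; exact: (Im_le_normc (x +i* y)).
have r20 : 0 < r / 20 by lra.
have main (h : R) : 0 < h < r / 20 ->
  normc ((F (z - c + h%:C) - F (z - c)) / h%:C - (F (0 + h%:C) - F 0) / h%:C)
   <= 8 * M / r * normc (z - c).
  move=> /andP[h0 hr]; pose G w := (F (w + h%:C) - F w) / h%:C.
  have nh : normc h%:C = h by rewrite normc_real gtr0_norm.
  have hC : h%:C != 0 :> R[i] by rewrite -normc_gt0 nh.
  have := @schwarz_lipschitz G (fun w => (f (w + h%:C + c) - f (w + c)) / h%:C) 0
    (r / 4) (7 * r / 20) M.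
  have -> : 2 * M / (r / 4) = 8 * M / r by field; rewrite gt_eqF.
  move=> S; have {S} := S ltac:(lra) ltac:(lra) _ _ _ (z - c).
  rewrite subr0; apply=> //.
  - move=> w; rewrite subr0 => wr.
    have wh : normc (w + h%:C) < s.
      by apply: le_lt_trans (le_normcD _ _) _; rewrite nh /s; lra.
    have ws : normc w < s by rewrite /s; lra.
    exact: (has_cderiv_diffquot h%:C (HF' _ wh) (HF' _ ws)).
  - move=> w; rewrite subr0 => wr.
    have wh : normc (w + h%:C) < r by apply: le_lt_trans (le_normcD _ _) _; rewrite nh; lra.
    have ws : normc w < r by lra.
    have h1 : has_cderiv (fun w => f (w + c)) (w + h%:C) (f' (w + h%:C + c)).
      by apply: has_cderiv_shift; apply: Hf; rewrite addrK.
    have h2 : has_cderiv (fun w => f (w + c)) w (f' (w + c)).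
      by apply: has_cderiv_shift; apply: Hf; rewrite addrK.
    eexists; exact: (has_cderiv_diffquot h%:C h1 h2).
  - move=> w; rewrite subr0 => wr.
    rewrite /G normcM normcV nh ler_pdivrMr// -[X in _ <= _ * X]nh.
    have ws : normc (w - 0) < s by rewrite subr0 /s; lra.
    have wh : normc (w + h%:C - 0) < s.
      by rewrite subr0; apply: le_lt_trans (le_normcD _ _) _; rewrite nh /s; lra.
    apply: (@cderiv_segment_le _ F (fun w => f (w + c))) => t t01;
      have := segment_in_disc t01 ws wh; rewrite subr0.
      exact: HF'.
    by move=> lt; apply: fM; rewrite addrK; apply: lt_trans lt _; rewrite /s; lra.
have zs : normc (z - c) < s by rewrite /s; lra.
have n0s : normc 0 < s by rewrite normc0.
have l1 := diffquot_limit (HF' _ zs); have l2 := diffquot_limit (HF' _ n0s).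
rewrite subrK in l1; rewrite add0r in l2.
apply: lipschitz_limit; first by exists (r / 20) => //; exact: main.
move=> e e0; have e20 : 0 < e / 2 by lra.
have [t t0 H1] := l1 _ e20; have [t' t0' H2] := l2 _ e20.
exists (Num.min t t') => [|h]; first by rewrite lt_min t0.
rewrite lt_min => /and3P[h0 h1 h2].
have {}H1 := H1 h; have {}H2 := H2 h; rewrite h0 h1 h2 in H1 H2.
set A := _ / _; set B := _ / _.
have -> : A - B - (f z - f c) = (A - f z) - (B - f c) by ring.
apply: le_trans (le_normcD _ _) _; rewrite normcN.
by have := H1 isT; have := H2 isT; rewrite -/A -/B; lra.
Qed.

Lemma cderiv_le_lipschitz f c d (r K : R) : 0 < r -> has_cderiv f c d ->
  (forall z, normc (z - c) <= r -> normc (f z - f c) <= K * normc (z - c)) ->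
  normc d <= K.
Proof.
move=> r0 H HK; apply: lipschitz_limit (diffquot_limit H).
exists r => // s /andP[s0 sr].
rewrite normcM normcV normc_real gtr0_norm// ler_pdivrMr//.
have := HK (c + s%:C); rewrite addrC addKr normc_real gtr0_norm//.
by rewrite addrC; apply; exact: ltW.
Qed.

Lemma cauchy_estimate f f' c (r M : R) : 0 < r ->
  (forall z, normc (z - c) < r -> has_cderiv f z (f' z)) ->
  (forall z, normc (z - c) < r -> normc (f z) <= M) ->
  normc (f' c) <= 8 * M / r.
Proof.
move=> r0 Hf fM; have r40 : 0 < r / 4 by lra.
apply: (cderiv_le_lipschitz r40 (Hf c _) (cderivable_lipschitz r0 Hf fM)).
by rewrite subrr normc0.
Qed.

(** [f'] is not known to be differentiable, so [cderivable_lipschitz] is applied to the difference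
    quotients of [f], on half the radius to leave room for the shift; this turns 8 into 16. *)
Lemma cderiv_lipschitz f f' c (r M : R) : 0 < r ->
  (forall z, normc (z - c) < r -> has_cderiv f z (f' z)) ->
  (forall z, normc (z - c) < r -> normc (f' z) <= M) ->
  forall z, normc (z - c) <= r / 8 ->
    normc (f' z - f' c) <= 16 * M / r * normc (z - c).
Proof.
move=> r0 Hf fM z zr.
have r20 : 0 < r / 2 by lra.
have main (h : R) : 0 < h < r / 2 ->
  normc ((f (z + h%:C) - f z) / h%:C - (f (c + h%:C) - f c) / h%:C)
   <= 16 * M / r * normc (z - c).
  move=> /andP[h0 hr].
  have nh : normc h%:C = h by rewrite normc_real gtr0_norm.
  have := @cderivable_lipschitz (fun w => (f (w + h%:C) - f w) / h%:C)
    (fun w => (f' (w + h%:C) - f' w) / h%:C) c (r / 2) M r20.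
  have -> : 8 * M / (r / 2) = 16 * M / r by field; rewrite gt_eqF.
  have whr w : normc (w - c) < r / 2 -> normc (w + h%:C - c) < r.
    by move=> wr; rewrite addrAC; apply: le_lt_trans (le_normcD _ _) _; rewrite nh; lra.
  apply.
  - move=> w wr; apply: (has_cderiv_diffquot h%:C (Hf _ (whr _ wr))).
    by apply: Hf; lra.
  - move=> w wr.
    rewrite normcM normcV nh ler_pdivrMr// -[X in _ <= _ * X]nh.
    have ws : normc (w - c) < r by lra.
    by apply: (@cderiv_segment_le _ f f') => t t01;
      have := segment_in_disc t01 ws (whr _ wr); [exact: Hf|exact: fM].
  - by lra.
have zs : normc (z - c) < r by lra.
have cs : normc (c - c) < r by rewrite subrr normc0.
have l1 := diffquot_limit (Hf _ zs); have l2 := diffquot_limit (Hf _ cs).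
apply: lipschitz_limit; first by exists (r / 2) => //; exact: main.
move=> e e0; have e20 : 0 < e / 2 by lra.
have [t t0 H1] := l1 _ e20; have [t' t0' H2] := l2 _ e20.
exists (Num.min t t') => [|h]; first by rewrite lt_min t0.
rewrite lt_min => /and3P[h0 h1 h2].
have {}H1 := H1 h; have {}H2 := H2 h; rewrite h0 h1 h2 in H1 H2.
set A := _ / _; set B := _ / _.
have -> : A - B - (f' z - f' c) = (A - f' z) - (B - f' c) by ring.
apply: le_trans (le_normcD _ _) _; rewrite normcN.
by have := H1 isT; have := H2 isT; rewrite -/A -/B; lra.
Qed.

End CauchyEstimates.

(** * Integration over the plane *)

Section PlaneMeasure.
Variable R : realType.
Local Notation mu := (@lebesgue_measure R).

Definition rect (a b c d : R) : set (R * R) := `]a, b[%classic `*` `]c, d[%classic.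

Lemma measurable_rect a b c d : measurable (rect a b c d : set (R * R)).
Proof. by apply: measurableX; exact: measurable_itv. Qed.

(** An open set is the countable union of the rational rectangles that it contains; those not
    contained in it are replaced by [set0], so that the union runs over all rationals. *)
Lemma open_measurable_plane (U : set (R * R)) : open U -> measurable U.
Proof.
move=> oU.
pose F (a b c d : rat) : set (R * R) :=
  if `[< rect (ratr a) (ratr b) (ratr c) (ratr d) `<=` U >]
  then rect (ratr a) (ratr b) (ratr c) (ratr d) else set0.
have -> : U = \bigcup_a \bigcup_b \bigcup_c \bigcup_d F a b c d.
  apply/seteqP; split => [[x y] Uxy|]; last first.
    move=> w [a _ [b _ [c _ [d _]]]]; rewrite /F; case: ifPn => // /asboolP; exact.
  have : nbhs (x, y) U by exact: open_nbhs_nbhs.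
  move=> [[/= A B] [/nbhs_ballP[e /= e0 Ae] /nbhs_ballP[e' /= e'0 Be]] ABU].
  have h1 : x - e < x by lra.
  have h2 : x < x + e by lra.
  have h3 : y - e' < y by lra.
  have h4 : y < y + e' by lra.
  have [a] := rat_in_itvoo h1; rewrite in_itv /= => /andP[a1 a2].
  have [b] := rat_in_itvoo h2; rewrite in_itv /= => /andP[b1 b2].
  have [c] := rat_in_itvoo h3; rewrite in_itv /= => /andP[c1 c2].
  have [d] := rat_in_itvoo h4; rewrite in_itv /= => /andP[d1 d2].
  exists a => //; exists b => //; exists c => //; exists d => //; rewrite /F asboolT.
    by split; rewrite /= in_itv /= ?a2 ?b1 ?c2 ?d1.
  move=> [x' y'] [/=]; rewrite !in_itv /= => /andP[xa xb] /andP[yc yd].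
  apply: ABU; split => /=.
    by apply: Ae; rewrite -ball_normE /= ltr_norml; lra.
  by apply: Be; rewrite -ball_normE /= ltr_norml; lra.
do 4! (apply: bigcupT_measurable_rat => ?); rewrite /F; case: ifP => _ //.
exact: measurable_rect.
Qed.

Definition pl (w : R * R) : R[i] := w.1 +i* w.2.

Lemma open_ucont_measurable (D : set R[i]) (u : R[i] -> R) :
  (forall z, D z -> exists2 t : R, 0 < t & forall w, normc (w - z) < t -> D w) ->
  (forall z, D z -> ucont_at u z) ->
  measurable (pl @^-1` D) /\ measurable_fun (pl @^-1` D) (fun w => u (pl w)).
Proof.
move=> oD cu.
have op (P : set R[i]) :
  (forall z, P z -> exists2 t : R, 0 < t & forall w, normc (w - z) < t -> P w) ->
  open (pl @^-1` P).
  move=> H; rewrite openE => -[x y] /= /H[t t0 Ht].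
  have t20 : 0 < t / 2 by lra.
  exists (ball x (t / 2), ball y (t / 2)); first by split; exact: nbhsx_ballx.
  move=> [x' y'] [] /=; rewrite -!ball_normE /= => h1 h2; apply: Ht.
  apply: (le_lt_trans (normc_le_ReIm _)) => /=.
  by rewrite (distrC x') (distrC y'); lra.
have mD : measurable (pl @^-1` D) by apply: open_measurable_plane; exact: op.
split => //; apply: (measurability _ (RGenOInfty.measurableE R)) => //.
move=> /= _ [_ [a ->]] <-; apply: open_measurable_plane.
rewrite preimage_itvoy; apply: (op [set z | D z /\ a < u z]) => z [Dz az].
have [t t0 Ht] := oD _ Dz.
have e0 : 0 < u z - a by rewrite subr_gt0.
have [t' t'0 Ht'] := cu _ Dz _ e0.
exists (Num.min t t') => [|w]; first by rewrite lt_min t0.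
rewrite lt_min => /andP[/Ht Dw /Ht']; rewrite ltr_norml => /andP[h _].
by split => //; lra.
Qed.

Definition cmeas (h : R[i] -> \bar R) := measurable_fun [set: R * R] (h \o pl).

Definition aint (h : R[i] -> \bar R) : \bar R := (\int[mu \x mu]_w h (pl w))%E.

Lemma cmeas_ucont (u : R[i] -> R) : (forall z, ucont_at u z) ->
  cmeas (fun z => (u z)%:E).
Proof.
move=> cu; apply/measurable_EFinP.
have H (z : R[i]) : setT z -> exists2 t : R, 0 < t &
    forall w, normc (w - z) < t -> [set: R[i]] w by move=> _; exists 1.
by have [_] := open_ucont_measurable H (fun z _ => cu z).
Qed.

Lemma lebesgue_measure_translate (c : R) (A : set R) : measurable A ->
  pushforward mu ((fun x => x + c) : _ -> measurableTypeR R) A = mu A.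
Proof.
have mc : measurable_fun setT ((fun x => x + c) : R -> measurableTypeR R).
  by apply: measurable_funD => //; exact: measurable_id.
move=> mA; apply/esym/lebesgue_measure_unique => //= _ [[a b]] _ <-.
rewrite /pushforward.
have -> : (fun x => x + c) @^-1` [set` `]a, b]] = [set` `](a - c), (b - c)]].
  by apply/seteqP; split => x /=; rewrite !in_itv /=; lra.
rewrite !lebesgue_measure_itv /= !lte_fin ltrD2r.
by case: ifP => // _; rewrite -!EFinB; congr EFin; ring.
Qed.

Lemma integral_translate (c : R) (f : R -> \bar R) :
  measurable_fun setT f -> (forall x, 0 <= f x)%E ->
  (\int[mu]_x f (x + c)%R = \int[mu]_x f x)%E.
Proof.
move=> mf f0.
have mc : measurable_fun setT ((fun x => x + c) : R -> measurableTypeR R).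
  by apply: measurable_funD => //; exact: measurable_id.
transitivity (\int[pushforward mu ((fun x => x + c)%R : _ -> measurableTypeR R)]_x f x)%E.
  by rewrite ge0_integral_pushforward//=.
by apply: eq_measure_integral => //= A mA _; exact: lebesgue_measure_translate.
Qed.

(** On each horizontal line a shear is a translation, so Tonelli's theorem reduces the claim to
    [integral_translate]. *)
Lemma integral_shear_x (t : R) (h : R * R -> \bar R) :
  measurable_fun setT h -> (forall w, 0 <= h w)%E ->
  (\int[mu \x mu]_w h (w.1 + t * w.2, w.2)%R = \int[mu \x mu]_w h w)%E.
Proof.
move=> mh h0.
have ms : measurable_fun setT (fun w : R * R => (w.1 + t * w.2, w.2)).
  apply: measurable_fun_pair => //.
  by apply: measurable_funD => //; exact: measurable_funM.
have mhs : measurable_fun setT (fun w : R * R => h (w.1 + t * w.2, w.2)).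
  exact: (measurableT_comp mh ms).
rewrite [LHS]fubini_tonelli2// [RHS]fubini_tonelli2//.
apply: eq_integral => y _; rewrite /fubini_G /=.
apply: (@integral_translate (t * y) (fun x => h (x, y))) => //.
by apply: measurableT_comp => //; exact: measurable_pair2.
Qed.

Lemma integral_shear_y (t : R) (h : R * R -> \bar R) :
  measurable_fun setT h -> (forall w, 0 <= h w)%E ->
  (\int[mu \x mu]_w h (w.1, w.2 + t * w.1)%R = \int[mu \x mu]_w h w)%E.
Proof.
move=> mh h0.
have ms : measurable_fun setT (fun w : R * R => (w.1, w.2 + t * w.1)).
  apply: measurable_fun_pair => //.
  by apply: measurable_funD => //; exact: measurable_funM.
have mhs : measurable_fun setT (fun w : R * R => h (w.1, w.2 + t * w.1)).
  exact: (measurableT_comp mh ms).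
rewrite [LHS]fubini_tonelli1// [RHS]fubini_tonelli1//.
apply: eq_integral => x _; rewrite /fubini_F /=.
apply: (@integral_translate (t * x) (fun y => h (x, y))) => //.
by apply: measurableT_comp => //; exact: measurable_pair1.
Qed.

End PlaneMeasure.

(** * Area integrals and their invariance under rotations *)

Section PlaneIntegral.
Variable R : realType.
Local Notation mu := (@lebesgue_measure R).
Implicit Types (u v : R[i] -> R) (h : R[i] -> \bar R).

Definition rmeas u := measurable_fun [set: R * R] (u \o @pl R).

Lemma rmeas_EFin u : rmeas u -> cmeas (EFin \o u).
Proof. by move=> mu_; apply/measurable_EFinP. Qed.

Lemma rmeas_ucont u : (forall z, ucont_at u z) -> rmeas u.
Proof. by move=> /cmeas_ucont/measurable_EFinP. Qed.

Lemma rmeasM u v : rmeas u -> rmeas v -> rmeas (fun z => u z * v z).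
Proof. exact: measurable_funM. Qed.

Lemma rmeasD u v : rmeas u -> rmeas v -> rmeas (fun z => u z + v z).
Proof. exact: measurable_funD. Qed.

Lemma rmeas_cst (k : R) : rmeas (fun=> k).
Proof. exact: measurable_cst. Qed.

Lemma rmeas_comp (p : R -> R) u : measurable_fun setT p -> rmeas u ->
  rmeas (fun z => p (u z)).
Proof. by move=> mp mu_; exact: (measurableT_comp mp mu_). Qed.

Lemma rmeas_normc_sub (c : R[i]) : rmeas (fun z => normc (z - c)).
Proof. by apply: rmeas_ucont => z; exact: ucont_normc_sub. Qed.

Lemma rmeas_normc : rmeas (@normc R).
Proof.
have := rmeas_normc_sub 0; congr rmeas; apply/funext => z; by rewrite subr0.
Qed.

Lemma rmeas_powR (p : R) u : rmeas u -> rmeas (fun z => u z `^ p).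
Proof. exact: (@rmeas_comp (fun x => x `^ p)) (measurable_powR _). Qed.

Lemma le_aint u v : rmeas u -> rmeas v -> (forall z, 0 <= u z) ->
  (forall z, u z <= v z) -> (aint (EFin \o u) <= aint (EFin \o v))%E.
Proof.
move=> mu_ mv u0 uv; apply: ge0_le_integral => //.
- by move=> w _; rewrite lee_fin.
- exact: (rmeas_EFin mu_).
- exact: (rmeas_EFin mv).
- by move=> w _; rewrite lee_fin.
Qed.

Lemma aintZl (k : R) u : 0 <= k -> rmeas u -> (forall z, 0 <= u z) ->
  aint (fun z => (k * u z)%:E) = (k%:E * aint (EFin \o u))%E.
Proof.
move=> k0 mu_ u0; rewrite /aint -ge0_integralZl//.
  exact: (rmeas_EFin mu_).
by move=> w _; rewrite lee_fin.
Qed.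

Lemma aintD u v : rmeas u -> rmeas v -> (forall z, 0 <= u z) -> (forall z, 0 <= v z) ->
  aint (fun z => (u z + v z)%:E) = (aint (EFin \o u) + aint (EFin \o v))%E.
Proof.
move=> mu_ mv u0 v0; rewrite /aint -ge0_integralD//; try (by move=> w _; rewrite lee_fin);
  by [exact: (rmeas_EFin mu_)|exact: (rmeas_EFin mv)].
Qed.

Lemma cmeas_rotate (om : R[i]) h : cmeas h -> cmeas (fun z => h (om * z)).
Proof.
case: om => c s mh.
have ms : measurable_fun setT (fun w : R * R => (c * w.1 - s * w.2, c * w.2 + s * w.1)).
  by apply: measurable_fun_pair; apply: measurable_funD => //;
    try apply: measurable_funN; exact: measurable_funM.
exact: (measurableT_comp mh ms).
Qed.

(* A plane rotation is a product of three shears. *)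
Lemma aint_rotate (om : R[i]) h : normc om = 1 -> cmeas h -> (forall z, 0 <= h z)%E ->
  aint (fun z => h (om * z)) = aint h.
Proof.
have main (c s : R) k : c ^+ 2 + s ^+ 2 = 1 -> s != 0 -> cmeas k -> (forall z, 0 <= k z)%E ->
    aint (fun z => k ((c +i* s) * z)) = aint k.
  (* If theta is the argument of [c +i* s], then [t] is - tan (theta / 2). *)
  move=> cs s0 mk k0; pose t := (c - 1) / s.
  pose X (w : R * R) := (w.1 + t * w.2, w.2); pose Y (w : R * R) := (w.1, w.2 + s * w.1).
  have mX : measurable_fun setT X.
    apply: measurable_fun_pair => //.
    by apply: measurable_funD => //; exact: measurable_funM.
  have mY : measurable_fun setT Y.
    apply: measurable_fun_pair => //.
    by apply: measurable_funD => //; exact: measurable_funM.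
  have mkX : measurable_fun setT ((k \o @pl R) \o X) by exact: measurableT_comp.
  have mkXY : measurable_fun setT (((k \o @pl R) \o X) \o Y) by exact: measurableT_comp.
  rewrite /aint.
  transitivity (\int[mu \x mu]_w ((k \o @pl R) \o X \o Y) (X w))%E.
    apply: eq_integral => -[x y] _ /=; congr k.
    rewrite /pl /X /Y /=; apply/eqP; rewrite eq_complex /=; apply/andP; split; apply/eqP.
      rewrite /t; apply: (mulfI s0).
      have -> : s * (c * x - s * y) = s * c * x - (1 - c ^+ 2) * y.
        by rewrite -cs; ring.
      by field.
    by rewrite /t; field.
  rewrite (integral_shear_x t mkXY); last by move=> w; exact: k0.
  rewrite (integral_shear_y s mkX); last by move=> w; exact: k0.
  by rewrite (integral_shear_x t mk)// => w; exact: k0.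
case: om => c s n1 mh h0.
have cs : c ^+ 2 + s ^+ 2 = 1 by have := sqr_normcE (c +i* s); rewrite n1 expr1n.
(* For [s = 0] the quotient [t] makes no sense; the rotation is then the identity or, being -1,
   twice the rotation by ['i]. *)
have [s0|s0] := eqVneq s 0; last exact: main.
have i01 : (0 : R) ^+ 2 + 1 ^+ 2 = 1 by rewrite expr0n expr1n add0r.
have fac (a b : R) : a ^+ 2 + b ^+ 2 = 1 -> b = 0 -> (a - 1) * (a + 1) = 0.
  by move=> + b0; rewrite b0 expr0n addr0 => a2; rewrite -subr_sqr expr1n a2 subrr.
have := fac _ _ cs s0.
move=> /eqP; rewrite mulf_eq0 subr_eq0 addr_eq0 => /orP[/eqP c1|/eqP c1].
  rewrite c1 s0; congr (aint _); apply/funext => z; congr h.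
  by have -> : 1 +i* 0 = 1 :> R[i] by []; rewrite mul1r.
rewrite -(main 0 1 h i01 (oner_neq0 _) mh h0).
rewrite -(main 0 1 _ i01 (oner_neq0 _) (cmeas_rotate (0 +i* 1) mh)) => [|z]; last exact: h0.
congr (aint _); apply/funext => -[x y]; congr h; rewrite c1 s0.
by apply/eqP; rewrite eq_complex /=; apply/andP; split; apply/eqP; ring.
Qed.

End PlaneIntegral.

(** * Integrals of the kernel |1 - conj(a) z|^-2 *)

Section Shells.
Variable R : realType.
Local Notation mu := (@lebesgue_measure R).
Implicit Types (u v : R[i] -> R) (h : R[i] -> \bar R).

(** The indicator of the annulus 1 - rho <= |z| < 1, written through [1 - normc z] so that
    measurability follows by composition. *)
Definition shell (rho : R) (z : R[i]) : R := \1_(`]0, rho]%classic) (1 - normc z).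

Lemma shellE rho z : shell rho z = ((0 < 1 - normc z) && (1 - normc z <= rho))%:R.
Proof. by rewrite /shell indicE; congr (_ %:R); rewrite mem_setE in_itv. Qed.

Lemma shell_ge0 rho z : 0 <= shell rho z.
Proof. by rewrite shellE ler0n. Qed.

Lemma rmeas_shell rho : rmeas (shell rho).
Proof.
apply: (@rmeas_comp R (fun x => \1_(`]0, rho]%classic) (1 - x)) (@normc R)); last exact: rmeas_normc.
have m1 : measurable_fun setT (\1_(`]0, rho]%classic) : R -> R).
  by apply: measurable_indic; exact: measurable_itv.
by apply: (measurableT_comp m1); exact: measurable_funB.
Qed.

Lemma rmeas_Re : rmeas (@complex.Re R).
Proof. exact: measurable_fst. Qed.

Lemma rmeas_Im : rmeas (@complex.Im R).
Proof. exact: measurable_snd. Qed.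

(** Near the top and the bottom of the circle a horizontal section of the annulus can have length of
    order sqrt(rho). This double sector avoids these places, and its image under a quarter turn
    covers the rest of the plane. *)
Let wedge (z : R[i]) : R := \1_(`[0, +oo[%classic) (`|Re z| - `|Im z|).

Let wedgeE z : wedge z = (`|Im z| <= `|Re z|)%R%:R.
Proof. by rewrite /wedge indicE mem_setE in_itv /= andbT subr_ge0. Qed.

Let rmeas_wedge : rmeas wedge.
Proof.
apply: (@rmeas_comp R (\1_(`[0, +oo[%classic)) (fun z => `|Re z| - `|Im z|)).
  by apply: measurable_indic; exact: measurable_itv.
apply: measurable_funB.
  by apply: (@rmeas_comp R (@Num.norm _ R) (@complex.Re R)); [exact: normr_measurable|exact: rmeas_Re].
by apply: (@rmeas_comp R (@Num.norm _ R) (@complex.Im R)); [exact: normr_measurable|exact: rmeas_Im].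
Qed.

Lemma integral_indic_itv (a b : R) : a <= b ->
  (\int[mu]_x (\1_(`[a, b]%classic) x)%:E = (b - a)%:E)%E.
Proof.
move=> ab; rewrite integral_indic ?setIT//.
rewrite [LHS](@lebesgue_measure_itv R `[a, b]) /= lte_fin -EFinB.
by case: ltgtP ab => // -> _; rewrite subrr.
Qed.

Lemma indic_ge0 T (A : set T) (x : T) : 0 <= \1_A x :> R.
Proof. by rewrite indicE ler0n. Qed.

Lemma integral_indic_itvZ (k a b : R) : 0 <= k -> a <= b ->
  (\int[mu]_x (k * \1_(`[a, b]%classic) x)%:E = (k * (b - a))%:E)%E.
Proof.
move=> k0 ab; under eq_integral do rewrite EFinM.
rewrite ge0_integralZl//.
- by rewrite integral_indic_itv// -EFinM.
- by apply/measurable_EFinP; apply: measurable_indic; exact: measurable_itv.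
Qed.

(** Here |x| >= 1/3, as otherwise |z|^2 < 2/9 < (1 - rho)^2. Since x^2 varies by at most 2 rho, |x|
    varies by at most 3 rho, and x lies in two intervals of length 6 rho. *)
Let wedge_section (rho y : R) : 0 < rho <= 1 / 2 ->
  (\int[mu]_x (shell rho (x +i* y) * wedge (x +i* y))%:E <=
   (12 * rho * \1_(`[(-1)%R, 1%R]%classic) y)%:E)%E.
Proof.
move=> /andP[r0 r1].
have mS : measurable_fun setT (fun x => (shell rho (x +i* y) * wedge (x +i* y))%:E).
  have mw := rmeas_EFin (rmeasM (rmeas_shell rho) rmeas_wedge).
  have my : measurable_fun setT (fun x : R => (x, y)) by exact: measurable_pair2.
  have H := measurableT_comp mw my; exact: H.
have [[x1 Sx1]|noS] := pselect (exists x1, shell rho (x1 +i* y) * wedge (x1 +i* y) != 0); last first.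
  rewrite integral0_eq ?lee_fin ?mulr_ge0 ?indicE//; first by lra.
  by move=> x _; apply/eqP; rewrite eqe; apply/negP => H; apply: noS; exists x; apply/negP.
have S x : shell rho (x +i* y) * wedge (x +i* y) != 0 ->
    [/\ (1 - rho) ^+ 2 <= x ^+ 2 + y ^+ 2, x ^+ 2 + y ^+ 2 < 1 & 1 / 3 <= `|x|].
  rewrite mulf_eq0 negb_or shellE wedgeE !pnatr_eq0 !eqb0 !negbK => /andP[/andP[n1 n2]] /= yx.
  have n0 := normc_ge0 (x +i* y).
  have nE : normc (x +i* y) ^+ 2 = x ^+ 2 + y ^+ 2 by rewrite sqr_normcE.
  have h1 : (1 - rho) ^+ 2 <= x ^+ 2 + y ^+ 2.
    by rewrite -nE lerXn2r ?nnegrE//; lra.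
  have h2 : x ^+ 2 + y ^+ 2 < 1.
    by rewrite -nE expr_lt1//; lra.
  split => //; rewrite leNgt; apply/negP => x3.
  have y3 : `|y| < 1 / 3 by apply: le_lt_trans yx x3.
  have e (t : R) : `|t| < 1 / 3 -> t ^+ 2 < 1 / 9.
    rewrite -real_normK ?num_real// => t3.
    have -> : 1 / 9 = (1 / 3) ^+ 2 :> R by field.
    by rewrite ltrXn2r//; lra.
  have := e _ x3; have := e _ y3.
  have : (1 / 2) ^+ 2 <= (1 - rho) ^+ 2 by rewrite !expr2; nra.
  by lra.
have close x : shell rho (x +i* y) * wedge (x +i* y) != 0 -> `| `|x| - `|x1| | <= 3 * rho.
  move=> /S [a1 a2 a3]; have [b1 b2 b3] := S _ Sx1.
  have : `|x| ^+ 2 - `|x1| ^+ 2 <= 2 * rho by rewrite !real_normK ?num_real//; nra.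
  have : `|x1| ^+ 2 - `|x| ^+ 2 <= 2 * rho by rewrite !real_normK ?num_real//; nra.
  rewrite !subr_sqr; move: `|x| `|x1| a3 b3 => p q p3 q3 h1 h2.
  by rewrite ler_norml; apply/andP; split; nra.
have y1 : \1_(`[(-1)%R, 1%R]%classic) y = 1 :> R.
  rewrite indicE mem_setE in_itv /= -ler_norml.
  have [_ b2 _] := S _ Sx1; rewrite (_ : (_ <= _) = true)//.
  by rewrite -(@expr_le1 _ 2)// real_normK ?num_real//; have := sqr_ge0 x1; lra.
have cover (p q : R) : `| `|p| - `|q| | <= 3 * rho ->
    1 <= (q - 3 * rho <= p <= q + 3 * rho)%R%:R
         + (- q - 3 * rho <= p <= - q + 3 * rho)%R%:R :> R.
  case: (ger0P p) => p0; case: (ger0P q) => q0; rewrite ler_norml => /andP[c1 c2].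
  - have -> : q - 3 * rho <= p <= q + 3 * rho by apply/andP; split; lra.
    by rewrite lerDl ler0n.
  - have -> : - q - 3 * rho <= p <= - q + 3 * rho by apply/andP; split; lra.
    by rewrite lerDr ler0n.
  - have -> : - q - 3 * rho <= p <= - q + 3 * rho by apply/andP; split; lra.
    by rewrite lerDr ler0n.
  - have -> : q - 3 * rho <= p <= q + 3 * rho by apply/andP; split; lra.
    by rewrite lerDl ler0n.
rewrite y1 mulr1.
pose I1 := `[x1 - 3 * rho, x1 + 3 * rho]%classic.
pose I2 := `[- x1 - 3 * rho, - x1 + 3 * rho]%classic.
apply: (@le_trans _ _ (\int[mu]_x ((\1_I1 x)%:E + (\1_I2 x)%:E))%E).
  apply: ge0_le_integral => //.
  - by move=> x _; rewrite lee_fin mulr_ge0 ?shell_ge0// wedgeE ler0n.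
  - apply: emeasurable_funD; apply/measurable_EFinP; apply: measurable_indic; exact: measurable_itv.
  - move=> x _; rewrite -EFinD lee_fin.
    have [->|nz] := eqVneq (shell rho (x +i* y) * wedge (x +i* y)) 0.
      by rewrite addr_ge0 // indicE ler0n.
    have := close _ nz; rewrite shellE wedgeE -natrM mulnb.
    set b := nat_of_bool _; have b1 : b%:R <= 1 :> R by rewrite lern1 leq_b1.
    move=> c; apply: (le_trans b1).
    by rewrite !indicE !mem_setE !in_itv /=; exact: cover.
rewrite ge0_integralD//=.
- rewrite !integral_indic_itv; [|lra|lra].
  by rewrite -EFinD lee_fin; lra.
- apply/measurable_EFinP; apply: measurable_indic; exact: measurable_itv.
- apply/measurable_EFinP; apply: measurable_indic; exact: measurable_itv.
Qed.

(** Integrating [wedge_section] over -1 <= y <= 1 gives 24 rho for the double sector, and the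
    quarter turn doubles it. For rho > 1/2 the square of area 4 around the disc is enough. *)
Lemma aint_shell rho : 0 < rho -> (aint (EFin \o shell rho) <= (48 * rho)%:E)%E.
Proof.
move=> r0; have [r1|r1] := lerP rho (1 / 2); last first.
  apply: (@le_trans _ _ (aint (fun z => (\1_(`[(-1)%R, 1%R]%classic) (Re z) * \1_(`[(-1)%R, 1%R]%classic) (Im z))%:E))%E).
    have m1 : measurable_fun setT (\1_(`[(-1)%R, 1%R]%classic) : R -> R).
      by apply: measurable_indic; exact: measurable_itv.
    apply: (@le_aint R _ (fun z => \1_(`[(-1)%R, 1%R]%classic) (Re z) * \1_(`[(-1)%R, 1%R]%classic) (Im z))).
    - exact: rmeas_shell.
    - exact: (rmeasM (rmeas_comp m1 rmeas_Re) (rmeas_comp m1 rmeas_Im)).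
    - exact: shell_ge0.
    - move=> z; rewrite shellE !indicE !mem_setE !in_itv /= -natrM mulnb ler_nat.
      case: (_ && _) / andP => // -[n1 n2].
      rewrite -!ler_norml (le_trans (Re_le_normc _)) ?(le_trans (Im_le_normc _))//; lra.
  rewrite /aint fubini_tonelli1//=; last first.
    have m1 : measurable_fun setT (\1_(`[(-1)%R, 1%R]%classic) : R -> R).
      by apply: measurable_indic; exact: measurable_itv.
    apply: (@rmeas_EFin R (fun z => \1_(`[(-1)%R, 1%R]%classic) (Re z) * \1_(`[(-1)%R, 1%R]%classic) (Im z))).
    exact: (rmeasM (rmeas_comp m1 rmeas_Re) (rmeas_comp m1 rmeas_Im)).
  rewrite /fubini_F /=.
  apply: (@le_trans _ _ (\int[mu]_x (2 * \1_(`[(-1)%R, 1%R]%classic) x)%:E)%E); last first.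
    by rewrite integral_indic_itvZ ?lee_fin; lra.
  rewrite le_eqVlt; apply/orP; left; apply/eqP; apply: eq_integral => x _ /=.
  by rewrite (integral_indic_itvZ (indic_ge0 _ _)); [congr EFin; lra|lra].
pose q z := shell rho z * wedge z.
have mq : rmeas q by apply: rmeasM; [exact: rmeas_shell|exact: rmeas_wedge].
have q0 z : 0 <= q z by rewrite mulr_ge0 ?shell_ge0// wedgeE ler0n.
have i1 : normc ('i : R[i]) = 1 by rewrite /= expr0n expr1n add0r sqrtr1.
have aq : (aint (EFin \o q) <= (24 * rho)%:E)%E.
  have qw0 w : (0 <= ((EFin \o q) \o @pl R) w)%E by rewrite lee_fin.
  rewrite /aint [leLHS](@fubini_tonelli2 _ _ _ _ R mu mu _ (rmeas_EFin mq) qw0) /fubini_G.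
  apply: (@le_trans _ _ (\int[mu]_y (12 * rho * \1_(`[(-1)%R, 1%R]%classic) y)%:E)%E).
    apply: ge0_le_integral => //.
    - by move=> y _; apply: integral_ge0 => x _; rewrite lee_fin q0.
    - exact: (@measurable_fun_fubini_tonelli_G _ _ _ _ R mu _ (rmeas_EFin mq) qw0).
    - have m1 : measurable_fun setT (\1_(`[(-1)%R, 1%R]%classic) : R -> R).
        by apply: measurable_indic; exact: measurable_itv.
      apply/measurable_EFinP.
      exact: (measurable_funM (measurable_cst (12 * rho)) m1).
    - by move=> y _; apply: wedge_section; rewrite r0.
  by rewrite integral_indic_itvZ ?lee_fin; lra.
have mqi : rmeas (fun z => q ('i * z)).
  by apply/measurable_EFinP; exact: (cmeas_rotate _ (rmeas_EFin mq)).
apply: (@le_trans _ _ (aint (fun z => (q z + q ('i * z))%:E))%E).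
  apply: (@le_aint R (shell rho) (fun z => q z + q ('i * z)) (rmeas_shell rho)
    (rmeasD mq mqi) (shell_ge0 rho)).
    move=> z; rewrite /q.
    have -> : shell rho ('i * z) = shell rho z by rewrite !shellE normcM i1 mul1r.
    rewrite -mulrDr ler_peMr ?shell_ge0// !wedgeE.
    case: z => x y /=; rewrite !mul0r !mul1r sub0r add0r normrN.
    by case: (lerP `|y| `|x|) => [_|/ltW ->]; rewrite ?lerDl ?lerDr ?ler0n.
rewrite aintD//.
have -> : aint (EFin \o (fun z => q ('i * z))) = aint (EFin \o q).
  by apply: (@aint_rotate R 'i (EFin \o q)) => //; exact: rmeas_EFin.
apply: (le_trans (leeD aq aq)); rewrite -EFinD lee_fin; lra.
Qed.

End Shells.

(** * The kernel on shells, by averaging over dyadic rotations *)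

Section KernelEstimates.
Variable R : realType.
Implicit Types (u v : R[i] -> R) (a z : R[i]).

Definition kern a z : R := normc (1 - a^* * z).

Lemma rmeas_normc_has_cderiv (f : R[i] -> R[i]) :
  (forall z, exists d, has_cderiv f z d) -> rmeas (fun z => normc (f z)).
Proof.
move=> H; apply: rmeas_ucont => z; have [d Hd] := H z.
exact: ucont_has_cderiv_normc Hd.
Qed.

Lemma has_cderiv_affine (b c : R[i]) z : has_cderiv (fun w => b + c * w) z c.
Proof.
have := has_cderivD (has_cderiv_cst b z) (has_cderivZ c (has_cderiv_id z)).
by rewrite add0r mulr1.
Qed.

Lemma rmeas_kern a : rmeas (kern a).
Proof.
apply: (@rmeas_normc_has_cderiv (fun z => 1 - a^* * z)) => z; exists (- a^*).
by under eq_fun do rewrite -mulNr; exact: has_cderiv_affine.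
Qed.

Lemma kern_ge0 a z : 0 <= kern a z.
Proof. exact: normc_ge0. Qed.

Lemma kern_ge a z : 1 - normc a * normc z <= kern a z.
Proof.
have := le_normcB 1 (a^* * z).
by rewrite normcM normc_conj [normc 1](normc1 R).
Qed.

Lemma normcD_sqr (b c : R[i]) :
  normc (b - c) ^+ 2 + normc (b + c) ^+ 2 = 2 * (normc b ^+ 2 + normc c ^+ 2).
Proof. by rewrite !sqr_normcE; case: b c => [? ?] [? ?] /=; ring. Qed.

(** Rotating z by [om] changes the sign of the 2^m-th power of conj(a) z: this is the symmetry that
    [kernel_shell] averages over. *)
Lemma root_of_minus_one m : exists2 om : R[i], normc om = 1 & om ^+ (2 ^ m) = -1.
Proof.
elim: m => [|m [om om1 omE]].
  by exists (-1); rewrite ?normcN ?expr1//; exact: normc1.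
exists (sqrtc om); last by rewrite expnS exprM sqr_sqrtc.
have : normc (sqrtc om) ^+ 2 = 1 by rewrite -normcX sqr_sqrtc.
by move/eqP; rewrite sqrf_eq1 => /orP[/eqP//|/eqP H]; have := normc_ge0 (sqrtc om); rewrite H; lra.
Qed.

(** The geometric sum 1 + x + ... + x^(2^m - 1) in factored form, with one factor for each averaging
    step. *)
Fixpoint dyadic_sum (m : nat) (x : R) : R :=
  if m is n.+1 then dyadic_sum n x * (1 + x ^+ (2 ^ n)) else 1.

Lemma dyadic_sumE m x : dyadic_sum m x * (1 - x) = 1 - x ^+ (2 ^ m).
Proof.
elim: m => [|m IH] /=; first by rewrite mul1r expr1.
by rewrite mulrAC IH expnS mulnC exprM; ring.
Qed.

Lemma dyadic_sum_ge0 m x : 0 <= x -> 0 <= dyadic_sum m x.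
Proof.
move=> x0; elim: m => [|m IH] /=; first exact: ler01.
by rewrite mulr_ge0// addr_ge0// exprn_ge0.
Qed.

Lemma measurable_dyadic_sum m : measurable_fun setT (dyadic_sum m).
Proof.
elim: m => [|m IH] /=; first exact: measurable_cst.
apply: measurable_funM => //; apply: measurable_funD => //.
Qed.


Lemma aint_mean u v : rmeas u -> rmeas v -> (forall z, 0 <= u z) ->
  (forall z, 0 <= v z) -> aint (EFin \o v) = aint (EFin \o u) ->
  aint (fun z => (2^-1 * (u z + v z))%:E) = aint (EFin \o u).
Proof.
move=> mu mv u0 v0 E; have half0 : 0 <= 2^-1 :> R by lra.
rewrite (@aintZl R 2^-1 (fun z => u z + v z) half0 (rmeasD mu mv)); last first.
  by move=> z; rewrite addr_ge0.
have -> : EFin \o (fun z => u z + v z) = fun z => (u z + v z)%:E by [].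
rewrite (aintD mu mv u0 v0) E.
rewrite -{1}[aint (EFin \o u)]mul1e -{2}[aint (EFin \o u)]mul1e.
rewrite -ge0_muleDl ?lee_fin//.
have h : 2^-1 * (1 + 1) = 1 :> R by field.
by rewrite muleA -EFinD -EFinM h mul1e.
Qed.

(** With b = conj(a) z, the mean of |1 - b|^-2 and |1 + b|^-2 is (1 + |b|^2) |1 - b^2|^-2, by the
    parallelogram law. Repeating this with b^2, b^4, ... and using that shells are invariant under
    rotations, one finds that all the [G m] have the same integral. The collected factor is at most
    1 / (1 - |a|); once |a|^(2^m) <= 1/2 the remaining kernel is at most 4. Together with the area
    bound 48 rho this gives 192. *)
Lemma kernel_shell a rho : normc a < 1 -> 0 < rho ->
  (aint (fun z => (shell rho z * kern a z `^ (- 2%:R))%:E) <=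
   (192 * rho / (1 - normc a))%:E)%E.
Proof.
move=> a1 r0.
pose b z := a^* * z.
pose G m z := shell rho z * (dyadic_sum m (normc (b z) ^+ 2) *
   normc (1 - b z ^+ (2 ^ m)) `^ (- 2%:R)).
have G0 m z : 0 <= G m z.
  by rewrite mulr_ge0 ?shell_ge0// mulr_ge0 ?powR_ge0// dyadic_sum_ge0// sqr_ge0.
have mG m : rmeas (G m).
  apply: rmeasM; first exact: rmeas_shell.
  apply: rmeasM.
    apply: (@rmeas_comp R (fun x => dyadic_sum m (x ^+ 2)) (fun z => normc (b z))).
      by apply: (measurableT_comp (measurable_dyadic_sum m)); exact: exprn_measurable.
    apply: rmeas_normc_has_cderiv => z; exists a^*.
    by have := has_cderiv_affine 0 a^* z; under eq_fun do rewrite add0r.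
  apply: rmeas_powR; apply: rmeas_normc_has_cderiv => z.
  have Hb : has_cderiv b z a^*.
    by have := has_cderiv_affine 0 a^* z; under eq_fun do rewrite add0r.
  have := has_cderivX (2 ^ m).-1 Hb; rewrite prednK ?expn_gt0// => H.
  have := has_cderivD (has_cderiv_cst 1 z) (has_cderivZ (-1) H).
  under eq_fun do rewrite mulN1r.
  by move=> H'; eexists; exact: H'.
have key0 (s A B C : R) : s = 0 -> s * A = 2^-1 * (s * B + s * C).
  by move=> ->; rewrite !mul0r addr0 mulr0.
have step m : aint (EFin \o G m.+1) = aint (EFin \o G m).
  have [om om1 omE] := root_of_minus_one m.
  have mGo : rmeas (fun z => G m (om * z)).
    by apply/measurable_EFinP; exact: (cmeas_rotate _ (rmeas_EFin (mG m))).
  have -> : aint (EFin \o G m.+1) = aint (fun z => (2^-1 * (G m z + G m (om * z)))%:E).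
    congr (aint _); apply/funext => z /=; congr EFin; rewrite /G.
    have -> : shell rho (om * z) = shell rho z by rewrite !shellE normcM om1 mul1r.
    have bo : b (om * z) = om * b z by rewrite /b mulrCA.
    have -> : normc (b (om * z)) = normc (b z) by rewrite bo normcM om1 mul1r.
    have [sz|nz] := eqVneq (shell rho z) 0; first exact: key0.
    have z1 : normc z < 1.
      by move: nz; rewrite shellE pnatr_eq0 eqb0 negbK => /andP[+ _]; rewrite subr_gt0.
    have bz1 : normc (b z) < 1.
      rewrite /b normcM normc_conj; have := normc_ge0 z; have := normc_ge0 a; nra.
    have bo2 : b (om * z) ^+ (2 ^ m) = - (b z ^+ (2 ^ m)).
      by rewrite bo; move: (b z) => y; rewrite exprMn omE mulN1r.
    rewrite /= bo2 opprK.
    set c := b z ^+ (2 ^ m).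
    have c1 : normc c < 1 by rewrite normcX exprn_ilt1 ?normc_ge0 -?lt0n ?expn_gt0.
    have -> : b z ^+ (2 ^ m.+1) = c ^+ 2 by rewrite /c -exprM expnS mulnC.
    have -> : normc (b z) ^+ 2 ^+ (2 ^ m) = normc c ^+ 2.
      by rewrite /c normcX -!exprM mulnC.
    rewrite !powR_invn ?normc_ge0//.
    have p1 : 0 < normc (1 - c).
      rewrite normc_gt0 subr_eq0; apply/eqP => cE; move: c1.
      by rewrite -cE [normc 1](normc1 R) ltxx.
    have p2 : 0 < normc (1 + c).
      rewrite normc_gt0 addr_eq0; apply/eqP => cE; move: c1.
      by rewrite -normcN -cE [normc 1](normc1 R) ltxx.
    have -> : normc (1 - c ^+ 2) = normc (1 - c) * normc (1 + c).
      by rewrite -normcM; congr normc; ring.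
    have := normcD_sqr 1 c; rewrite [normc 1](normc1 R) expr1n => par.
    have -> : 1 + normc c ^+ 2 = (normc (1 - c) ^+ 2 + normc (1 + c) ^+ 2) / 2.
      by rewrite par mulrC mulKf.
    by field; rewrite !gt_eqF.
  have aE : aint (EFin \o (fun z => G m (om * z))) = aint (EFin \o G m).
    have Gm0 z : (0 <= (EFin \o G m) z)%E by rewrite /comp lee_fin G0.
    exact: (@aint_rotate R om (EFin \o G m) om1 (rmeas_EFin (mG m)) Gm0).
  exact: (aint_mean (mG m) mGo (G0 m) (fun z => G0 m (om * z)) aE).
have cst_seq (I : nat -> \bar R) : (forall m, I m.+1 = I m) -> forall m, I m = I 0%N.
  by move=> IS; elim=> // m IH; rewrite IS.
have allE := cst_seq (fun m => aint (EFin \o G m)) step.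
have -> : aint (fun z => (shell rho z * kern a z `^ (- 2%:R))%:E) = aint (EFin \o G 0%N).
  by congr (aint _); apply/funext => z /=; rewrite /G /= mul1r expr1.
have [m am] : exists m, normc a ^+ (2 ^ m) <= 2^-1.
  have h0 : 0 < 2^-1 :> R by lra.
  have := @cvg_expr R (normc a); rewrite ger0_norm ?normc_ge0// => /(_ a1).
  move=> /cvgrPdist_lt/(_ _ h0)[N _ HN]; exists N.
  have := HN (2 ^ N)%N (ltnW (ltn_expl N (ltnSn 1))).
  by rewrite /= sub0r normrN normrX ger0_norm ?normc_ge0// => /ltW.
rewrite -(allE m).
have d0 : 0 < 1 - normc a by lra.
apply: (@le_trans _ _ (aint (fun z => (4 / (1 - normc a) * shell rho z)%:E))).
  apply: (@le_aint R (G m) (fun z => 4 / (1 - normc a) * shell rho z)) => //.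
    by apply: rmeasM; [exact: rmeas_cst|exact: rmeas_shell].
  move=> z; rewrite /G mulrC.
  have [->|nz] := eqVneq (shell rho z) 0; first by rewrite !mulr0.
  have z1 : normc z < 1.
    by move: nz; rewrite shellE pnatr_eq0 eqb0 negbK => /andP[+ _]; rewrite subr_gt0.
  rewrite ler_wpM2r ?shell_ge0//.
  have bza : normc (b z) <= normc a.
    rewrite /b normcM normc_conj; have := normc_ge0 z; have := normc_ge0 a; nra.
  have bz1 : normc (b z) < 1 by exact: le_lt_trans a1.
  have b0 := normc_ge0 (b z).
  have x1 : normc (b z) ^+ 2 <= normc a by rewrite expr2; nra.
  have S1 : dyadic_sum m (normc (b z) ^+ 2) <= (1 - normc a)^-1.
    have S0 := dyadic_sum_ge0 m (sqr_ge0 (normc (b z))).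
    have SE := dyadic_sumE m (normc (b z) ^+ 2).
    have e0 : 0 <= (normc (b z) ^+ 2) ^+ (2 ^ m) by rewrite exprn_ge0// sqr_ge0.
    rewrite -[leRHS]mul1r ler_pdivlMr//.
    by apply: (@le_trans _ _ (dyadic_sum m (normc (b z) ^+ 2) * (1 - normc (b z) ^+ 2)));
      [rewrite ler_wpM2l//; lra|rewrite SE; lra].
  have c1 : normc (b z ^+ (2 ^ m)) <= 2^-1.
    rewrite normcX; apply: le_trans am.
    by rewrite lerXn2r ?nnegrE// normc_ge0.
  have k1 : 2^-1 <= normc (1 - b z ^+ (2 ^ m)).
    by have := le_normcB 1 (b z ^+ (2 ^ m)); rewrite [normc 1](normc1 R); lra.
  rewrite mulrC; apply: ler_pM => //.
  - exact: powR_ge0.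
  - exact: dyadic_sum_ge0 (sqr_ge0 _).
  - rewrite powR_invn ?normc_ge0//.
    have -> : 4 = (2^-1 : R) ^- 2 by field.
    have k0 : 0 < normc (1 - b z ^+ (2 ^ m)) by lra.
    by rewrite lef_pV2 ?posrE ?exprn_gt0 ?invr_gt0// lerXn2r ?nnegrE; lra.
have c0 : 0 <= 4 / (1 - normc a) by rewrite divr_ge0// ltW.
rewrite (aintZl c0 (rmeas_shell rho) (shell_ge0 rho)).
have -> : 192 * rho / (1 - normc a) = 4 / (1 - normc a) * (48 * rho) by field; rewrite gt_eqF.
by rewrite [leRHS]EFinM; apply: lee_wpmul2l; [rewrite lee_fin|exact: aint_shell].
Qed.

End KernelEstimates.

(** * Layer-cake estimates for power weights *)

Section Layers.
Variable R : realType.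
Implicit Types (h v : R[i] -> R) (z : R[i]).

(** For a negative exponent the roles of [r] and [x] are exchanged, hence the two comparisons. *)
Lemma powR_ratio (M x r e : R) : 0 < M -> 0 < x -> 0 < r -> r <= M * x -> x <= M * r ->
  r `^ e <= M `^ `|e| * x `^ e.
Proof.
move=> M0 x0 r0 rx xr; have q0 : 0 < r / x by rewrite divr_gt0.
have -> : r `^ e = (r / x) `^ e * x `^ e.
  by rewrite -powRM ?(ltW x0) ?(ltW q0)// divfK// gt_eqF.
rewrite ler_wpM2r ?powR_ge0//; have [e0|e0] := lerP 0 e.
  by rewrite ger0_norm//; apply: ge0_ler_powR; rewrite ?nnegrE ?(ltW q0) ?(ltW M0)// ler_pdivrMr.
have -> : (r / x) `^ e = (x / r) `^ (- e).
  by rewrite -invf_div -(@powR_inv1 R (x / r)) ?divr_ge0 ?(ltW x0) ?(ltW r0)// -powRrM mulN1r.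
rewrite ltr0_norm//; apply: ge0_ler_powR;
  by rewrite ?nnegrE ?oppr_ge0 ?(ltW e0) ?(ltW M0) ?divr_ge0 ?(ltW x0) ?(ltW r0)// ler_pdivrMr.
Qed.

Lemma powR_comparable (x r be : R) : 0 < r -> r / 2 <= x <= r ->
  x `^ (- be) <= 2 `^ `|be| * r `^ (- be).
Proof.
by move=> r0 /andP[rx xr]; rewrite -[`|be|]normrN; apply: powR_ratio => //; lra.
Qed.

Lemma geometric_nneseries_le (K q : R) : 0 <= K -> 0 <= q < 1 ->
  (\sum_(0 <= k <oo) (K * q ^+ k)%:E <= (K / (1 - q))%:E)%E.
Proof.
move=> K0 /andP[q0 q1]; have q10 : 0 < 1 - q by rewrite subr_gt0.
have t0 k : (0 <= (K * q ^+ k)%:E)%E by rewrite lee_fin mulr_ge0// exprn_ge0.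
apply: lime_le; first by apply: is_cvg_nneseries => k _ _; exact: t0.
apply: nearW => n; rewrite sumEFin lee_fin.
have -> : \sum_(0 <= i < n) K * q ^+ i = K * (1 - q ^+ n) / (1 - q).
  elim: n => [|n IH]; first by rewrite big_nil expr0 subrr mulr0 mul0r.
  by rewrite big_nat_recr//= IH exprS; field; rewrite gt_eqF.
rewrite ler_pM2r ?invr_gt0// ler_piMr// lerBlDr lerDl exprn_ge0//.
Qed.

Definition ind_le (t x : R) : R := \1_(`]0, t]%classic) x.

Lemma ind_leE t x : ind_le t x = ((0 < x) && (x <= t))%:R.
Proof. by rewrite /ind_le indicE mem_setE in_itv. Qed.

Lemma rmeas_ind_le t h : rmeas h -> rmeas (fun z => ind_le t (h z)).
Proof.
apply: rmeas_comp; apply: measurable_indic; exact: measurable_itv.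
Qed.

Lemma ind_le_ge0 t x : 0 <= ind_le t x.
Proof. by rewrite ind_leE ler0n. Qed.

(* Cut along h ~ r k and sum a geometric series. *)
Lemma layer h v (r : nat -> R) (al be A c q : R) :
  rmeas h -> rmeas v -> (forall z, 0 <= v z) -> 0 <= A -> 0 <= c -> 0 <= q < 1 ->
  (forall k, 0 < r k) -> (forall k, r k `^ (al - be) <= c * q ^+ k) ->
  (forall t, 0 < t -> (aint (fun z => (v z * ind_le t (h z))%:E) <= (A * t `^ al)%:E)%E) ->
  (forall z, v z != 0 -> exists k, r k / 2 <= h z <= r k) ->
  (aint (fun z => (v z * h z `^ (- be))%:E) <= (2 `^ `|be| * A * c / (1 - q))%:E)%E.
Proof.
move=> mh mv v0 A0 c0 q01 r0 rq HA Hk.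
set B := 2 `^ `|be|; have B0 : 0 <= B by exact: powR_ge0.
pose term k z := B * r k `^ (- be) * (v z * ind_le (r k) (h z)).
have t0 k z : 0 <= term k z.
  by rewrite mulr_ge0 ?mulr_ge0 ?powR_ge0 ?ind_le_ge0.
have mt k : rmeas (term k).
  by apply: rmeasM; [exact: rmeas_cst|apply: rmeasM => //; exact: rmeas_ind_le].
have mvh : rmeas (fun z => v z * h z `^ (- be)) by apply: rmeasM => //; exact: rmeas_powR.
have tk k : (aint (EFin \o term k) <= (B * A * c * q ^+ k)%:E)%E.
  have Brk : 0 <= B * r k `^ (- be) by rewrite mulr_ge0 ?powR_ge0.
  have mvk : rmeas (fun z => v z * ind_le (r k) (h z)).
    by apply: rmeasM => //; exact: rmeas_ind_le.
  have vk0 z : 0 <= v z * ind_le (r k) (h z) by rewrite mulr_ge0 ?ind_le_ge0.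
  have -> : aint (EFin \o term k) = _ := aintZl Brk mvk vk0.
  apply: le_trans (lee_wpmul2l _ (HA _ (r0 k))) _; first by rewrite lee_fin.
  rewrite -EFinM lee_fin.
  have -> : B * r k `^ (- be) * (A * r k `^ al) = B * A * (r k `^ al * r k `^ (- be)) by ring.
  rewrite -powRD; last by rewrite (gt_eqF (r0 k)) implybT.
  by rewrite -[leRHS]mulrA ler_wpM2l// mulr_ge0.
have E : aint (fun z => (\sum_(0 <= k <oo) (term k z)%:E)%E) =
    (\sum_(0 <= k <oo) aint (EFin \o term k))%E.
  rewrite /aint integral_nneseries//.
  - by move=> k; exact: (rmeas_EFin (mt k)).
  - by move=> k w _; rewrite lee_fin t0.
apply: (@le_trans _ _ (\sum_(0 <= k <oo) aint (EFin \o term k))%E); last first.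
  apply: le_trans (geometric_nneseries_le _ q01).
    apply: lee_nneseries => [k _ _|k _]; last exact: tk.
    by apply: integral_ge0 => w _; rewrite lee_fin t0.
  by rewrite !mulr_ge0.
rewrite -E; apply: ge0_le_integral => //.
- by move=> w _; rewrite lee_fin mulr_ge0 ?powR_ge0.
- exact: (rmeas_EFin mvh).
- by apply: ge0_emeasurable_sum => k *; [rewrite lee_fin t0|exact: (rmeas_EFin (mt k))].
- move=> w _; set z := pl w.
  have [vz|vz] := eqVneq (v z) 0.
    by rewrite vz mul0r; apply: nneseries_ge0 => k _ _; rewrite lee_fin t0.
  have [k /[dup] hk /andP[hk1 hk2]] := Hk _ vz.
  apply: (@le_trans _ _ (\sum_(0 <= i < k.+1) (term i z)%:E)%E); last first.
    by apply: nneseries_lim_ge => i _ _; rewrite lee_fin t0.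
  rewrite big_nat_recr//= -[leLHS]add0e; apply: leeD.
    by apply: sume_ge0 => i _; rewrite lee_fin t0.
  rewrite lee_fin /term ind_leE hk2 andbT.
  have -> : 0 < h z by have := r0 k; lra.
  by rewrite mulr1 mulrC ler_wpM2r//; exact: powR_comparable.
Qed.

Lemma dyadic_below (rho x : R) : 0 < rho -> 0 < x <= rho ->
  exists k, rho / 2 ^+ k / 2 <= x <= rho / 2 ^+ k.
Proof.
move=> r0 /andP[x0 xr].
have ex : exists k, rho / 2 ^+ k / 2 <= x.
  exists (Num.bound (rho / x)).
  have := @upper_nthrootP R (rho / x) (Num.bound (rho / x)) (leqnn _).
  rewrite ltr_pdivrMr// => h.
  have p : 0 < (2 : R) ^+ Num.bound (rho / x) by rewrite exprn_gt0.
  have : rho / 2 ^+ Num.bound (rho / x) < x by rewrite ltr_pdivrMr// mulrC.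
  have : 0 < rho / 2 ^+ Num.bound (rho / x) by rewrite divr_gt0.
  by lra.
case: (ex_minnP ex) => k kx kmin; exists k; rewrite kx /=.
case: k kx kmin => [|k] kx kmin; first by rewrite expr0 divr1.
rewrite leNgt; apply/negP => lt.
suff /kmin : rho / 2 ^+ k / 2 <= x by rewrite ltnn.
by move: lt; rewrite exprSr invfM mulrA => /ltW.
Qed.

Lemma dyadic_above (d x : R) : 0 < d -> d <= x ->
  exists k, 2 ^+ k * d / 2 <= x <= 2 ^+ k * d.
Proof.
move=> d0 dx.
have ex : exists k, x <= 2 ^+ k * d.
  exists (Num.bound (x / d)).
  have := @upper_nthrootP R (x / d) (Num.bound (x / d)) (leqnn _).
  by rewrite ltr_pdivrMr// => /ltW.
case: (ex_minnP ex) => k kx kmin; exists k; rewrite kx andbT.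
case: k kx kmin => [|k] kx kmin; first by rewrite expr0; lra.
rewrite leNgt; apply/negP => lt.
suff /kmin : x <= 2 ^+ k * d by rewrite ltnn.
by move: lt; rewrite (_ : _ / 2 = 2 ^+ k * d) => [/ltW//|]; rewrite exprS; field.
Qed.

(** The scales rho / 2^k are summed towards 0, where [h] may vanish; [be < al] makes the ratio 2^(be
    - al) less than 1. *)
Lemma layer_below (al be : R) : be < al -> exists2 K : R, 0 < K &
  forall h v (A rho : R), rmeas h -> rmeas v -> (forall z, 0 <= v z) -> 0 <= A -> 0 < rho ->
  (forall t, 0 < t -> (aint (fun z => (v z * ind_le t (h z))%:E) <= (A * t `^ al)%:E)%E) ->
  (forall z, v z != 0 -> 0 < h z <= rho) ->
  (aint (fun z => (v z * h z `^ (- be))%:E) <= (K * A * rho `^ (al - be))%:E)%E.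
Proof.
move=> ab; pose q : R := 2 `^ (be - al).
have q0 : 0 <= q by exact: powR_ge0.
have q1 : q < 1.
  rewrite /q -[ltRHS](powRr0 2) /powR !pnatr_eq0/= ltr_expR mul0r.
  by rewrite pmulr_llt0 ?subr_lt0// ln_gt0// ltr1n.
have q10 : 0 < 1 - q by rewrite subr_gt0.
exists (2 `^ `|be| / (1 - q)) => [|h v A rho mh mv v0 A0 rho0 HA Hv].
  by rewrite divr_gt0// powR_gt0.
rewrite (_ : _ * _ * _ = 2 `^ `|be| * A * rho `^ (al - be) / (1 - q)); last by ring.
apply: (@layer h v (fun k => rho / 2 ^+ k) al) => //.
- exact: powR_ge0.
- by rewrite q0.
- by move=> k; rewrite divr_gt0// exprn_gt0.
- move=> k; rewrite powRM ?(ltW rho0) ?invr_ge0 ?exprn_ge0// ler_wpM2l ?powR_ge0//.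
  rewrite -(powR_invn k)// -powRrM /q -(powR_mulrn k (powR_ge0 _ _)) -powRrM.
  by rewrite (_ : - k%:R * _ = (be - al) * k%:R)//; ring.
- by move=> z /Hv; exact: dyadic_below.
Qed.

(** The mirror image of [layer_below]: the scales 2^k d grow from the lower bound [d] of [h], and
    [al < be] provides the decay. *)
Lemma layer_above (al be : R) : al < be -> exists2 K : R, 0 < K &
  forall h v (A d : R), rmeas h -> rmeas v -> (forall z, 0 <= v z) -> 0 <= A -> 0 < d ->
  (forall t, 0 < t -> (aint (fun z => (v z * ind_le t (h z))%:E) <= (A * t `^ al)%:E)%E) ->
  (forall z, v z != 0 -> d <= h z) ->
  (aint (fun z => (v z * h z `^ (- be))%:E) <= (K * A * d `^ (al - be))%:E)%E.
Proof.
move=> ab; pose q : R := 2 `^ (al - be).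
have q0 : 0 <= q by exact: powR_ge0.
have q1 : q < 1.
  rewrite /q -[ltRHS](powRr0 2) /powR !pnatr_eq0/= ltr_expR mul0r.
  by rewrite pmulr_llt0 ?subr_lt0// ln_gt0// ltr1n.
have q10 : 0 < 1 - q by rewrite subr_gt0.
exists (2 `^ `|be| / (1 - q)) => [|h v A d mh mv v0 A0 d0 HA Hv].
  by rewrite divr_gt0// powR_gt0.
rewrite (_ : _ * _ * _ = 2 `^ `|be| * A * d `^ (al - be) / (1 - q)); last by ring.
apply: (@layer h v (fun k => 2 ^+ k * d) al) => //.
- exact: powR_ge0.
- by rewrite q0.
- by move=> k; rewrite mulr_gt0// exprn_gt0.
- move=> k; rewrite powRM ?(ltW d0) ?exprn_ge0// mulrC ler_wpM2l ?powR_ge0//.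
  by rewrite -(powR_mulrn k)// -powRrM /q -(powR_mulrn k (powR_ge0 _ _)) -powRrM mulrC.
- by move=> z /Hv; exact: dyadic_above.
Qed.

End Layers.

(** * Sub-mean-value property and growth *)

Section DiscFunctions.
Variable R : realType.
Local Notation mu := (@lebesgue_measure R).
Implicit Types (f g : R[i] -> R[i]) (z w : R[i]) (u : R[i] -> R).

Definition dind z : R := \1_(@disc R) z.

Lemma dindE z : dind z = (normc z < 1)%R%:R.
Proof. by rewrite /dind indicE; congr (_ %:R); congr nat_of_bool; apply/idP/idP => [/set_mem//|h];
  exact/mem_set. Qed.

Lemma dind_ge0 z : 0 <= dind z. Proof. by rewrite dindE ler0n. Qed.

Lemma dind_in z : normc z < 1 -> dind z = 1. Proof. by rewrite dindE => ->. Qed.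

Lemma disc_integralE (h : R[i] -> R) :
  disc_integral h = ((pi^-1)%:E * aint (fun z => (dind z * h z)%:E))%E.
Proof.
rewrite /disc_integral /aint integral_mkcond; congr (_ * _)%E.
apply: eq_integral => w _; rewrite patchE dindE.
rewrite -[w.1 +i* w.2]/(pl w) -/(@disc R).
case: ifPn => [/set_mem H|/negP H].
  by have -> : normc (pl w) < 1 by []; rewrite mul1r.
have -> : (normc (pl w) < 1) = false by apply/negP => ?; apply: H; exact/mem_set.
by rewrite mul0r.
Qed.

Lemma rmeas_disc u : (forall z, normc z < 1 -> ucont_at u z) ->
  rmeas (fun z => dind z * u z).
Proof.
move=> cu.
have oD (z : R[i]) : @disc R z -> exists2 t : R, 0 < t &
    forall w, normc (w - z) < t -> @disc R w.
  move=> z1; exists (1 - normc z) => [|w wz]; first by rewrite subr_gt0.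
  rewrite /disc /= -(subrK z w); apply: le_lt_trans (le_normcD _ _) _.
  by rewrite -ltrBrDr.
have [mD mf] := open_ucont_measurable oD cu.
have := mf; rewrite -{1}[X in measurable_fun X _]setTI => /(measurable_restrict _ mD measurableT).
congr measurable_fun; apply/funext => w; rewrite patchE /= dindE.
case: ifPn => [/set_mem H|/negP H].
  by have -> : normc (pl w) < 1 by []; rewrite mul1r.
have -> : (normc (pl w) < 1) = false by apply/negP => ?; apply: H; exact/mem_set.
by rewrite mul0r.
Qed.

Lemma rmeas_dind : rmeas dind.
Proof.
have -> : dind = fun z => dind z * 1 by apply/funext => z; rewrite mulr1.
by apply: rmeas_disc => z _ e e0; exists 1 => // w _; rewrite subrr normr0.
Qed.

Definition hol f := forall z, normc z < 1 -> has_cderiv f z (cderiv f z).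

Lemma in_disc_sub z w r : normc (z - w) < r -> normc w + r <= 1 -> normc z < 1.
Proof.
move=> h1 h2; rewrite -(subrK w z); apply: le_lt_trans (le_normcD _ _) _; lra.
Qed.

Lemma hol_bounded f (r : R) : hol f -> 0 <= r < 1 ->
  exists M : R, forall z, normc z <= r -> normc (f z) <= M.
Proof.
move=> hf /andP[r0 r1].
have [|z0 _ H] := @disc_max R (fun z => normc (f z)) 0 r r0.
  move=> z; rewrite subr0 => zr; apply: ucont_has_cderiv_normc; apply: hf; lra.
by exists (normc (f z0)) => z zr; apply: H; rewrite subr0.
Qed.

(** Cauchy's estimate bounds f' near [z], after which [cderiv_lipschitz] applies. The continuity is
    what makes the integrands measurable and lets a maximum be attained in [submean]. *)
Lemma cderiv_continuous f z : hol f -> normc z < 1 -> forall e : R, 0 < e ->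
  exists2 t : R, 0 < t & forall w, normc (w - z) < t ->
    normc (cderiv f w - cderiv f z) < e.
Proof.
move=> hf z1 e e0; pose r := (1 - normc z) / 3.
have r0 : 0 < r by rewrite /r; lra.
have z0 := normc_ge0 z.
have [|M HM] := @hol_bounded f (normc z + 2 * r) hf; first by rewrite /r; lra.
have fM' w : normc (w - z) < r -> normc (cderiv f w) <= 8 * M / r.
  move=> wr; have wz : normc w <= normc z + r.
    by have := le_normcB w z; lra.
  apply: (@cauchy_estimate _ f (cderiv f)) => // v vw.
    by apply: hf; apply: in_disc_sub vw _; rewrite /r in wz *; lra.
  by apply: HM; have := le_normcB v w; lra.
have M0 : 0 <= M.
  by apply: le_trans (normc_ge0 (f z)) (HM z _); lra.
have L := @cderiv_lipschitz R f (cderiv f) z r (8 * M / r) r0 _ fM'.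
pose K := 16 * (8 * M / r) / r.
have K0 : 0 <= K.
  by apply: divr_ge0 (ltW r0); apply: mulr_ge0 => //; apply: divr_ge0 (ltW r0); apply: mulr_ge0.
have K1 : 0 < K + 1 by rewrite ltr_wpDl.
exists (Num.min (r / 8) (e / (K + 1))) => [|w].
  by rewrite lt_min (divr_gt0 e0 K1) andbT; exact: divr_gt0.
rewrite lt_min => /andP[wr we]; apply: le_lt_trans (L _ w (ltW wr)) _.
  by move=> v vz; apply: hf; apply: in_disc_sub vz _; rewrite /r; lra.
rewrite -/K; apply: (@le_lt_trans _ _ ((K + 1) * normc (w - z))).
  by rewrite ler_wpM2r ?normc_ge0// lerDl.
by rewrite mulrC -ltr_pdivlMr.
Qed.

Lemma ucont_cderiv f z : hol f -> normc z < 1 -> ucont_at (fun w => normc (cderiv f w)) z.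
Proof.
move=> hf z1 e e0; have [t t0 H] := cderiv_continuous hf z1 e0.
by exists t => // w /H; apply: le_lt_trans; exact: le_normc_dist.
Qed.

(** The indicator is moved inside the power, which relies on 0^p = 0; the convention 0^0 = 1 is what
    [p != 0] excludes. *)
Lemma rmeas_powR_disc (p : R) u : p != 0 ->
  (forall z, normc z < 1 -> ucont_at u z) -> rmeas (fun z => dind z * u z `^ p).
Proof.
move=> p0 cu; have := rmeas_powR p (rmeas_disc cu).
congr rmeas; apply/funext => z; rewrite dindE.
by case: (_ < _); rewrite ?mul1r// !mul0r powR0.
Qed.

Lemma rmeas_hol_powR (p : R) f : p != 0 -> hol f ->
  rmeas (fun z => dind z * normc (f z) `^ p).
Proof.
move=> p0 hf; apply: (@rmeas_powR_disc p (fun z => normc (f z))) => // z z1.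
by apply: ucont_has_cderiv_normc; exact: hf.
Qed.

Lemma rmeas_cderiv_powR (p : R) f : p != 0 -> hol f ->
  rmeas (fun z => dind z * normc (cderiv f z) `^ p).
Proof.
move=> p0 hf; apply: (@rmeas_powR_disc p (fun z => normc (cderiv f z))) => // z z1.
exact: ucont_cderiv.
Qed.

Lemma aint_square (c : R[i]) (k s : R) : 0 <= k -> 0 <= s ->
  aint (fun z => (k * (\1_(`[Re c - s, Re c + s]%classic) (Re z) *
     \1_(`[Im c - s, Im c + s]%classic) (Im z)))%:E) = (k * (2 * s) ^+ 2)%:E.
Proof.
move=> k0 s0.
have m1 (a b : R) : measurable_fun setT (\1_(`[a, b]%classic) : R -> R).
  by apply: measurable_indic; exact: measurable_itv.
have mq : rmeas (fun z : R[i] => \1_(`[Re c - s, Re c + s]%classic) (Re z) *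
     \1_(`[Im c - s, Im c + s]%classic) (Im z) : R).
  exact: (rmeasM (rmeas_comp (m1 _ _) (@rmeas_Re R)) (rmeas_comp (m1 _ _) (@rmeas_Im R))).
have mkq := rmeasM (@rmeas_cst R k) mq.
have kq0 (w : R * R) : (0 <= ((EFin \o (fun z : R[i] => k * (\1_(`[Re c - s, Re c + s]%classic) (Re z) *
     \1_(`[Im c - s, Im c + s]%classic) (Im z)) : R)%R) \o @pl R) w)%E.
  by rewrite /= lee_fin !mulr_ge0 ?indic_ge0.
rewrite /aint [LHS](@fubini_tonelli1 _ _ _ _ R mu mu _ (rmeas_EFin mkq) kq0) /fubini_F /=.
transitivity (\int[mu]_x (k * (2 * s) * \1_(`[Re c - s, Re c + s]%classic) x)%:E)%E.
  apply: eq_integral => x _.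
  under eq_integral do rewrite mulrA.
  rewrite (integral_indic_itvZ (mulr_ge0 k0 (indic_ge0 _ _ _))); last by lra.
  by congr EFin; ring.
rewrite integral_indic_itvZ; [congr EFin; ring| |lra].
by rewrite mulr_ge0// mulr_ge0.
Qed.

Lemma le_normcBC z w : normc z - normc w <= normc (w - z).
Proof. by rewrite normc_dist le_normcB. Qed.

Lemma powR_trade (p r d x y : R) (N : nat) : 0 < p -> 2 <= N%:R * p ->
  0 < d -> d <= r -> 0 <= x -> 0 <= y -> x * r ^+ N <= y * d ^+ N ->
  x `^ p * r ^+ 2 <= y `^ p * d ^+ 2.
Proof.
move=> p0 Np d0 dr x0 y0 H; have r0 : 0 < r by exact: lt_le_trans dr.
have : x `^ p * (r ^+ N) `^ p <= y `^ p * (d ^+ N) `^ p.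
  rewrite -!powRM ?exprn_ge0 ?(ltW r0) ?(ltW d0)//.
  by apply: ge0_ler_powR; rewrite ?nnegrE ?mulr_ge0 ?exprn_ge0 ?(ltW p0) ?(ltW r0) ?(ltW d0).
have split t : 0 < t -> (t ^+ N) `^ p = t ^+ 2 * t `^ (N%:R * p - 2%:R).
  move=> t0; rewrite -powR_mulrn ?(ltW t0)// -powRrM -(powR_mulrn 2) ?(ltW t0)//.
  by rewrite -powRD ?(gt_eqF t0) ?implybT// addrC subrK.
rewrite !split// => {}H.
have t0 : 0 < r `^ (N%:R * p - 2%:R) by exact: powR_gt0.
rewrite -(ler_pM2r t0) -[leLHS]mulrA -[leRHS]mulrA; apply: (le_trans H).
rewrite ler_wpM2l ?powR_ge0// ler_wpM2l ?sqr_ge0//.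
by apply: ge0_ler_powR; rewrite ?nnegrE ?(ltW r0) ?(ltW d0)// subr_ge0.
Qed.

(* Sub-mean-value property of |f'|^p for every p > 0: at a maximum z* of
   |f'| d^N, with d the distance to the boundary circle and N p >= 2, the
   Lipschitz estimate keeps |f'| above half its value on a disc of radius
   comparable to d z*. *)
Lemma submean (p : R) : 0 < p -> exists2 C : R, 0 < C & forall f w (Phi : R[i] -> R),
  hol f -> normc w < 1 -> rmeas Phi -> (forall z, 0 <= Phi z) ->
  (forall z, normc (z - w) < (1 - normc w) / 4 -> normc (cderiv f z) `^ p <= Phi z) ->
  ((normc (cderiv f w) `^ p * (1 - normc w) ^+ 2)%:E <= C%:E * aint (EFin \o Phi))%E.
Proof.
move=> p0; have [N Np] : exists N : nat, 2 <= N%:R * p.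
  exists (Num.bound (2 / p)); rewrite -ler_pdivrMr//; apply: ltW.
  by apply: archi_boundP; rewrite divr_ge0 // ltW.
have N0 : (0 < N)%N.
  by rewrite lt0n; apply: contraTneq Np => ->; rewrite mul0r -ltNge.
(* The Lipschitz constant 16 (2^N U) / (d / 2) times the radius ep d is exactly U / 2, and ep <=
   1/64 keeps this radius below the d / 16 that [cderiv_lipschitz] allows. *)
have [ep epE] : exists ep : R, ep = (64 * 2 ^+ N)^-1 by eexists.
have tN : 1 <= 2 ^+ N :> R by rewrite exprn_ege1// ler1n.
have ep0 : 0 < ep by rewrite epE invr_gt0; lra.
have ep64 : ep <= 64^-1 by rewrite epE lef_pV2 ?posrE; lra.
have ep1 : ep < 1 by rewrite epE invf_lt1; lra.
(* 16 comes from r = (1 - |w|) / 4, 2^p from halving |f'|, and ep^-2 from the area of the square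
   over which [Phi] is integrated. *)
exists (16 * 2 `^ p / ep ^+ 2) => [|f w Phi hf w1 mPhi Phi0 HPhi].
  by rewrite divr_gt0 ?exprn_gt0// mulr_gt0// powR_gt0.
have [r rE] : exists r, r = (1 - normc w) / 4 by eexists.
have r0 : 0 < r by rewrite rE; lra.
have w0 := normc_ge0 w.
have tri (x y q rr : R) : x < (rr - q) / 2 -> y <= x + q -> (rr - q) / 2 <= rr - y by lra.
have tri2 (q x : R) : q <= r -> x - normc w <= q -> x + (r - q) / 2 <= 1.
  by rewrite rE; lra.
have [U UE] : exists U : R[i] -> R, forall z, U z = normc (cderiv f z) by eexists.
have [d dE] : exists d : R[i] -> R, forall z, d z = r - normc (z - w) by eexists.
have [Psi PsiE] : exists Psi : R[i] -> R, Psi = fun z => U z * d z ^+ N by eexists.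
have cd z : ucont_at d z.
  move=> e /(ucont_normc_sub w z)[t t0 H]; exists t => // v /H.
  by rewrite distrC (_ : d v - d z = normc (z - w) - normc (v - w)) // !dE; ring.
have cPsi z : normc (z - w) <= r -> ucont_at Psi z.
  rewrite PsiE => zr; apply: ucontM.
    have -> : U = fun z => normc (cderiv f z) by apply/funext.
    apply: ucont_cderiv => //; apply: (@in_disc_sub z w (2 * r)); last by rewrite rE; lra.
    by lra.
  elim: (N) => [|n IH]; first by move=> e e0; exists 1 => // v _; rewrite !expr0 subrr normr0.
  by under eq_fun do rewrite exprS; apply: ucontM.
have [zs zsr zsmax] := disc_max (ltW r0) cPsi.
have d0 : 0 <= d zs by rewrite dE subr_ge0.
have dr : d zs <= r by rewrite dE; have := normc_ge0 (zs - w); lra.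
have U0 z : 0 <= U z by rewrite UE normc_ge0.
have Psw : U w * r ^+ N <= U zs * d zs ^+ N.
  have := zsmax w; rewrite subrr normc0 => /(_ (ltW r0)).
  by rewrite PsiE !dE subrr normc0 subr0 -dE.
have [Uw|Uw] := eqVneq (U w) 0.
  rewrite -UE Uw powR0 ?gt_eqF// mul0r mule_ge0//.
    by rewrite lee_fin !mulr_ge0 ?powR_ge0// invr_ge0 sqr_ge0.
  by apply: integral_ge0 => v _; rewrite lee_fin.
have Uw0 : 0 < U w by rewrite lt0r Uw U0.
have Ps0 : 0 < U zs * d zs ^+ N by apply: lt_le_trans Psw; rewrite mulr_gt0// exprn_gt0.
have Us : 0 < U zs.
  by rewrite lt0r U0 andbT; apply/eqP => E; move: Ps0; rewrite E mul0r ltxx.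
have ds : 0 < d zs.
  rewrite lt0r d0 andbT; apply/eqP => E; move: Ps0.
  by rewrite E expr0n gtn_eqF// mulr0 ltxx.
(* Within half the distance to the circle [d] keeps at least half of its value, so maximality of U
   d^N bounds U up to a factor 2^N. *)
have near z : normc (z - zs) < d zs / 2 -> U z <= 2 ^+ N * U zs.
  move=> zz; have zw : normc (z - w) <= normc (z - zs) + normc (zs - w).
    by rewrite (le_trans _ (le_normcD _ _))// addrA subrK.
  have dz : d zs / 2 <= d z.
    by rewrite !dE in zz *; exact: tri zz zw.
  have zr : normc (z - w) <= r.
    by rewrite -subr_ge0 -dE; apply: le_trans dz; rewrite divr_ge0.
  have := zsmax z zr; rewrite PsiE => H.
  have dn : 0 < (d zs / 2) ^+ N by rewrite exprn_gt0// divr_gt0.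
  rewrite -(ler_pM2r dn); apply: (@le_trans _ _ (U z * d z ^+ N)).
    rewrite ler_wpM2l// lerXn2r ?nnegrE ?divr_ge0//.
    by apply: le_trans dz; rewrite divr_ge0.
  apply: le_trans H _; rewrite expr_div_n.
  by have -> : 2 ^+ N * U zs * (d zs ^+ N / 2 ^+ N) = U zs * d zs ^+ N
    by field; rewrite gt_eqF// exprn_gt0.
have d20 : 0 < d zs / 2 by lra.
have inD z : normc (z - zs) < d zs / 2 -> normc z < 1.
  move=> zz; apply: (@in_disc_sub z zs (d zs / 2)) => //.
  by have := le_normcB zs w; rewrite dE; exact: tri2.
have near' z : normc (z - zs) < d zs / 2 -> normc (cderiv f z) <= 2 ^+ N * U zs.
  by rewrite -UE; exact: near.
have lip := @cderiv_lipschitz R f (cderiv f) zs (d zs / 2) (2 ^+ N * U zs) d20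
  (fun z h => hf z (inD z h)) near'.
have low z : normc (z - zs) <= ep * d zs -> U zs / 2 <= U z.
  move=> zz.
  have e16 : ep * d zs <= d zs / 2 / 8.
    by have := ler_wpM2r d0 ep64; lra.
  have := lip z (le_trans zz e16) => h1.
  have h2 : U zs - U z <= normc (cderiv f z - cderiv f zs).
    by rewrite (UE zs) (UE z); exact: le_normcBC.
  suff : 16 * (2 ^+ N * U zs) / (d zs / 2) * normc (z - zs) <= U zs / 2 by lra.
  apply: (@le_trans _ _ (16 * (2 ^+ N * U zs) / (d zs / 2) * (ep * d zs))).
    by apply: ler_wpM2l => //; rewrite divr_ge0// ?mulr_ge0//; lra.
  rewrite epE [leLHS](_ : _ = U zs / 2)//; field.
  by rewrite !gt_eqF//; lra.
(* Half the side of a square around [zs] that lies in the disc of radius ep d, because |z| <= |Re z|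
   + |Im z|. *)
pose s := ep * d zs / 2.
have s0 : 0 <= s by rewrite /s !mulr_ge0 ?(ltW ep0).
have k0 : 0 <= (U zs / 2) `^ p by exact: powR_ge0.
have sq := aint_square zs k0 s0.
have m1 (a b : R) : measurable_fun setT (\1_(`[a, b]%classic) : R -> R).
  by apply: measurable_indic; exact: measurable_itv.
have lower : (((U zs / 2) `^ p * (2 * s) ^+ 2)%:E <= aint (EFin \o Phi))%E.
  rewrite -sq.
  apply: (@le_aint R (fun z => (U zs / 2) `^ p * (\1_(`[Re zs - s, Re zs + s]%classic) (Re z) *
     \1_(`[Im zs - s, Im zs + s]%classic) (Im z)))) => //.
  - apply: rmeasM; first exact: rmeas_cst.
    exact: (rmeasM (rmeas_comp (m1 _ _) (@rmeas_Re R)) (rmeas_comp (m1 _ _) (@rmeas_Im R))).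
  - by move=> z; rewrite !mulr_ge0 ?indic_ge0.
  - move=> z; rewrite !indicE !mem_setE !in_itv /=.
    case: andP => [[z1 z2]|]; last by rewrite mul0r mulr0.
    case: andP => [[z3 z4]|]; last by rewrite !mulr0.
    rewrite !mulr1.
    have zz : normc (z - zs) <= ep * d zs.
      apply: (le_trans (normc_le_ReIm _)).
      have -> : Re (z - zs) = Re z - Re zs by case: (z) (zs) => [? ?] [? ?].
      have -> : Im (z - zs) = Im z - Im zs by case: (z) (zs) => [? ?] [? ?].
      have -> : ep * d zs = s + s by rewrite /s; lra.
      by apply: lerD; rewrite ler_norml; lra.
    have zw : normc (z - w) <= normc (z - zs) + normc (zs - w).
      by rewrite (le_trans _ (le_normcD _ _))// addrA subrK.
    have e1 : ep * d zs < d zs by rewrite gtr_pMl.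
    apply: le_trans (HPhi z _); last by rewrite -rE; rewrite dE in zz e1; lra.
    rewrite -UE; apply: ge0_ler_powR; rewrite ?nnegrE ?(ltW p0)//; last exact: low.
    by rewrite divr_ge0 // ltW.
have C0 : 0 <= 16 * 2 `^ p / ep ^+ 2 by rewrite !mulr_ge0 ?powR_ge0// invr_ge0 sqr_ge0.
apply: le_trans (lee_wpmul2l _ lower); last by rewrite lee_fin.
rewrite -EFinM lee_fin.
have -> : (1 - normc w) ^+ 2 = 16 * r ^+ 2 by rewrite rE; field.
have -> : (U zs / 2) `^ p = U zs `^ p / 2 `^ p.
  by rewrite powRM ?(ltW Us)// -powR_inv1// -powRrM mulN1r powRN.
have tp : 2 `^ p != 0 :> R by rewrite gt_eqF// powR_gt0.
rewrite [leRHS](_ : _ = 16 * (U zs `^ p * d zs ^+ 2)); last first.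
  by rewrite /s; field; rewrite tp gt_eqF.
rewrite -UE mulrCA ler_pM2l//.
by apply: powR_trade Psw; rewrite // ltW.
Qed.

End DiscFunctions.

(** * Radial integration and a pointwise bound for the Dirichlet type space *)

Section Growth.
Variable R : realType.
Implicit Types (f g : R[i] -> R[i]) (z w : R[i]) (u : R[i] -> R).

Lemma is_derive_powR_affine (n k t : R) : 0 < 1 - t * n ->
  is_derive t 1 (fun s => (1 - s * n) `^ k) (- (k * n * (1 - t * n) `^ (k - 1))).
Proof.
move=> t0.
have tin : 1 - t * n \in `]0, +oo[%R by rewrite in_itv /= t0.
have d1 : is_derive (1 - t * n) 1 (@powR R ^~ k) (k * (1 - t * n) `^ (k - 1)).
  split; first exact: derivable_powR.
  by rewrite -derive1E powR_derive1.
have d2 : is_derive t 1 (fun s => 1 - s * n) (- n).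
  apply/is_derive_epsP => e e0; exists 1 => // s _.
  have -> : 1 - (t + s) * n - (1 - t * n) - - n * s = 0 by ring.
  by rewrite normr0 mulr_ge0 // ltW.
have := @is_derive1_comp R (@powR R ^~ k) (fun s => 1 - s * n) t _ _ d1 d2.
by rewrite (_ : _ * _ = - (k * n * (1 - t * n) `^ (k - 1)))//; ring.
Qed.

(** The mean value inequality along the segment from 0 to [z], with B / k (1 - t |z|)^(-k) as a
    primitive of the bound on the derivative. *)
Lemma growth f z (k B : R) : hol f -> 0 < k -> normc z < 1 -> 0 <= B ->
  (forall t : R, 0 <= t <= 1 ->
     normc (cderiv f (t%:C * z)) <= B * (1 - t * normc z) `^ (- (1 + k))) ->
  normc (f z - f 0) <= B / k * (1 - normc z) `^ (- k).
Proof.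
move=> hf k0 z1 B0 H; set n := normc z in z1 H *.
have n0 : 0 <= n by exact: normc_ge0.
have tn (t : R) : 0 <= t <= 1 -> t * n < 1.
  by move=> /andP[t0 t1]; apply: le_lt_trans z1; rewrite ler_piMl.
have Hp (t : R) : 0 <= t <= 1 ->
    has_rderiv (fun s : R => f (0 + s%:C * z)) t (cderiv f (t%:C * z) * z).
  move=> t01; apply: has_rderiv_line; rewrite add0r; apply: hf.
  rewrite normcM normc_real ger0_norm; first exact: tn.
  by case/andP: t01.
pose q (t : R) := B / k * (1 - t * n) `^ (- k).
have Hq (t : R) : 0 <= t <= 1 -> is_derive t 1 q (B * (1 - t * n) `^ (- (1 + k)) * n).
  move=> t01; have t0 : 0 < 1 - t * n by rewrite subr_gt0 tn.
  have := is_deriveZ (B / k) (is_derive_powR_affine (- k) t0).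
  rewrite (_ : _ *: _ = B * (1 - t * n) `^ (- (1 + k)) * n)//.
  rewrite [- k - 1](_ : _ = - (1 + k)); last by ring.
  by rewrite /GRing.scale /=; field; rewrite gt_eqF.
have Hle (t : R) : 0 <= t <= 1 ->
    normc (cderiv f (t%:C * z) * z) <= B * (1 - t * n) `^ (- (1 + k)) * n.
  by move=> t01; rewrite normcM ler_wpM2r//; exact: H.
have := normc_increment_le ler01 Hp Hq Hle.
rewrite /q rmorph1 rmorph0 mul1r mul0r !add0r mul1r => /le_trans; apply.
by rewrite gerBl mulr_ge0 ?powR_ge0// divr_ge0// ltW.
Qed.

Lemma powR_add_le (p a b : R) : 0 < p -> 0 <= a -> 0 <= b ->
  (a + b) `^ p <= 2 `^ p * (a `^ p + b `^ p).
Proof.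
move=> p0 a0 b0.
have aux (x y : R) : 0 <= x -> x <= y -> (x + y) `^ p <= 2 `^ p * (x `^ p + y `^ p).
  move=> x0 xy; have y0 : 0 <= y by exact: le_trans xy.
  apply: (@le_trans _ _ ((2 * y) `^ p)).
    by apply: ge0_ler_powR; rewrite ?nnegrE ?(ltW p0)//; lra.
  by rewrite powRM// ler_wpM2l ?powR_ge0// lerDr powR_ge0.
have [ab|ba] := leP a b; first exact: aux.
by rewrite addrC [a `^ p + _]addrC; apply: aux => //; exact: ltW.
Qed.

Lemma growth_powR f z (p k D : R) : 0 < p -> 0 < k -> hol f -> normc z < 1 -> 0 <= D ->
  (forall t : R, 0 <= t <= 1 ->
     normc (cderiv f (t%:C * z)) `^ p * (1 - t * normc z) `^ (p * (1 + k)) <= D) ->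
  normc (f z) `^ p <=
    2 `^ p * (normc (f 0) `^ p + k `^ (- p) * D * (1 - normc z) `^ (- (k * p))).
Proof.
move=> p0 k0 hf z1 D0 H.
have z0 : 0 < 1 - normc z by rewrite subr_gt0.
have pV : p * p^-1 = 1 by rewrite divff// gt_eqF.
have g : normc (f z - f 0) <= D `^ p^-1 / k * (1 - normc z) `^ (- k).
  apply: growth => //; first exact: powR_ge0.
  move=> t t01; have tz : 0 < 1 - t * normc z.
    rewrite subr_gt0; apply: le_lt_trans z1.
    by case/andP: t01 => ? ?; rewrite ler_piMl ?normc_ge0.
  have := H t t01; set X := normc _; set y := 1 - t * normc z in tz * => h.
  have X0 : 0 <= X by exact: normc_ge0.
  have /(ge0_ler_powR (r := p^-1)) : X `^ p * y `^ (p * (1 + k)) <= D := h.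
  rewrite invr_ge0 (ltW p0) => /(_ isT).
  rewrite !nnegrE mulr_ge0 ?powR_ge0// => /(_ isT D0).
  rewrite powRM ?powR_ge0// -!powRrM pV powRr1// mulrAC pV mul1r => h2.
  by rewrite powRN ler_pdivlMr// powR_gt0.
have ft : normc (f z) <= normc (f 0) + normc (f z - f 0).
  by have := le_normcD (f 0) (f z - f 0); rewrite addrCA subrr addr0.
apply: (@le_trans _ _ ((normc (f 0) + normc (f z - f 0)) `^ p)).
  by apply: ge0_ler_powR; rewrite ?nnegrE ?(ltW p0) ?addr_ge0 ?normc_ge0.
apply: le_trans (powR_add_le p0 (normc_ge0 _) (normc_ge0 _)) _.
rewrite ler_wpM2l ?powR_ge0// lerD2l.
apply: (@le_trans _ _ ((D `^ p^-1 / k * (1 - normc z) `^ (- k)) `^ p)).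
  apply: ge0_ler_powR; rewrite ?nnegrE ?(ltW p0) ?normc_ge0//.
  by rewrite mulr_ge0 ?powR_ge0// divr_ge0 ?powR_ge0 // ltW.
rewrite powRM ?powR_ge0 ?divr_ge0 ?powR_ge0 ?(ltW k0)//.
rewrite powRM ?powR_ge0 ?invr_ge0 ?(ltW k0)// -!powRrM mulVf ?gt_eqF// powRr1//.
rewrite -(powR_inv1 (ltW k0)) -powRrM mulN1r mulNr.
by rewrite [D * _]mulrC.
Qed.

(** Marks the pairs in which [w] is at least half as far from the circle as [z]. A half-line
    indicator of one difference is measurable in both points jointly, as Tonelli's theorem
    requires. *)
Definition nearer z w : R := \1_(`[0, +oo[%classic) (2 * (1 - normc w) - (1 - normc z)).

Lemma nearerE z w : nearer z w = (1 - normc z <= 2 * (1 - normc w))%R%:R.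
Proof. by rewrite /nearer indicE mem_setE in_itv /= andbT subr_ge0. Qed.

Lemma rmeas_1sub : rmeas (fun z => 1 - normc z : R).
Proof.
apply: (@rmeas_comp R (fun x => 1 - x) (@normc R)); last exact: rmeas_normc.
by apply: measurable_funB => //; exact: measurable_cst.
Qed.

Lemma rmeas_nearer_r z : rmeas (nearer z).
Proof.
apply: (@rmeas_comp R (fun x => \1_(`[0, +oo[%classic) (2 * x - (1 - normc z)))
  (fun w => 1 - normc w)); last exact: rmeas_1sub.
have m1 : measurable_fun setT (\1_(`[0, +oo[%classic) : R -> R).
  by apply: measurable_indic; exact: measurable_itv.
by apply: (measurableT_comp m1); exact: measurable_funB.
Qed.

(** [submean] is applied at the points w of the radius to [z]. On the disc of integration 1 - |v| is
    comparable to 1 - |w| >= 1 - |z|, so [nearer z v] holds there and |f'(w)|^p is at most a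
    multiple of (1 - |w|)^(-p - 1/2) times the integral. Integrating along the radius leaves (1 -
    |z|)^(-1/2). *)
Lemma pointwise_embedding (p : R) : 0 < p -> exists2 C : R, 0 < C & forall f z,
  hol f -> normc z < 1 ->
  ((normc (f z) `^ p)%:E <= C%:E * ((normc (f 0) `^ p)%:E +
     ((1 - normc z) `^ (- 2^-1))%:E *
      aint (fun w => (dind w * normc (cderiv f w) `^ p *
         (1 - normc w) `^ (p - 3 / 2) * nearer z w)%:E)))%E.
Proof.
move=> p0; have [C1 C10 sub] := @submean R p p0.
pose e : R := p - 3 / 2.
(* 1 - |w| lies between 4/3 (1 - |v|) and half of it, as [powR_comparable] asks. *)
pose K : R := 2 `^ `|e| * (4 / 3) `^ e.
have K0 : 0 < K by rewrite mulr_gt0 ?powR_gt0//; lra.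
(* Chosen so that p (1 + k) = 2 + e, the power that [submean] produces; then k p = 1/2. *)
pose k : R := (2 * p)^-1.
have k0 : 0 < k by rewrite invr_gt0 mulr_gt0.
pose C2 : R := k `^ (- p) * (C1 * K).
have C20 : 0 < C2 by rewrite !mulr_gt0// powR_gt0.
exists (2 `^ p * (1 + C2)) => [|f z hf z1].
  by rewrite mulr_gt0 ?powR_gt0// addr_gt0.
set Iz := aint _.
have z0 : 0 < 1 - normc z by rewrite subr_gt0.
pose V w := dind w * normc (cderiv f w) `^ p * (1 - normc w) `^ e * nearer z w.
have V0 w : 0 <= V w by rewrite !mulr_ge0 ?powR_ge0 ?dind_ge0// nearerE ler0n.
have mV : rmeas V.
  apply: rmeasM; last exact: rmeas_nearer_r.
  apply: rmeasM; first by apply: rmeas_cderiv_powR => //; rewrite gt_eqF.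
  by apply: rmeas_powR; exact: rmeas_1sub.
have Iz0 : (0 <= Iz)%E by apply: integral_ge0 => w _; rewrite lee_fin V0.
have IzE : Iz = aint (EFin \o V) by [].
clearbody Iz.
case: Iz Iz0 IzE => [I|_ _|//]; last first.
  rewrite gt0_muley ?lte_fin ?powR_gt0// addey// gt0_muley ?leey// lte_fin.
  by rewrite mulr_gt0 ?powR_gt0// addr_gt0.
rewrite lee_fin => I0 IE.
rewrite -[leRHS]/(((2 `^ p * (1 + C2)) * (normc (f 0) `^ p +
  (1 - normc z) `^ (- 2^-1) * I))%:E) lee_fin.
have D0 : 0 <= C1 * K * I by rewrite !mulr_ge0// ltW.
have main (t : R) : 0 <= t <= 1 ->
  normc (cderiv f (t%:C * z)) `^ p * (1 - t * normc z) `^ (p * (1 + k)) <= C1 * K * I.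
  move=> t01; set w := t%:C * z.
  have nw : normc w = t * normc z.
    by rewrite normcM normc_real ger0_norm//; case/andP: t01.
  have wz : normc w <= normc z.
    by rewrite nw; case/andP: t01 => ? ?; rewrite ler_piMl ?normc_ge0.
  rewrite -nw; have w1 : normc w < 1 by exact: le_lt_trans z1.
  have w0 : 0 < 1 - normc w by rewrite subr_gt0.
  have c0 : 0 <= K * (1 - normc w) `^ (- e) by rewrite mulr_ge0 ?powR_ge0// ltW.
  have := sub f w (fun v => K * (1 - normc w) `^ (- e) * V v) hf w1.
  have -> : aint (EFin \o (fun v => K * (1 - normc w) `^ (- e) * V v)) =
    ((K * (1 - normc w) `^ (- e))%:E * I%:E)%E by rewrite IE; exact: aintZl c0 mV V0.
  rewrite -[X in _ -> _ -> _ -> (_ <= X)%E]/((C1 * (K * (1 - normc w) `^ (- e) * I))%:E) lee_fin => S; have {}S : _ <= _ := S _ _ _.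
  rewrite [p * (1 + k)](_ : _ = 2%:R + e); last by rewrite /k /e; field; rewrite gt_eqF.
  rewrite powRD; last by rewrite (gt_eqF w0) implybT.
  rewrite powR_mulrn ?(ltW w0)// mulrA -ler_pdivlMr ?powR_gt0//.
  rewrite -powRN [leRHS](_ : _ = C1 * (K * (1 - normc w) `^ (- e) * I)); last by ring.
  apply: S.
  - by apply: rmeasM => //; exact: rmeas_cst.
  - by move=> v; rewrite mulr_ge0.
  - move=> v vw.
    have nv : normc v <= normc w + (1 - normc w) / 4.
      by have := le_normcB v w; lra.
    have nv' : normc w <= normc v + (1 - normc w) / 4.
      by have := le_normcBC w v; lra.
    rewrite /V nearerE (_ : (1 - normc z <= 2 * (1 - normc v)) = true); last by apply/idP; lra.
    rewrite dind_in; last by lra.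
    rewrite mul1r mulr1 [leRHS](_ : _ = normc (cderiv f v) `^ p *
      (K * (1 - normc v) `^ e * (1 - normc w) `^ (- e))); last by ring.
    rewrite ler_peMr ?powR_ge0//.
    rewrite powRN ler_pdivlMr ?powR_gt0// mul1r.
    have v0 : 0 < 4 / 3 * (1 - normc v) by lra.
    have := @powR_comparable R (1 - normc w) (4 / 3 * (1 - normc v)) (- e) v0.
    rewrite opprK normrN powRM; [|lra|lra].
    by rewrite mulrA; apply; lra.
have := growth_powR p0 k0 hf z1 D0 main.
have -> : k * p = 2^-1 by rewrite /k; field; rewrite gt_eqF.
move=> /le_trans; apply; rewrite -[leRHS]mulrA ler_wpM2l ?powR_ge0//.
have P0 : 0 <= (1 - normc z) `^ (- 2^-1) by exact: powR_ge0.
have F0 : 0 <= normc (f 0) `^ p by exact: powR_ge0.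
rewrite [k `^ _ * _](_ : _ = C2 * I); last by rewrite /C2; ring.
have PI0 : 0 <= (1 - normc z) `^ (- 2^-1) * I by rewrite mulr_ge0.
have := mulr_ge0 (ltW C20) F0.
lra.
Qed.

End Growth.

(** * Carleson embedding of the Dirichlet type space *)

Section Carleson.
Variable R : realType.
Local Notation mu := (@lebesgue_measure R).

(* Canonical structure inference finds a sigma-finite structure on a product of
   measures only for subprobabilities, so we give one by hand. *)
Definition area : set (measurableTypeR R * measurableTypeR R)%type -> \bar R := (mu \x mu)%E.
HB.instance Definition _ := Measure.on area.
Lemma area_sigma_finite : sigma_finite setT area.
Proof.
have /sigma_finiteP[F [TF ndF Foo]] := sigma_finiteT mu.
exists (fun n => F n `*` F n).
  rewrite predeqE => -[x y]; split => // _.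
  have [n _ Fnx] : (\bigcup_i F i) x by rewrite -TF.
  have [k _ Fky] : (\bigcup_i F i) y by rewrite -TF.
  exists (maxn n k) => //; split.
  - by move: x Fnx; exact/subsetPset/ndF/leq_maxl.
  - by move: y Fky; exact/subsetPset/ndF/leq_maxr.
move=> k; have [? ?] := Foo k.
split; first exact: measurableX.
by rewrite /area product_measure1E// lte_mul_pinfty// ge0_fin_numE.
Qed.
HB.instance Definition _ := @Measure_isSigmaFinite.Build _ _ _ area area_sigma_finite.
Definition area_sf : {sigma_finite_measure set _ -> \bar R} := area.

Implicit Types (f g : R[i] -> R[i]) (z w a : R[i]) (u : R[i] -> R).

Lemma nearer_ge0 z w : 0 <= nearer z w.
Proof. by rewrite nearerE ler0n. Qed.

Section Tonelli.
Variables A B : R[i] -> R.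
Hypotheses (mA : rmeas A) (mB : rmeas B).
Hypotheses (A0 : forall z, 0 <= A z) (B0 : forall z, 0 <= B z).

Let T (zw : (R * R) * (R * R)) : \bar R :=
  (A (pl zw.1) * (B (pl zw.2) * nearer (pl zw.1) (pl zw.2)))%:E.

Let mT : measurable_fun setT T.
Proof.
apply/measurable_EFinP.
have m1 : measurable_fun setT (\1_(`[0, +oo[%classic) : R -> R).
  by apply: measurable_indic; exact: measurable_itv.
have mA1 : measurable_fun setT (fun zw : (R * R) * (R * R) => A (pl zw.1)).
  exact: (measurableT_comp mA measurable_fst).
have mB2 : measurable_fun setT (fun zw : (R * R) * (R * R) => B (pl zw.2)).
  exact: (measurableT_comp mB measurable_snd).
have ms := @rmeas_1sub R.
have ms1 : measurable_fun setT (fun zw : (R * R) * (R * R) => 1 - normc (pl zw.1)).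
  exact: (measurableT_comp ms measurable_fst).
have ms2 : measurable_fun setT (fun zw : (R * R) * (R * R) => 1 - normc (pl zw.2)).
  exact: (measurableT_comp ms measurable_snd).
have mN : measurable_fun setT
    (fun zw : (R * R) * (R * R) => nearer (pl zw.1) (pl zw.2)).
  apply: (measurableT_comp m1); apply: measurable_funB => //.
  exact: measurable_funM.
exact: (measurable_funM mA1 (measurable_funM mB2 mN)).
Qed.

Let T0 zw : (0 <= T zw)%E.
Proof. by rewrite lee_fin !mulr_ge0 ?nearer_ge0. Qed.

Let mBn z : rmeas (fun w => B w * nearer z w).
Proof. by apply: rmeasM => //; exact: rmeas_nearer_r. Qed.

Let innerE z : (\int[mu \x mu]_w T ((Re z, Im z), w) =
  (A z)%:E * aint (fun w => (B w * nearer z w)%:E))%E.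
Proof.
rewrite -(aintZl (A0 z) (mBn z)); last by move=> w; rewrite mulr_ge0 ?nearer_ge0.
by case: z.
Qed.

Let mAn w : rmeas (fun z => A z * nearer z w).
Proof.
apply: rmeasM => //.
apply: (@rmeas_comp R (fun x => \1_(`[0, +oo[%classic) (2 * (1 - normc w) - x))
  (fun z => 1 - normc z)); last exact: rmeas_1sub.
have m1 : measurable_fun setT (\1_(`[0, +oo[%classic) : R -> R).
  by apply: measurable_indic; exact: measurable_itv.
by apply: (measurableT_comp m1); exact: measurable_funB.
Qed.

Let outerE w : (\int[mu \x mu]_z T (z, (Re w, Im w)) =
  (B w)%:E * aint (fun z => (A z * nearer z w)%:E))%E.
Proof.
rewrite -(aintZl (B0 w) (mAn w)); last by move=> z; rewrite mulr_ge0 ?nearer_ge0.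
by apply: eq_integral => z _; rewrite /T mulrCA; case: w.
Qed.

Lemma cmeas_nearer_inner :
  cmeas (fun z => ((A z)%:E * aint (fun w => (B w * nearer z w)%:E))%E).
Proof.
have H : measurable_fun setT (fun z : R * R => \int[mu \x mu]_w T (z, w))%E.
  exact: (@measurable_fun_fubini_tonelli_F _ _ _ _ R area_sf T mT T0).
by apply: eq_measurable_fun H => -[x y] _ /=; rewrite -innerE.
Qed.

Lemma cmeas_nearer_outer :
  cmeas (fun w => ((B w)%:E * aint (fun z => (A z * nearer z w)%:E))%E).
Proof.
have H : measurable_fun setT (fun w : R * R => \int[mu \x mu]_z T (z, w))%E.
  exact: (@measurable_fun_fubini_tonelli_G _ _ _ _ R area_sf T mT T0).
by apply: eq_measurable_fun H => -[x y] _ /=; rewrite -outerE.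
Qed.

Lemma tonelli_nearer :
  aint (fun z => ((A z)%:E * aint (fun w => (B w * nearer z w)%:E))%E) =
  aint (fun w => ((B w)%:E * aint (fun z => (A z * nearer z w)%:E))%E).
Proof.
transitivity (\int[mu \x mu]_z \int[mu \x mu]_w T (z, w))%E.
  by apply: eq_integral => -[x y] _; rewrite -innerE.
transitivity (\int[mu \x mu]_w \int[mu \x mu]_z T (z, w))%E.
  exact: (@fubini_tonelli _ _ _ _ R area_sf area_sf T mT T0).
by apply: eq_integral => -[x y] _; rewrite -outerE.
Qed.

End Tonelli.

Lemma dind_shell z : dind z = shell 1 z :> R.
Proof.
rewrite dindE shellE subr_gt0; congr (_%:R); congr nat_of_bool.
by rewrite gerBl normc_ge0 andbT.
Qed.

Lemma dind_out z : 1 <= normc z -> dind z = 0.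
Proof. by rewrite dindE leNgt => /negbTE ->. Qed.

Lemma dind_nearer z w : dind z * nearer z w = shell (2 * (1 - normc w)) z.
Proof. by rewrite dindE nearerE shellE -natrM mulnb subr_gt0. Qed.

Lemma rmeas_1subsq : rmeas (fun z => 1 - normc z ^+ 2 : R).
Proof.
apply: (@rmeas_comp R (fun x => 1 - x ^+ 2) (@normc R)); last exact: rmeas_normc.
by apply: measurable_funB => //; exact: exprn_measurable.
Qed.

Lemma rmeas_dirichlet_integrand (p q : R) f : p != 0 -> hol f ->
  rmeas (fun z => dind z * (normc (cderiv f z) `^ p * (1 - normc z ^+ 2) `^ q)).
Proof.
move=> p0 hf; under eq_fun do rewrite mulrA.
apply: rmeasM; first exact: rmeas_cderiv_powR.
by apply: rmeas_powR; exact: rmeas_1subsq.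
Qed.

(** After Tonelli the inner integral runs over the shell 1 - |z| <= 2 (1 - |w|). A shell of width t
    has kernel mass at most M t, with M = 192 / (1 - |a|), so [layer_below] bounds the inner
    integral by a multiple of M (1 - |w|)^(1/2). This restores the exponent p - 1 of the Dirichlet
    integral, and 1 - |a|^2 <= 2 (1 - |a|) cancels the denominator of M, which makes the constant
    uniform in [a]. *)
Lemma carleson (p : R) : 0 < p -> exists2 C : R, 0 < C & forall f a,
  hol f -> normc a < 1 ->
  (aint (fun z => (dind z * normc (f z) `^ p * ((1 - normc a ^+ 2) * kern a z `^ (- 2%:R)))%:E)
   <= C%:E * ((normc (f 0) `^ p)%:E +
      aint (fun w => (dind w * (normc (cderiv f w) `^ p *
         (1 - normc w ^+ 2) `^ (p - 1)))%:E)))%E.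
Proof.
move=> p0; have [C1 C10 emb] := @pointwise_embedding R p p0.
have [K K0 lay] : exists2 K : R, 0 < K & _ := @layer_below R 1 2^-1 ltac:(lra).
(* [K] comes from the layers, 2^(1/2) from the factor 2 in [nearer], and the last factor from
   replacing 1 - |w| by 1 - |w|^2. *)
have [L LE] : exists L : R, L = K * 2 `^ 2^-1 * 2 `^ `|1 - p| by eexists.
have L0 : 0 < L by rewrite LE !mulr_gt0 ?powR_gt0.
exists (2 * C1 * 192 * (1 + L)) => [|f a hf a1].
  by rewrite !mulr_gt0// addr_gt0.
have a0 := normc_ge0 a; have da : 0 < 1 - normc a by rewrite subr_gt0.
have [M ME] : exists M : R, M = 192 / (1 - normc a) by eexists.
have M0 : 0 < M by rewrite ME divr_gt0.
pose W z := dind z * kern a z `^ (- 2%:R).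
have mk : rmeas (fun z => kern a z `^ (- 2%:R)) by apply: rmeas_powR; exact: rmeas_kern.
have mW : rmeas W by apply: rmeasM => //; exact: rmeas_dind.
have W0 z : 0 <= W z by rewrite mulr_ge0 ?dind_ge0 ?powR_ge0.
have WM : (aint (EFin \o W) <= M%:E)%E.
  have := kernel_shell a1 (@ltr01 R); rewrite mulr1 -ME.
  by have -> : (fun z => (shell 1 z * kern a z `^ (- 2%:R))%:E) = EFin \o W
    by apply/funext => z /=; rewrite /W dind_shell.
pose A z := W z * (1 - normc z) `^ (- 2^-1).
have mA : rmeas A by apply: rmeasM => //; apply: rmeas_powR; exact: rmeas_1sub.
have A0 z : 0 <= A z by rewrite mulr_ge0 ?powR_ge0.
pose B w := dind w * normc (cderiv f w) `^ p * (1 - normc w) `^ (p - 3 / 2).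
have mB : rmeas B.
  apply: rmeasM; first by apply: rmeas_cderiv_powR => //; rewrite gt_eqF.
  by apply: rmeas_powR; exact: rmeas_1sub.
have B0 w : 0 <= B w by rewrite !mulr_ge0 ?powR_ge0 ?dind_ge0.
pose J w := dind w * (normc (cderiv f w) `^ p * (1 - normc w ^+ 2) `^ (p - 1)).
have J0 w : 0 <= J w by rewrite !mulr_ge0 ?powR_ge0 ?dind_ge0.
have mJ : rmeas J by apply: rmeas_dirichlet_integrand; rewrite ?gt_eqF.
have inner w : normc w < 1 -> (aint (fun z => (A z * nearer z w)%:E) <=
    (K * M * (2 * (1 - normc w)) `^ 2^-1)%:E)%E.
  move=> w1; have r0 : 0 < 2 * (1 - normc w) by lra.
  pose v z := shell (2 * (1 - normc w)) z * kern a z `^ (- 2%:R).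
  have mv : rmeas v by apply: rmeasM => //; exact: rmeas_shell.
  have v0 z : 0 <= v z by rewrite mulr_ge0 ?shell_ge0 ?powR_ge0.
  have := lay (fun z => 1 - normc z) v M _ (@rmeas_1sub R) mv v0 (ltW M0) r0.
  have -> : (1 : R) - 2^-1 = 2^-1 by lra.
  have -> : (fun z => (A z * nearer z w)%:E) = (fun z => (v z * (1 - normc z) `^ (- 2^-1))%:E).
    by apply/funext => z; rewrite /A /W /v -dind_nearer; congr EFin; ring.
  apply.
  - move=> t t0; apply: le_trans (le_trans (kernel_shell a1 t0) _); last first.
      by rewrite powRr1 ?(ltW t0)// lee_fin ME mulrAC.
    apply: (@le_aint R (fun z => v z * ind_le t (1 - normc z))
      (fun z => shell t z * kern a z `^ (- 2%:R))).
    + by apply: rmeasM => //; apply: rmeas_ind_le; exact: rmeas_1sub.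
    + by apply: rmeasM => //; exact: rmeas_shell.
    + by move=> z; rewrite mulr_ge0 ?ind_le_ge0.
    + move=> z; rewrite /v mulrAC ler_wpM2r ?powR_ge0//.
      rewrite ind_leE -shellE; have := shell_ge0 t z.
      by rewrite (shellE (2 * _)); case: (_ && _)%B; rewrite ?mul1r ?mul0r//.
  - move=> z; rewrite mulf_eq0 negb_or shellE pnatr_eq0 eqb0 negbK.
    by move=> /andP[].
have step w : ((B w)%:E * aint (fun z => (A z * nearer z w)%:E) <= (M * L * J w)%:E)%E.
  rewrite /B /J; have [w1|w1] := ltP (normc w) 1; last first.
    by rewrite dind_out// !mul0r mul0e mulr0.
  rewrite dind_in// !mul1r; have w0 : 0 < 1 - normc w by rewrite subr_gt0.
  apply: le_trans (lee_wpmul2l _ (inner w w1)) _.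
    by rewrite lee_fin mulr_ge0 ?powR_ge0.
  rewrite -EFinM lee_fin powRM ?(ltW w0)//.
  have nw := normc_ge0 w.
  have r0 : 0 < 1 - normc w ^+ 2 by rewrite expr2; nra.
  have := @powR_comparable R (1 - normc w) (1 - normc w ^+ 2) (1 - p) r0.
  have -> : - (1 - p) = p - 1 by ring.
  move=> /(_ _)h; have {}h : (1 - normc w) `^ (p - 1) <=
    2 `^ `|1 - p| * (1 - normc w ^+ 2) `^ (p - 1) by apply: h; rewrite expr2; nra.
  have E : (1 - normc w) `^ (p - 3 / 2) * (1 - normc w) `^ 2^-1 = (1 - normc w) `^ (p - 1).
    rewrite -powRD ?(gt_eqF w0) ?implybT//; congr (_ `^ _); lra.
  set X := normc _ `^ p; have X0 : 0 <= X by exact: powR_ge0.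
  rewrite [leLHS](_ : _ = X * K * M * 2 `^ 2^-1 * ((1 - normc w) `^ (p - 3 / 2) *
    (1 - normc w) `^ 2^-1)); last by ring.
  rewrite E [leRHS](_ : _ = X * K * M * 2 `^ 2^-1 * (2 `^ `|1 - p| *
    (1 - normc w ^+ 2) `^ (p - 1))); last by rewrite LE; ring.
  by rewrite ler_wpM2l// !mulr_ge0 ?powR_ge0 ?(ltW K0) ?(ltW M0).
set F := normc (f 0) `^ p; have F0 : 0 <= F by exact: powR_ge0.
pose G z := ((F * W z)%:E + (A z)%:E * aint (fun w => (B w * nearer z w)%:E))%E.
have mG1 : cmeas (fun z => (F * W z)%:E).
  exact: (rmeas_EFin (rmeasM (@rmeas_cst R F) mW)).
have mG2 := cmeas_nearer_inner mA mB A0 B0.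
have G20 z : (0 <= (A z)%:E * aint (fun w => (B w * nearer z w)%:E))%E.
  apply: mule_ge0; first by rewrite lee_fin.
  by apply: integral_ge0 => w _; rewrite lee_fin mulr_ge0 ?nearer_ge0.
have G10 z : (0 <= (F * W z)%:E)%E by rewrite lee_fin mulr_ge0.
have GJ : (aint G <= (M * (1 + L))%:E * (F%:E + aint (EFin \o J)))%E.
  have -> : aint G = (F%:E * aint (EFin \o W) +
      aint (fun w => ((B w)%:E * aint (fun z => (A z * nearer z w)%:E))%E))%E.
    rewrite -(tonelli_nearer mA mB A0 B0) -(aintZl F0 mW W0).
    by rewrite /aint /G ge0_integralD.
  have i1 : (aint (fun w => ((B w)%:E * aint (fun z => (A z * nearer z w)%:E))%E) <=
      (M * L)%:E * aint (EFin \o J))%E.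
    have ML0 : 0 <= M * L by rewrite mulr_ge0 ?ltW.
    rewrite -(aintZl ML0 mJ J0); apply: ge0_le_integral => //.
    - move=> w _; apply: mule_ge0; first by rewrite lee_fin.
      by apply: integral_ge0 => z _; rewrite lee_fin mulr_ge0 ?nearer_ge0.
    - exact: (cmeas_nearer_outer mA mB A0 B0).
    - exact: (rmeas_EFin (rmeasM (@rmeas_cst R (M * L)) mJ)).
  have JJ : (0 <= aint (EFin \o J))%E by apply: integral_ge0 => w _; rewrite lee_fin.
  apply: (@le_trans _ _ (F%:E * M%:E + (M * L)%:E * aint (EFin \o J))%E).
    apply: leeD => //; apply: lee_wpmul2l => //; by rewrite lee_fin.
  rewrite [leRHS]ge0_muleDr ?lee_fin//; apply: leeD.
    rewrite -EFinM lee_fin mulrC ler_wpM2r// ler_peMr ?(ltW M0)//.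
    by rewrite lerDl ltW.
  apply: lee_wpmul2r => //; rewrite lee_fin ler_wpM2l ?(ltW M0)//.
  by rewrite lerDr.
have ca0 : 0 <= (1 - normc a ^+ 2) * C1.
  by rewrite mulr_ge0 ?(ltW C10)// expr2; nra.
have G0 z : (0 <= G z)%E by rewrite adde_ge0.
have mG : cmeas G by exact: emeasurable_funD.
have -> : (2 * C1 * 192 * (1 + L))%:E = ((2 * (1 - normc a) * C1)%:E * (M * (1 + L))%:E)%E.
  by rewrite -EFinM; congr EFin; rewrite ME; field; rewrite gt_eqF.
rewrite -muleA; apply: (@le_trans _ _ (((1 - normc a ^+ 2) * C1)%:E * aint G)%E); last first.
  apply: le_trans (lee_wpmul2l _ GJ).
    apply: lee_wpmul2r; first by apply: integral_ge0 => w _; exact: G0.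
    by rewrite lee_fin ler_wpM2r ?(ltW C10)// expr2; nra.
  by rewrite lee_fin !mulr_ge0 ?(ltW C10) ?(ltW da).
rewrite /aint -ge0_integralZl//.
apply: ge0_le_integral => //.
- move=> w _; rewrite lee_fin mulr_ge0 ?mulr_ge0 ?dind_ge0 ?powR_ge0//.
  by rewrite expr2; nra.
- apply/measurable_EFinP; apply: (@rmeasM R (fun z => dind z * normc (f z) `^ p)
    (fun z => (1 - normc a ^+ 2) * kern a z `^ (- 2%:R))).
    by apply: rmeas_hol_powR => //; rewrite gt_eqF.
  by apply: rmeasM => //; exact: rmeas_cst.
- apply: emeasurable_funM => //; exact: measurable_cst.
- move=> w _; set z := pl w; rewrite /G /A /W; have [z1|z1] := ltP (normc z) 1; last first.
    by rewrite dind_out// !(mul0r, mulr0) mul0e adde0 mule0.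
  rewrite dind_in// !mul1r; have := emb f z hf z1; rewrite -/F => h.
  set N := aint _ in h *.
  set kk := kern a z `^ _; have kk0 : 0 <= kk by exact: powR_ge0.
  have cc0 : 0 <= (1 - normc a ^+ 2) * kk by rewrite mulr_ge0// expr2; nra.
  rewrite EFinM muleC; apply: (le_trans (lee_wpmul2l _ h)); first by rewrite lee_fin.
  rewrite [in leRHS]EFinM [(F * kk)%:E]EFinM [(kk * _)%:E]EFinM.
  rewrite [(((1 - _) * kk)%:E)]EFinM.
  have -> : (F%:E * kk%:E + kk%:E * ((1 - normc z) `^ (- 2^-1))%:E * N =
      kk%:E * (F%:E + ((1 - normc z) `^ (- 2^-1))%:E * N))%E.
    have PN0 : (0 <= ((1 - normc z) `^ (- 2^-1))%:E * N)%E.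
      apply: mule_ge0; first by rewrite lee_fin powR_ge0.
      apply: integral_ge0 => w' _; rewrite lee_fin.
      exact: mulr_ge0 (B0 _) (nearer_ge0 _ _).
    by rewrite [RHS]ge0_muleDr ?lee_fin// (muleC F%:E) muleA.
  by rewrite -!muleA [(kk%:E * (C1%:E * _))%E]muleCA.
Qed.

End Carleson.

(** * Bounded multipliers *)

Section Multiplication.
Variable R : realType.
Implicit Types (f g h : R[i] -> R[i]) (z w a : R[i]) (u : R[i] -> R).

Lemma hol_holomorphic f : hol f <-> holomorphic_disc f.
Proof. by rewrite holomorphic_discP. Qed.

Lemma kern_gt0 a z : normc a < 1 -> normc z < 1 -> 0 < kern a z.
Proof.
move=> a1 z1; apply: lt_le_trans (kern_ge a z); rewrite subr_gt0.
apply: le_lt_trans z1; rewrite -[leRHS]mul1r ler_wpM2r ?normc_ge0 ?(ltW a1)//.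
Qed.

Lemma kern_powRN2 a z : kern a z `^ (- 2%:R) = (kern a z ^+ 2)^-1.
Proof. by rewrite powRN powR_mulrn ?kern_ge0. Qed.

Lemma sqr_sub_lt1 (x : R) : 0 <= x -> x < 1 -> 0 < 1 - x ^+ 2.
Proof. by move=> x0 x1; rewrite expr2; nra. Qed.

Lemma kern_diag a : normc a < 1 -> kern a a = 1 - normc a ^+ 2.
Proof.
move=> a1; rewrite /kern -[a^* * a]mulrC -normCK normCE -rmorphXn.
rewrite -(rmorph1 (@real_complex R)) -rmorphB normc_real ger0_norm//.
by rewrite ltW// sqr_sub_lt1// normc_ge0.
Qed.

Lemma sigmaE a z : normc a < 1 -> normc z < 1 ->
  1 - normc (sigma a z) ^+ 2 =
  (1 - normc a ^+ 2) * (1 - normc z ^+ 2) * kern a z `^ (- 2%:R).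
Proof.
move=> a1 z1; have k0 := kern_gt0 a1 z1.
rewrite kern_powRN2 /sigma normcM normcV -/(kern a z) expr_div_n.
have -> : normc (a - z) ^+ 2 = kern a z ^+ 2 - (1 - normc a ^+ 2) * (1 - normc z ^+ 2).
  rewrite /kern !sqr_normcE; case: a {a1 k0} => [x y]; case: z {z1} => [s t] /=; ring.
by field; rewrite gt_eqF.
Qed.

Lemma sigma_weight01 a z : normc a < 1 -> normc z < 1 ->
  0 <= (1 - normc a ^+ 2) * (1 - normc z ^+ 2) * kern a z `^ (- 2%:R) <= 1.
Proof.
move=> a1 z1; apply/andP; split.
  by rewrite !mulr_ge0 ?powR_ge0// ltW// sqr_sub_lt1// normc_ge0.
by rewrite -sigmaE// gerBl sqr_ge0.
Qed.

Lemma F_integrandE (p q : R) h a : normc a < 1 ->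
  disc_integral (fun z => normc (cderiv h z) `^ p * (1 - normc z ^+ 2) `^ q *
    (1 - normc (sigma a z) ^+ 2) `^ 1) =
  ((pi^-1)%:E * aint (fun z => (dind z * normc (cderiv h z) `^ p *
    ((1 - normc z ^+ 2) `^ q *
     ((1 - normc a ^+ 2) * (1 - normc z ^+ 2) * kern a z `^ (- 2%:R))))%:E))%E.
Proof.
move=> a1; rewrite disc_integralE; congr (_ * aint _)%E; apply/funext => z.
congr EFin; have [z1|z1] := ltP (normc z) 1; last by rewrite dind_out// !mul0r.
have /andP[s0 _] := sigma_weight01 a1 z1.
by rewrite sigmaE// powRr1// !mulrA.
Qed.

Lemma rmeas_F_integrand (p q : R) h a : p != 0 -> hol h ->
  rmeas (fun z => dind z * normc (cderiv h z) `^ p * ((1 - normc z ^+ 2) `^ q *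
     ((1 - normc a ^+ 2) * (1 - normc z ^+ 2) * kern a z `^ (- 2%:R)))).
Proof.
move=> p0 hh; apply: rmeasM; first exact: rmeas_cderiv_powR.
apply: rmeasM; first by apply: rmeas_powR; exact: rmeas_1subsq.
apply: rmeasM; last by apply: rmeas_powR; exact: rmeas_kern.
by apply: rmeasM; [exact: rmeas_cst|exact: rmeas_1subsq].
Qed.

Lemma has_cderiv_mulop f g z : hol f -> hol g -> normc z < 1 ->
  has_cderiv (mulop g f) z (cderiv f z * g z + f z * cderiv g z).
Proof. by move=> hf hg z1; apply: has_cderivM; [exact: hf|exact: hg]. Qed.

Lemma cderiv_mulop f g z : hol f -> hol g -> normc z < 1 ->
  cderiv (mulop g f) z = cderiv f z * g z + f z * cderiv g z.
Proof. by move=> hf hg z1; apply: cderivE; exact: has_cderiv_mulop. Qed.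

Lemma hol_mulop f g : hol f -> hol g -> hol (mulop g f).
Proof. by move=> hf hg z z1; rewrite cderiv_mulop//; exact: has_cderiv_mulop. Qed.

Lemma bounded_cderiv_le g (G : R) z : hol g -> (forall z, normc z < 1 -> normc (g z) <= G) ->
  normc z < 1 -> normc (cderiv g z) <= 8 * G / (1 - normc z).
Proof.
move=> hg gG z1; have r0 : 0 < 1 - normc z by rewrite subr_gt0.
have inD w : normc (w - z) < 1 - normc z -> normc w < 1.
  by move=> h; apply: in_disc_sub h _; rewrite addrCA subrr addr0.
apply: (@cauchy_estimate R g (cderiv g)) => // w /inD w1; [exact: hg|exact: gG].
Qed.

(** The letters stand for T = |(f g)'|, x = |f'|, y = |f|, b = |g|, c = |g'|, n = |z|, A = 1 - |a|^2
    and k = |1 - conj(a) z|^-2. In the first term the weight A (1 - n^2) k is bounded by 1. In the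
    second, the factor (1 - n)^(-p) from g' meets (1 - n^2)^p, and their product is at most 2^p;
    this turns 8^p into 16^p. *)
Lemma product_rule_powR_le (p T x y b c G A k n : R) : 0 < p ->
  0 <= T -> 0 <= x -> 0 <= y -> 0 <= b -> 0 <= c -> 0 <= G -> 0 <= A -> 0 <= k ->
  0 <= n -> n < 1 -> T <= x * b + y * c -> b <= G -> c <= 8 * G / (1 - n) ->
  0 <= A * (1 - n ^+ 2) * k <= 1 ->
  T `^ p * ((1 - n ^+ 2) `^ (p - 1) * (A * (1 - n ^+ 2) * k)) <=
  2 `^ p * G `^ p * (x `^ p * (1 - n ^+ 2) `^ (p - 1) + 16 `^ p * (y `^ p * (A * k))).
Proof.
move=> p0 T0 x0 y0 b0 c0 G0 A0 k0 n0 n1 TT bG cG /andP[].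
set s := 1 - n ^+ 2; have s0 : 0 < s by exact: sqr_sub_lt1.
move=> w0 w1; have r0 : 0 < 1 - n by lra.
have s2 : s <= 2 * (1 - n) by rewrite /s expr2; nra.
have H1 : T `^ p <= 2 `^ p * ((x * G) `^ p + (y * (8 * G / (1 - n))) `^ p).
  apply: le_trans (powR_add_le p0 _ _); rewrite ?mulr_ge0 ?invr_ge0 ?(ltW r0)//.
  apply: ge0_ler_powR; rewrite ?nnegrE ?(ltW p0)// ?addr_ge0 ?mulr_ge0 ?invr_ge0 ?(ltW r0)//.
  by apply: le_trans TT _; apply: lerD; apply: ler_wpM2l.
have sp : s `^ (p - 1) * s = s `^ p.
  by rewrite -{2}[s]powRr1 ?(ltW s0)// -powRD ?subrK// gt_eqF ?implybT.
have W0 : 0 <= s `^ (p - 1) * (A * s * k) by rewrite mulr_ge0 ?powR_ge0.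
apply: le_trans (ler_wpM2r W0 H1) _.
rewrite -!mulrA ler_wpM2l ?powR_ge0// mulrDl [leRHS]mulrDr; apply: lerD.
  rewrite powRM//.
  rewrite [leLHS](_ : _ = G `^ p * (x `^ p * s `^ (p - 1)) * (A * s * k)); last by ring.
  by apply: ler_piMr => //; rewrite !mulr_ge0 ?powR_ge0.
rewrite !powRM ?mulr_ge0 ?invr_ge0 ?(ltW r0)//.
rewrite [leLHS](_ : _ = y `^ p * 8 `^ p * G `^ p * ((1 - n)^-1 `^ p * (s `^ (p - 1) * s)) * (A * k));
  last by ring.
rewrite [leRHS](_ : _ = y `^ p * G `^ p * 16 `^ p * (A * k)); last by ring.
apply: ler_wpM2r; first by rewrite mulr_ge0.
rewrite sp -(@powRM R (1 - n)^-1 s p) ?invr_ge0 ?(ltW r0) ?(ltW s0)//.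
rewrite [leLHS](_ : _ = y `^ p * G `^ p * (8 `^ p * ((1 - n)^-1 * s) `^ p)); last by ring.
rewrite ler_wpM2l ?mulr_ge0 ?powR_ge0// -(@powRM R 8) ?mulr_ge0 ?invr_ge0 ?(ltW r0) ?(ltW s0)//.
have q0 : 0 <= (1 - n)^-1 * s by rewrite mulr_ge0 ?invr_ge0 ?(ltW r0) ?(ltW s0).
have q2 : (1 - n)^-1 * s <= 2 by rewrite mulrC ler_pdivrMr.
move: ((1 - n)^-1 * s) q0 q2 => v q0 q2.
by apply: ge0_ler_powR; rewrite ?nnegrE ?(ltW p0)// ?mulr_ge0//; lra.
Qed.

Lemma mulop_integrand_le (p : R) f g (G : R) a z : 0 < p -> hol f -> hol g ->
  0 <= G -> (forall z, normc z < 1 -> normc (g z) <= G) -> normc a < 1 -> normc z < 1 ->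
  normc (cderiv (mulop g f) z) `^ p * ((1 - normc z ^+ 2) `^ (p - 1) *
     ((1 - normc a ^+ 2) * (1 - normc z ^+ 2) * kern a z `^ (- 2%:R))) <=
  2 `^ p * G `^ p * (normc (cderiv f z) `^ p * (1 - normc z ^+ 2) `^ (p - 1) +
    16 `^ p * (normc (f z) `^ p * ((1 - normc a ^+ 2) * kern a z `^ (- 2%:R)))).
Proof.
move=> p0 hf hg G0 gG a1 z1.
have A0 : 0 <= 1 - normc a ^+ 2 by rewrite ltW// sqr_sub_lt1// normc_ge0.
have TT : normc (cderiv (mulop g f) z) <=
    normc (cderiv f z) * normc (g z) + normc (f z) * normc (cderiv g z).
  rewrite (cderiv_mulop hf hg z1) -(normcM (cderiv f z)) -(normcM (f z)).
  exact: (le_normcD (cderiv f z * g z) (f z * cderiv g z)).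
exact: (@product_rule_powR_le p (normc (cderiv (mulop g f) z)) (normc (cderiv f z))
  (normc (f z)) (normc (g z)) (normc (cderiv g z)) G (1 - normc a ^+ 2)
  (kern a z `^ (- 2%:R)) (normc z) p0 (normc_ge0 _) (normc_ge0 _) (normc_ge0 _)
  (normc_ge0 _) (normc_ge0 _) G0 A0 (powR_ge0 _ _) (normc_ge0 _) z1 TT (gG z z1)
  (bounded_cderiv_le hg gG z1) (sigma_weight01 a1 z1)).
Qed.

Lemma mulop_area_le (p : R) : 0 < p -> exists2 C : R, 0 < C & forall f g (G : R) a,
  hol f -> hol g -> 0 <= G -> (forall z, normc z < 1 -> normc (g z) <= G) -> normc a < 1 ->
  (aint (fun z => (dind z * normc (cderiv (mulop g f) z) `^ p * ((1 - normc z ^+ 2) `^ (p - 1) *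
     ((1 - normc a ^+ 2) * (1 - normc z ^+ 2) * kern a z `^ (- 2%:R))))%:E) <=
   (G `^ p * C)%:E * ((normc (f 0) `^ p)%:E + aint (fun w => (dind w *
      (normc (cderiv f w) `^ p * (1 - normc w ^+ 2) `^ (p - 1)))%:E)))%E.
Proof.
move=> p0; have [K K0 car] := @carleson R p p0.
exists (2 `^ p * (1 + 16 `^ p * K)) => [|f g G a hf hg G0 gG a1].
  by rewrite mulr_gt0 ?powR_gt0// addr_gt0// mulr_gt0 ?powR_gt0.
have pn : p != 0 by rewrite gt_eqF.
have := car f a hf a1.
set F := normc (f 0) `^ p; have F0 : 0 <= F by exact: powR_ge0.
pose J w := dind w * (normc (cderiv f w) `^ p * (1 - normc w ^+ 2) `^ (p - 1)).
have J0 w : 0 <= J w by rewrite !mulr_ge0 ?powR_ge0 ?dind_ge0.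
have mJ : rmeas J by exact: rmeas_dirichlet_integrand.
pose L z := dind z * normc (f z) `^ p * ((1 - normc a ^+ 2) * kern a z `^ (- 2%:R)).
have L0 z : 0 <= L z.
  by rewrite !mulr_ge0 ?powR_ge0 ?dind_ge0// ltW// sqr_sub_lt1// normc_ge0.
have mL : rmeas L.
  apply: rmeasM; first exact: rmeas_hol_powR.
  by apply: rmeasM; [exact: rmeas_cst|apply: rmeas_powR; exact: rmeas_kern].
rewrite -/(EFin \o J) -/(EFin \o L) => {}car.
have tp0 : 0 <= 16 `^ p :> R by exact: powR_ge0.
have c0 : 0 <= 2 `^ p * G `^ p by rewrite mulr_ge0 ?powR_ge0.
have mL' : rmeas (fun z => 16 `^ p * L z) by apply: rmeasM => //; exact: rmeas_cst.
have L'0 z : 0 <= 16 `^ p * L z by rewrite mulr_ge0.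
apply: (@le_trans _ _ (aint (fun z => (2 `^ p * G `^ p * (J z + 16 `^ p * L z))%:E))).
  apply: (@le_aint R (fun z => dind z * normc (cderiv (mulop g f) z) `^ p * ((1 - normc z ^+ 2) `^ (p - 1) *
     ((1 - normc a ^+ 2) * (1 - normc z ^+ 2) * kern a z `^ (- 2%:R))))
     (fun z => 2 `^ p * G `^ p * (J z + 16 `^ p * L z))).
  - exact: (rmeas_F_integrand (p - 1) a pn (hol_mulop hf hg)).
  - by apply: rmeasM; [exact: rmeas_cst|exact: rmeasD].
  - move=> z; have [z1|z1] := ltP (normc z) 1; last by rewrite dind_out// !mul0r.
    have /andP[s0 _] := sigma_weight01 a1 z1.
    by apply: mulr_ge0; apply: mulr_ge0; rewrite ?dind_ge0 ?powR_ge0.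
  - move=> z; rewrite /J /L; have [z1|z1] := ltP (normc z) 1; last first.
      by rewrite dind_out// !mul0r mulr0 addr0 mulr0.
    rewrite dind_in// !mul1r; exact: mulop_integrand_le.
rewrite (aintZl c0 (rmeasD mJ mL')); last by move=> z; rewrite addr_ge0.
rewrite -/(EFin \o (fun z => J z + 16 `^ p * L z)).
have -> : aint (EFin \o (fun z => J z + 16 `^ p * L z)) =
    (aint (EFin \o J) + (16 `^ p)%:E * aint (EFin \o L))%E.
  by rewrite -(aintZl tp0 mL L0); exact: (aintD mJ mL' J0 L'0).
have I0 : (0 <= aint (EFin \o J))%E by apply: integral_ge0 => w _; rewrite lee_fin.
rewrite (_ : G `^ p * (2 `^ p * (1 + 16 `^ p * K)) = 2 `^ p * G `^ p * (1 + 16 `^ p * K)); last by ring.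
rewrite [((2 `^ p * G `^ p) * (1 + _))%:E]EFinM -[leRHS]muleA.
apply: lee_wpmul2l; first by rewrite lee_fin.
rewrite [(1 + _)%:E]EFinD ge0_muleDl ?lee_fin ?mulr_ge0 ?(ltW K0)// mul1e.
apply: leeD; first by rewrite leeDr ?lee_fin.
rewrite EFinM -muleA; apply: lee_wpmul2l => //; by rewrite lee_fin.
Qed.

Lemma F_seminorm_ge0 (p q : R) h :
  (0 <= ereal_sup [set disc_integral (fun z =>
      (normc (cderiv h z) `^ p * (1 - normc z ^+ 2) `^ q *
       (1 - normc (sigma a z) ^+ 2) `^ 1)%R) | a in @disc R])%E.
Proof.
have pi0 : 0 <= (pi : R)^-1 by rewrite invr_ge0 pi_ge0.
apply: (@le_trans _ _ (disc_integral (fun z =>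
      (normc (cderiv h z) `^ p * (1 - normc z ^+ 2) `^ q *
       (1 - normc (sigma 0 z) ^+ 2) `^ 1)%R))).
  rewrite disc_integralE; apply: mule_ge0; first by rewrite lee_fin.
  apply: integral_ge0 => w _; rewrite lee_fin; apply: mulr_ge0; first exact: dind_ge0.
  by apply: mulr_ge0; [apply: mulr_ge0|]; exact: powR_ge0.
by apply: ereal_sup_ubound; exists 0; [rewrite /disc /mkset normc0|].
Qed.

Lemma mulop_F_norm_le (p : R) : 0 < p -> exists2 C : R, 0 < C & forall f g (G : R),
  hol f -> hol g -> 0 <= G -> (forall z, normc z < 1 -> normc (g z) <= G) ->
  (F_norm p (p - 1) 1 (mulop g f) <= (C * G)%:E * dirichlet_norm p f)%E.
Proof.
move=> p0; have [K K0 est] := @mulop_area_le p p0.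
(* 1 accounts for the value at 0 and [K] for the supremum. *)
exists ((1 + K) `^ p^-1) => [|f g G hf hg G0 gG]; first by rewrite powR_gt0// addr_gt0.
have pV0 : 0 <= p^-1 by rewrite invr_ge0 ltW.
have := fun a => est f g G a hf hg G0 gG.
rewrite /F_norm /dirichlet_norm disc_integralE.
set F := normc (f 0) `^ p; have F0 : 0 <= F by exact: powR_ge0.
set I := aint _ => {}est.
have I0 : (0 <= I)%E.
  by apply: integral_ge0 => w _; rewrite lee_fin !mulr_ge0 ?powR_ge0 ?dind_ge0.
have pi0 : 0 <= (pi : R)^-1 by rewrite invr_ge0 pi_ge0.
(* The area estimate is multiplied by 1/pi as a whole, whereas the Dirichlet norm carries this
   factor on the integral only; on |f(0)|^p it is bounded by 1. *)
have pi1 : (pi : R)^-1 <= 1 by rewrite invf_le1 ?pi_gt0//; apply: le_trans (pi_ge2 R); lra.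
set N := (F%:E + _ * I)%E.
have N0 : (0 <= N)%E by rewrite adde_ge0 ?lee_fin// mule_ge0 ?lee_fin.
have Gp0 : 0 <= G `^ p by exact: powR_ge0.
have -> : (((1 + K) `^ p^-1 * G)%:E * N `^ p^-1 = ((G `^ p * (1 + K))%:E * N) `^ p^-1)%E.
  have GK0 : 0 <= G `^ p * (1 + K) by rewrite mulr_ge0// addr_ge0// ltW.
  rewrite poweRM ?lee_fin// poweR_EFin powRM ?addr_ge0 ?(ltW K0)// -powRrM divff ?gt_eqF//.
  by rewrite powRr1// (mulrC G).
have S : (ereal_sup [set disc_integral (fun z =>
      (normc (cderiv (mulop g f) z) `^ p * (1 - normc z ^+ 2) `^ (p - 1) *
       (1 - normc (sigma a z) ^+ 2) `^ 1)%R) | a in @disc R] <= (G `^ p * K)%:E * N)%E.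
  apply: ge_ereal_sup => _ [a a1 <-].
  rewrite F_integrandE//; apply: le_trans (lee_wpmul2l _ (est a a1)) _; first by rewrite lee_fin.
  rewrite muleCA; apply: lee_wpmul2l; first by rewrite lee_fin mulr_ge0// ltW.
  rewrite /N ge0_muleDr ?lee_fin//; apply: leeD => //.
  by rewrite -EFinM lee_fin ler_piMl.
have M0 : ((normc (mulop g f 0) `^ p)%:E <= (G `^ p)%:E * N)%E.
  apply: (@le_trans _ _ ((G `^ p)%:E * F%:E)%E).
    rewrite -EFinM lee_fin /mulop normcM powRM ?normc_ge0// mulrC ler_wpM2r//.
    apply: ge0_ler_powR; rewrite ?nnegrE ?normc_ge0 ?(ltW p0)//.
    by apply: gG; rewrite normc0.
  apply: lee_wpmul2l; first by rewrite lee_fin.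
  by rewrite leeDl// mule_ge0 ?lee_fin.
have sup0 := F_seminorm_ge0 p (p - 1) (mulop g f).
apply: gt0_ler_poweR => //; rewrite ?in_itv /= ?leey ?andbT.
- by rewrite adde_ge0 ?lee_fin ?powR_ge0.
- by rewrite mule_ge0 ?lee_fin ?mulr_ge0// addr_ge0// ltW.
- rewrite mulrDr mulr1 EFinD ge0_muleDl ?lee_fin ?mulr_ge0 ?(ltW K0)//.
  exact: leeD.
Qed.

End Multiplication.

(** * Test functions *)

Section TestFunctions.
Variable R : realType.
Implicit Types (f g h : R[i] -> R[i]) (z w a : R[i]) (u : R[i] -> R).

(** Two layerings. In 1 - |z|, [layer_below] gives a shell of width t the weighted mass K1 M t^p.
    Since 1 - |z| <= |1 - conj(a) z|, the part of the disc where the kernel modulus is at most t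
    lies in that shell, so [layer_above] applies in this modulus, which is at least 1 - |a|. The
    remaining power -1 of 1 - |a| comes from M. *)
Lemma kernel_weight (p be : R) : 0 < p -> p < be -> exists2 K : R, 0 < K & forall a, normc a < 1 ->
  (aint (fun z => (dind z * kern a z `^ (- 2%:R) * (1 - normc z) `^ (p - 1) *
     kern a z `^ (- be))%:E) <= (K * (1 - normc a) `^ (p - be - 1))%:E)%E.
Proof.
move=> p0 pbe; have p1 : 1 - p < 1 by lra.
have [K1 K10 lb] := @layer_below R 1 (1 - p) p1.
have [K2 K20 la] := @layer_above R p be pbe.
exists (K2 * K1 * 192) => [|a a1]; first by apply: mulr_gt0 => //; exact: mulr_gt0.
have d0 : 0 < 1 - normc a by rewrite subr_gt0.
have [M ME] : exists M : R, M = 192 / (1 - normc a) by eexists.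
have M0 : 0 < M by rewrite ME; exact: divr_gt0.
pose W t z := shell t z * kern a z `^ (- 2%:R).
have mk : rmeas (fun z => kern a z `^ (- 2%:R)) by apply: rmeas_powR; exact: rmeas_kern.
have mW t : rmeas (W t) by apply: rmeasM => //; exact: rmeas_shell.
have W0 t z : 0 <= W t z by rewrite mulr_ge0 ?shell_ge0 ?powR_ge0.
have ms : rmeas (fun z => (1 - normc z) `^ (p - 1)) by apply: rmeas_powR; exact: rmeas_1sub.
have below t : 0 < t -> (aint (fun z => (W t z * (1 - normc z) `^ (p - 1))%:E) <=
    (K1 * M * t `^ p)%:E)%E.
  move=> t0; have := lb (fun z => 1 - normc z) (W t) M t (@rmeas_1sub R) (mW t) (W0 t) (ltW M0) t0.
  have -> : (1 : R) - (1 - p) = p by ring.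
  have -> : - (1 - p) = p - 1 by ring.
  apply.
  - move=> s s0; apply: le_trans (le_trans (kernel_shell a1 s0) _); last first.
      by rewrite powRr1 ?(ltW s0)// lee_fin ME mulrAC.
    apply: (@le_aint R (fun z => W t z * ind_le s (1 - normc z))
      (fun z => shell s z * kern a z `^ (- 2%:R))).
    + by apply: rmeasM => //; apply: rmeas_ind_le; exact: rmeas_1sub.
    + exact: mW.
    + by move=> z; rewrite mulr_ge0 ?ind_le_ge0.
    + move=> z; rewrite /W mulrAC ler_wpM2r ?powR_ge0//.
      rewrite ind_leE -shellE; have := shell_ge0 s z.
      by rewrite (shellE t); case: (_ && _)%B; rewrite ?mul1r ?mul0r.
  - move=> z; rewrite mulf_eq0 negb_or shellE pnatr_eq0 eqb0 negbK.
    by move=> /andP[].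
pose v z := dind z * kern a z `^ (- 2%:R) * (1 - normc z) `^ (p - 1).
have mv : rmeas v.
  by apply: rmeasM => //; apply: rmeasM => //; exact: rmeas_dind.
have v0 z : 0 <= v z by rewrite !mulr_ge0 ?powR_ge0 ?dind_ge0.
have KM0 : 0 <= K1 * M by rewrite mulr_ge0 ?ltW.
have kz z : normc z < 1 -> 1 - normc z <= kern a z /\ 1 - normc a <= kern a z.
  move=> z1; have := kern_ge a z; have := normc_ge0 z; have := normc_ge0 a; nra.
have := la (kern a) v (K1 * M) (1 - normc a) (rmeas_kern a) mv v0 KM0 d0.
have -> : K2 * (K1 * M) * (1 - normc a) `^ (p - be) = K2 * K1 * 192 * (1 - normc a) `^ (p - be - 1).
  rewrite [in RHS]powRD ?(gt_eqF d0) ?implybT// powR_inv1 ?(ltW d0)// ME; ring.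
apply.
- move=> t t0; apply: le_trans (below t t0).
  apply: (@le_aint R (fun z => v z * ind_le t (kern a z)) (fun z => W t z * (1 - normc z) `^ (p - 1))).
  + by apply: rmeasM => //; apply: rmeas_ind_le; exact: rmeas_kern.
  + exact: rmeasM.
  + by move=> z; rewrite mulr_ge0 ?ind_le_ge0.
  + move=> z; rewrite /v /W mulrAC ler_wpM2r ?powR_ge0// mulrAC ler_wpM2r ?powR_ge0//.
    have [z1|z1] := ltP (normc z) 1; last by rewrite dind_out// mul0r shell_ge0.
    rewrite dind_in// mul1r ind_leE shellE ler_nat subr_gt0 z1/=.
    case: (lerP (kern a z) t) => kt; last by rewrite andbF.
    by rewrite (le_trans (kz z z1).1 kt) leq_b1.
- move=> z vz; apply: (kz z _).2; rewrite ltNge; apply/negP => z1.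
  by move: vz; rewrite /v dind_out// !mul0r eqxx.
Qed.

Definition test_fun a (c : R) n z : R[i] := c%:C * ((1 - a^* * z) ^+ n.+1)^-1.

Lemma kern_neq0 a z : normc a < 1 -> normc z < 1 -> 1 - a^* * z != 0.
Proof. by move=> a1 z1; rewrite -normc_gt0; exact: kern_gt0. Qed.

Lemma has_cderiv_test_fun a c n z : normc a < 1 -> normc z < 1 ->
  has_cderiv (test_fun a c n) z (c%:C * (- (n.+1%:R * (1 - a^* * z) ^+ n * - a^*) /
    ((1 - a^* * z) ^+ n.+1) ^+ 2)).
Proof.
move=> a1 z1; apply: has_cderivZ.
apply: (@has_cderivV R (fun w => (1 - a^* * w) ^+ n.+1)); last by rewrite expf_neq0// kern_neq0.
apply: (@has_cderivX R (fun w => 1 - a^* * w)).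
have := @has_cderiv_affine R 1 (- a^*) z.
by congr has_cderiv; apply/funext => w; rewrite mulNr.
Qed.

Lemma hol_test_fun a c n : normc a < 1 -> hol (test_fun a c n).
Proof.
move=> a1 z z1; have H := @has_cderiv_test_fun a c n z a1 z1.
by rewrite (cderivE H).
Qed.

Lemma normc_natr n : normc (n%:R : R[i]) = n%:R.
Proof. by rewrite -(rmorph_nat (@real_complex R)) normc_real ger0_norm. Qed.

Lemma normc_test_fun a c n z : 0 <= c ->
  normc (test_fun a c n z) = c * (kern a z ^+ n.+1)^-1.
Proof.
by move=> c0; rewrite /test_fun normcM normc_real ger0_norm// normcV normcX.
Qed.

Lemma cderiv_test_fun_le a c n z : 0 <= c -> normc a < 1 -> normc z < 1 ->
  normc (cderiv (test_fun a c n) z) <= c * n.+1%:R * kern a z `^ (- n.+2%:R).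
Proof.
move=> c0 a1 z1; rewrite (cderivE (@has_cderiv_test_fun a c n z a1 z1)).
have k0 := kern_gt0 a1 z1.
rewrite mulrN opprK normcM normc_real ger0_norm// normcM normcV !normcM !normcX normc_natr normc_conj.
rewrite -/(kern a z) powRN powR_mulrn ?(ltW k0)//.
rewrite [leLHS](_ : _ = c * n.+1%:R * (kern a z ^+ n.+2)^-1 * normc a); last first.
  move: k0; move: (kern a z) => k k0; have kn : k ^+ n != 0 by rewrite expf_neq0// gt_eqF.
  rewrite !exprS. field. by rewrite kn gt_eqF.
by rewrite ler_piMr ?(ltW a1)// !mulr_ge0// invr_ge0 exprn_ge0 // ltW.
Qed.

(** The p-th power of the bound c (n + 1) |1 - conj(a) z|^(-(n + 2)) on |f'| is split into the
    exponents -2 and [- be] of [kernel_weight]; its condition [p < be] amounts to (n + 1) p > 2. *)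
Lemma test_fun_dirichlet (p : R) n : 0 < p -> 2 < n.+1%:R * p -> exists2 L : R, 0 < L &
  forall a (c : R), normc a < 1 -> 0 <= c ->
  (aint (fun z => (dind z * (normc (cderiv (test_fun a c n) z) `^ p *
     (1 - normc z ^+ 2) `^ (p - 1)))%:E) <= (L * c `^ p * (1 - normc a) `^ (1 - n.+1%:R * p))%:E)%E.
Proof.
move=> p0 np; pose be : R := n.+2%:R * p - 2%:R.
have nS : n.+2%:R = n.+1%:R + 1 :> R by rewrite -natr1.
have pbe : p < be by rewrite /be nS mulrDl mul1r; move: np; move: (n.+1%:R * p) => x; lra.
have [K K0 HK] := kernel_weight p0 pbe.
have [B BE] : exists B : R, B = n.+1%:R `^ p * 2 `^ `|p - 1| by eexists.
have B0 : 0 < B by rewrite BE !mulr_gt0 ?powR_gt0// ltr0n.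
exists (B * K) => [|a c a1 c0]; first exact: mulr_gt0.
have pn : p != 0 by rewrite gt_eqF.
have Bc0 : 0 <= B * c `^ p by rewrite mulr_ge0 ?powR_ge0// ltW.
pose u z := dind z * kern a z `^ (- 2%:R) * (1 - normc z) `^ (p - 1) * kern a z `^ (- be).
have mk b : rmeas (fun z => kern a z `^ b) by apply: rmeas_powR; exact: rmeas_kern.
have mu1 : rmeas u.
  do 2![apply: rmeasM => //]; last by apply: rmeas_powR; exact: rmeas_1sub.
  by apply: rmeasM => //; exact: rmeas_dind.
have u0 z : 0 <= u z by rewrite !mulr_ge0 ?powR_ge0 ?dind_ge0.
apply: (@le_trans _ _ ((B * c `^ p)%:E * aint (EFin \o u))%E); last first.
  apply: (le_trans (lee_wpmul2l _ (HK a a1))); first by rewrite lee_fin.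
  rewrite -EFinM lee_fin (_ : p - be - 1 = 1 - n.+1%:R * p); last by rewrite /be nS; ring.
  by rewrite le_eqVlt; apply/orP; left; apply/eqP; ring.
rewrite -(aintZl Bc0 mu1 u0).
apply: (@le_aint R (fun z => dind z * (normc (cderiv (test_fun a c n) z) `^ p *
     (1 - normc z ^+ 2) `^ (p - 1))) (fun z => B * c `^ p * u z)).
- by apply: rmeas_dirichlet_integrand => //; exact: hol_test_fun.
- by apply: rmeasM => //; exact: rmeas_cst.
- by move=> z; rewrite !mulr_ge0 ?powR_ge0 ?dind_ge0.
- move=> z; rewrite /u; have [z1|z1] := ltP (normc z) 1; last first.
    by rewrite dind_out// !mul0r mulr0.
  rewrite dind_in// !mul1r; have k0 := kern_gt0 a1 z1; have z0 := normc_ge0 z.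
  have H1 : normc (cderiv (test_fun a c n) z) `^ p <=
      c `^ p * n.+1%:R `^ p * (kern a z `^ (- 2%:R) * kern a z `^ (- be)).
    rewrite -powRD ?(gt_eqF k0) ?implybT//.
    rewrite (_ : - 2%:R - be = - n.+2%:R * p); last by rewrite /be; ring.
    rewrite powRrM -powRM// -powRM ?mulr_ge0 ?powR_ge0//.
    apply: ge0_ler_powR; rewrite ?nnegrE ?(ltW p0) ?normc_ge0 ?mulr_ge0 ?powR_ge0//.
    exact: cderiv_test_fun_le.
  have s0 : 0 < 1 - normc z ^+ 2 by exact: sqr_sub_lt1.
  have H2 : (1 - normc z ^+ 2) `^ (p - 1) <= 2 `^ `|p - 1| * (1 - normc z) `^ (p - 1).
    by apply: powR_ratio; rewrite ?subr_gt0// expr2; nra.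
  apply: (le_trans (ler_pM (powR_ge0 _ _) (powR_ge0 _ _) H1 H2)).
  by rewrite BE le_eqVlt; apply/orP; left; apply/eqP; ring.
Qed.

Lemma test_function (p : R) : 0 < p -> exists2 c : R, 0 < c & forall a, normc a < 1 ->
  exists f, [/\ hol f, (dirichlet_norm p f <= 1)%E & c <= normc (f a) `^ p * (1 - normc a)].
Proof.
move=> p0; have [n np] : exists n : nat, 2 < n.+1%:R * p.
  exists (Num.bound (2 / p)); rewrite -ltr_pdivrMr//.
  apply: (@lt_le_trans _ _ (Num.bound (2 / p))%:R); last by rewrite ler_nat.
  by apply: archi_boundP; rewrite divr_ge0 // ltW.
have [L L0 HL] := test_fun_dirichlet p0 np.
have pV : p^-1 * p = 1 by rewrite mulVf// gt_eqF.
have L1 : 0 < 1 + L by rewrite addr_gt0.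
have [m mE] : exists m : R, m = n.+1%:R by eexists.
rewrite -mE in np HL.
exists ((1 + L)^-1 * 2 `^ (- (m * p))) => [|a a1]; first by rewrite mulr_gt0 ?invr_gt0 ?powR_gt0.
have [d dE] : exists d : R, d = 1 - normc a by eexists.
have d0 : 0 < d by rewrite dE subr_gt0.
have d1 : d <= 1 by rewrite dE gerBl normc_ge0.
(* Then c^p = (1 + L)^-1 d^(m p - 1), which leaves at most L / (1 + L) for the Dirichlet integral
   and at most 1 / (1 + L) for |f(0)|^p. *)
pose c := (1 + L) `^ (- p^-1) * d `^ (m - p^-1).
have c0 : 0 <= c by rewrite mulr_ge0 ?powR_ge0.
have cp : c `^ p = (1 + L)^-1 * d `^ (m * p - 1).
  rewrite /c powRM ?powR_ge0// -!powRrM mulNr pV powR_inv1 ?(ltW L1)//.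
  by rewrite mulrBl pV.
exists (test_fun a c n); split; first exact: hol_test_fun.
- rewrite /dirichlet_norm disc_integralE.
  have := HL a c a1 c0; set I := aint _ => HI.
  have I0 : (0 <= I)%E.
    apply: integral_ge0 => w _; rewrite lee_fin; apply: mulr_ge0; first exact: dind_ge0.
    by apply: mulr_ge0; exact: powR_ge0.
  rewrite (_ : L * _ * _ = (1 + L)^-1 * L) in HI; last first.
    rewrite cp -dE (_ : 1 - m * p = - (m * p - 1)); last by ring.
    by rewrite powRN; field; rewrite !gt_eqF ?powR_gt0.
  have pi0 : 0 <= (pi : R)^-1 by rewrite invr_ge0 pi_ge0.
  have pi1 : (pi : R)^-1 <= 1 by rewrite invf_le1 ?pi_gt0//; apply: le_trans (pi_ge2 R); lra.
  have k00 : kern a 0 = 1 by rewrite /kern mulr0 subr0 normc1.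
  rewrite normc_test_fun// k00 expr1n invr1 mulr1.
  have H : ((c `^ p)%:E + (pi^-1)%:E * I <= 1)%E.
    apply: (@le_trans _ _ (((1 + L)^-1)%:E + ((1 + L)^-1 * L)%:E)%E); last first.
      by rewrite -EFinD lee_fin -[X in X + _]mulr1 -mulrDr mulVf// gt_eqF.
    apply: leeD.
      rewrite lee_fin cp -[leRHS]mulr1 ler_wpM2l ?invr_ge0 ?(ltW L1)//.
      rewrite [leRHS](_ : 1 = 1 `^ (m * p - 1)); last (by rewrite powR1); apply: ge0_ler_powR; rewrite ?nnegrE ?(ltW d0)//.
      by move: np; move: (m * p) => x; lra.
    apply: le_trans HI; rewrite -[leRHS]mul1e; apply: lee_wpmul2r => //; by rewrite lee_fin.
  have -> : (1 = (1 : R)%:E `^ p^-1 :> \bar R)%E by rewrite poweR_EFin powR1.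
  apply: gt0_ler_poweR; rewrite ?in_itv /= ?leey ?andbT ?invr_ge0 ?(ltW p0)//.
  by rewrite adde_ge0 ?lee_fin ?powR_ge0// mule_ge0 ?lee_fin.
- rewrite normc_test_fun// powRM ?invr_ge0 ?exprn_ge0 ?kern_ge0// cp -dE.
  (* At [a] the kernel modulus is 1 - |a|^2, between d and 2 d; this is the origin of 2^(-m p) in
     the constant. *)
  have ka : kern a a <= 2 * d.
    by rewrite kern_diag// dE expr2; have := normc_ge0 a; nra.
  have ka0 : 0 < kern a a by exact: kern_gt0.
  have H : (2 * d) `^ (- (m * p)) <= (kern a a ^+ n.+1)^-1 `^ p.
    rewrite -(powR_mulrn n.+1 (ltW ka0)) -mE -powRN -powRrM mulNr !powRN.
    rewrite lef_pV2 ?posrE ?powR_gt0 ?mulr_gt0//; apply: ge0_ler_powR; rewrite ?nnegrE//.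
    + by move: np; move: (m * p) => x; lra.
    + exact: ltW.
    + by rewrite mulr_ge0 // ltW.
  have -> : (1 + L)^-1 * 2 `^ (- (m * p)) = (1 + L)^-1 * d `^ (m * p - 1) * (2 * d) `^ (- (m * p)) * d.
    rewrite powRM ?(ltW d0)// powRD ?(gt_eqF d0) ?implybT// powR_inv1 ?(ltW d0)//.
    rewrite [d `^ (- _)]powRN; field.
    by rewrite !gt_eqF ?powR_gt0.
  rewrite ler_wpM2r ?(ltW d0)// ler_wpM2l// mulr_ge0 ?powR_ge0// invr_ge0 ltW//.
Qed.

End TestFunctions.

(** * Growth of functions in F(p, p-1, 1) *)

Section LowerBound.
Variable R : realType.
Implicit Types (f g h : R[i] -> R[i]) (z w a : R[i]) (u : R[i] -> R).

Lemma kern_near w z : normc w < 1 -> normc (z - w) < (1 - normc w) / 4 ->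
  kern w z <= 9 / 4 * (1 - normc w).
Proof.
move=> w1 zw; have w0 := normc_ge0 w.
have -> : kern w z = normc ((1 - w^* * w) + w^* * (w - z)).
  by rewrite /kern; congr normc; ring.
apply: le_trans (le_normcD _ _) _; rewrite normcM normc_conj (normc_dist w z).
rewrite -/(kern w w) kern_diag//.
have : normc w * normc (z - w) <= (1 - normc w) / 4.
  apply: (@le_trans _ _ (1 * normc (z - w))); last by rewrite mul1r ltW.
  by rewrite ler_wpM2r ?normc_ge0// ltW.
by rewrite expr2; nra.
Qed.

(** With r = 1 - |w| the numerator is at least 3/4 r^2 and the kernel modulus at most 9/4 r, so the
    quotient is at least 4/27 > 1/9. *)
Lemma sigma_weight_near w z : normc w < 1 -> normc (z - w) < (1 - normc w) / 4 ->
  9^-1 <= (1 - normc w ^+ 2) * (1 - normc z ^+ 2) * kern w z `^ (- 2%:R).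
Proof.
move=> w1 zw; have w0 := normc_ge0 w; have z0 := normc_ge0 z.
have z1 : normc z < 1 by apply: in_disc_sub zw _; lra.
have zr' : 3 / 4 * (1 - normc w) <= 1 - normc z by have := le_normcB z w; lra.
have k0 := kern_gt0 w1 z1; have kr := kern_near w1 zw.
rewrite kern_powRN2 ler_pdivlMr ?exprn_gt0//.
have [r rE] : exists r, r = 1 - normc w by eexists.
have r0 : 0 < r by rewrite rE subr_gt0.
have A1 : r <= 1 - normc w ^+ 2 by rewrite rE expr2; nra.
have A2 : 3 / 4 * r <= 1 - normc z ^+ 2 by rewrite rE; apply: le_trans zr' _; rewrite expr2; nra.
rewrite -rE in kr.
have k2 : kern w z ^+ 2 <= (9 / 4 * r) ^+ 2.
  by apply: lerXn2r; rewrite ?nnegrE ?(ltW k0)//; lra.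
apply: (@le_trans _ _ (r * (3 / 4 * r))); last by apply: ler_pM => //; lra.
by move: k2; rewrite !expr2; nra.
Qed.

(** Near [w] the factor with [sigma w] is bounded below and 1 - |z|^2 is comparable to r = 1 - |w|.
    So a multiple of r^(1 - p) times the integrand dominates |h'|^p there and can serve as [Phi] in
    [submean]. *)
Lemma F_cderiv_le (p : R) : 0 < p -> exists2 C : R, 0 < C & forall h (D : R) w,
  hol h -> normc w < 1 ->
  (disc_integral (fun z => normc (cderiv h z) `^ p * (1 - normc z ^+ 2) `^ (p - 1) *
    (1 - normc (sigma w z) ^+ 2) `^ 1)%R <= D%:E)%E ->
  normc (cderiv h w) `^ p * (1 - normc w) `^ (p + 1) <= C * D.
Proof.
move=> p0; have [C C0 HC] := submean p0.
have pn : p != 0 by rewrite gt_eqF.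
(* 9 is from [sigma_weight_near]; 4 bounds both ratios between 1 - |z|^2 and r. *)
have [K KE] : exists K : R, K = 9 * 4 `^ `|1 - p| by eexists.
have K0 : 0 < K by rewrite KE mulr_gt0// powR_gt0.
have pi0 : 0 < (pi : R) by exact: pi_gt0.
exists (C * K * pi) => [|h D w hh w1]; first by rewrite !mulr_gt0.
have [r rE] : exists r, r = 1 - normc w by eexists.
have r0 : 0 < r by rewrite rE subr_gt0.
have w0 := normc_ge0 w.
rewrite (@F_integrandE R p (p - 1) h w w1).
have := rmeas_F_integrand (p - 1) w pn hh.
set I := fun z : R[i] => _ => mI HI.
have I0 z : 0 <= I z.
  rewrite /I; have [z1|z1] := ltP (normc z) 1; last by rewrite dind_out// !mul0r.
  have /andP[s0 _] := sigma_weight01 w1 z1.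
  by apply: mulr_ge0; apply: mulr_ge0; rewrite ?dind_ge0 ?powR_ge0.
have Kr0 : 0 <= K * r `^ (1 - p) by rewrite mulr_ge0 ?powR_ge0// ltW.
have mPhi : rmeas (fun z => K * r `^ (1 - p) * I z) by apply: rmeasM => //; exact: rmeas_cst.
have Phi0 z : 0 <= K * r `^ (1 - p) * I z by rewrite mulr_ge0.
have near z : normc (z - w) < (1 - normc w) / 4 ->
    normc (cderiv h z) `^ p <= K * r `^ (1 - p) * I z.
  move=> zw; have z0 := normc_ge0 z.
  have z1 : normc z < 1 by apply: in_disc_sub zw _; lra.
  rewrite /I dind_in// mul1r.
  have s9 := sigma_weight_near w1 zw.
  have zr1 : 3 / 4 * r <= 1 - normc z by rewrite rE; have := le_normcB z w; lra.
  have zr2 : 1 - normc z <= 5 / 4 * r by rewrite rE; have := le_normcBC w z; lra.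
  move: (_ * _ * kern w z `^ _) s9 => sg s9.
  have s0 : 0 < 1 - normc z ^+ 2 by exact: sqr_sub_lt1.
  have sr1 : 1 - normc z <= 1 - normc z ^+ 2 by rewrite expr2; nra.
  have sr2 : 1 - normc z ^+ 2 <= 2 * (1 - normc z) by rewrite expr2; nra.
  move: (1 - normc z ^+ 2) s0 sr1 sr2 => s s0 sr1 sr2.
  have H : s `^ (1 - p) <= 4 `^ `|1 - p| * r `^ (1 - p) by apply: powR_ratio => //; lra.
  have H1 : 1 <= 4 `^ `|1 - p| * r `^ (1 - p) * s `^ (p - 1).
    have E : s `^ (1 - p) * s `^ (p - 1) = 1.
      by rewrite -powRD ?(gt_eqF s0) ?implybT// (_ : _ + _ = 0) ?powRr0//; ring.
    by rewrite -[leLHS]E ler_wpM2r ?powR_ge0.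
  have X0 : 0 <= normc (cderiv h z) `^ p by exact: powR_ge0.
  move: (normc (cderiv h z) `^ p) X0 => X X0.
  rewrite KE [leRHS](_ : _ = X * ((4 `^ `|1 - p| * r `^ (1 - p) * s `^ (p - 1)) * (9 * sg))); last by ring.
  rewrite ler_peMr// -[leLHS]mulr1; apply: ler_pM => //; lra.
have := HC h w (fun z => K * r `^ (1 - p) * I z) hh w1 mPhi Phi0 near.
have -> : aint (EFin \o (fun z => K * r `^ (1 - p) * I z)) =
    ((K * r `^ (1 - p))%:E * aint (EFin \o I))%E.
  exact: (aintZl Kr0 mI I0).
have AI : (aint (EFin \o I) <= (pi * D)%:E)%E.
  have -> : aint (EFin \o I) = (pi%:E * ((pi^-1)%:E * aint (EFin \o I)))%E.
    by rewrite muleA -EFinM divff ?mul1e// gt_eqF.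
  by rewrite EFinM; apply: lee_wpmul2l => //; rewrite lee_fin ltW.
move=> H; have {H} : ((normc (cderiv h w) `^ p * (1 - normc w) ^+ 2)%:E <=
    (C * (K * r `^ (1 - p) * (pi * D)))%:E)%E.
  apply: le_trans H _; rewrite [leRHS]EFinM; apply: lee_wpmul2l; first by rewrite lee_fin ltW.
  by rewrite [leRHS]EFinM; apply: lee_wpmul2l; first by rewrite lee_fin.
rewrite lee_fin -rE.
move: (normc (cderiv h w) `^ p) => X H.
have -> : r `^ (p + 1) = r ^+ 2 * r `^ (p - 1).
  rewrite -powR_mulrn ?(ltW r0)// -powRD ?(gt_eqF r0) ?implybT//; congr (_ `^ _); ring.
rewrite mulrA; apply: le_trans (ler_wpM2r (powR_ge0 _ _) H) _.
rewrite [leLHS](_ : _ = C * K * pi * D * (r `^ (1 - p) * r `^ (p - 1))); last by ring.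
rewrite -powRD ?(gt_eqF r0) ?implybT// (_ : 1 - p + (p - 1) = 0); last by ring.
by rewrite powRr0 mulr1.
Qed.

(** [growth_powR] with k = 1 / p: then p (1 + k) = p + 1 is the exponent of [F_cderiv_le], and k p =
    1 that of the conclusion. *)
Lemma F_growth (p : R) : 0 < p -> exists2 C : R, 0 < C & forall h (D : R) a,
  hol h -> normc a < 1 ->
  ((normc (h 0) `^ p)%:E + ereal_sup [set disc_integral (fun z =>
      (normc (cderiv h z) `^ p * (1 - normc z ^+ 2) `^ (p - 1) *
       (1 - normc (sigma w z) ^+ 2) `^ 1)%R) | w in @disc R] <= D%:E)%E ->
  normc (h a) `^ p * (1 - normc a) <= C * D.
Proof.
move=> p0; have [C C0 HC] := F_cderiv_le p0.
have [K KE] : exists K : R, K = p^-1 `^ (- p) * C by eexists.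
have K0 : 0 < K by rewrite KE mulr_gt0// powR_gt0// invr_gt0.
exists (2 `^ p * (1 + K)) => [|h D a hh a1].
  by rewrite mulr_gt0 ?powR_gt0// addr_gt0.
have sup0 := F_seminorm_ge0 p (p - 1) h.
set S := ereal_sup _ in sup0 * => HD.
have h0D : normc (h 0) `^ p <= D.
  by rewrite -lee_fin; apply: le_trans HD; rewrite leeDl.
have SD : (S <= D%:E)%E by apply: le_trans HD; rewrite leeDr ?lee_fin ?powR_ge0.
have D0 : 0 <= D by apply: le_trans h0D; exact: powR_ge0.
have a0 := normc_ge0 a; have d0 : 0 < 1 - normc a by rewrite subr_gt0.
have pV0 : 0 < p^-1 by rewrite invr_gt0.
have CD0 : 0 <= C * D by rewrite mulr_ge0// ltW.
have G : normc (h a) `^ p <=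
    2 `^ p * (normc (h 0) `^ p + p^-1 `^ (- p) * (C * D) * (1 - normc a) `^ (- (p^-1 * p))).
  apply: growth_powR => // t /andP[t0 t1].
  have ta : normc (t%:C * a) = t * normc a by rewrite normcM normc_real ger0_norm.
  have ta1 : normc (t%:C * a) < 1 by rewrite ta; apply: le_lt_trans a1; rewrite ler_piMl.
  rewrite -ta mulrDr mulr1 divff ?gt_eqF//; apply: HC => //.
  by apply: le_trans SD; apply: ereal_sup_ubound; exists (t%:C * a).
rewrite mulVf ?gt_eqF// powR_inv1 ?(ltW d0)// in G.
apply: (le_trans (ler_wpM2r (ltW d0) G)).
rewrite [leLHS](_ : _ = 2 `^ p * (normc (h 0) `^ p * (1 - normc a) + K * D)); last first.
  by rewrite KE; field; rewrite gt_eqF.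
rewrite -mulrA ler_wpM2l ?powR_ge0// mulrDl mul1r lerD2r.
by apply: le_trans h0D; rewrite ler_piMr ?powR_ge0// gerBl.
Qed.

End LowerBound.

(** * Boundedness of the symbol and the norm equivalence *)

Section Boundedness.
Variable R : realType.
Implicit Types (f g h : R[i] -> R[i]) (z w a : R[i]).

Lemma F_norm_powR_le (p N : R) h : 0 < p -> 0 <= N -> (F_norm p (p - 1) 1 h <= N%:E)%E ->
  ((normc (h 0) `^ p)%:E + ereal_sup [set disc_integral (fun z =>
      (normc (cderiv h z) `^ p * (1 - normc z ^+ 2) `^ (p - 1) *
       (1 - normc (sigma w z) ^+ 2) `^ 1)%R) | w in @disc R] <= (N `^ p)%:E)%E.
Proof.
move=> p0 N0; rewrite /F_norm; set S := (_ + _)%E => H.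
have S0 : (0 <= S)%E by rewrite adde_ge0 ?lee_fin ?powR_ge0//; exact: F_seminorm_ge0.
have -> : S = ((S `^ p^-1) `^ p)%E.
  by rewrite -poweRrM mulVf ?gt_eqF// poweRe1.
rewrite -poweR_EFin; apply: gt0_ler_poweR; rewrite ?in_itv /= ?leey ?andbT ?(ltW p0) ?lee_fin//.
exact: poweR_ge0.
Qed.

Lemma F_norm_ge0 (p q s : R) h : (0 <= F_norm p q s h)%E.
Proof. exact: poweR_ge0. Qed.

(** The test function at [a] and the growth of f g there involve the same power of 1 - |a|, so c
    |g(a)|^p <= K N^p remains. Only the unit ball enters the hypothesis, which fits both an operator
    bound and the operator norm; [0 <= N] serves to exclude the value -oo of the latter. *)
Lemma multiplier_le (p : R) : 0 < p -> exists2 C : R, 0 < C & forall g (N : R),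
  hol g -> (forall f, hol f -> (dirichlet_norm p f <= 1)%E ->
    (F_norm p (p - 1) 1 (mulop g f) <= N%:E)%E) ->
  0 <= N /\ forall a, normc a < 1 -> normc (g a) <= C * N.
Proof.
move=> p0; have [c c0 test] := @test_function R p p0.
have [K K0 growth] := @F_growth R p p0.
exists ((K / c) `^ p^-1) => [|g N hg H]; first by rewrite powR_gt0// divr_gt0.
have N0 : 0 <= N.
  have [|f [hf f1 _]] := test 0; first by rewrite normc0.
  by rewrite -lee_fin; apply: le_trans (H f hf f1); exact: F_norm_ge0.
split=> // a a1; have [f [hf f1 fa]] := test a a1.
have := growth (mulop g f) (N `^ p) a (hol_mulop hf hg) a1
  (F_norm_powR_le p0 N0 (H f hf f1)).
rewrite /mulop normcM (powRM _ (normc_ge0 (f a)) (normc_ge0 (g a))) => h.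
have d0 : 0 < 1 - normc a by rewrite subr_gt0.
have : c * normc (g a) `^ p <= K * N `^ p.
  by apply: le_trans h; rewrite [leRHS]mulrAC ler_wpM2r ?powR_ge0.
rewrite mulrC -ler_pdivlMr// => {h}. move=> h.
have {h} : (normc (g a) `^ p) `^ p^-1 <= (K * N `^ p / c) `^ p^-1.
  by apply: ge0_ler_powR; rewrite ?nnegrE ?invr_ge0 ?powR_ge0 ?(ltW p0)// divr_ge0 ?mulr_ge0 ?powR_ge0// ltW.
rewrite -powRrM divff ?gt_eqF// powRr1 ?normc_ge0//.
rewrite (mulrAC K) (@powRM R (K / c) (N `^ p)) ?powR_ge0 ?divr_ge0 ?(ltW K0) ?(ltW c0)//.
by rewrite -powRrM divff ?gt_eqF// powRr1.
Qed.

Lemma Hinf_norm_ge0 g : (0 <= Hinf_norm g)%E.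
Proof.
apply: (@le_trans _ _ (normc (g 0))%:E); first by rewrite lee_fin normc_ge0.
by apply: ereal_sup_ubound; exists 0 => //; rewrite /disc /mkset normc0.
Qed.

Lemma Hinf_norm_leP g (G : R) :
  (Hinf_norm g <= G%:E)%E <-> forall z, normc z < 1 -> normc (g z) <= G.
Proof.
split=> [H z z1|H].
  by rewrite -lee_fin; apply: le_trans H; apply: ereal_sup_ubound; exists z.
by apply: ge_ereal_sup => _ [z z1 <-]; rewrite lee_fin; exact: H.
Qed.

End Boundedness.

Unset Implicit Arguments.

Theorem theorem5 (R : realType) (p : R) (hp : 0 < p) :
  (forall g : R[i] -> R[i], holomorphic_disc g ->
     (bounded_operator (dirichlet_norm p) (F_norm p (p - 1) 1) (mulop g)
      <-> Hinf g)) /\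
  (exists C : R, 0 < C /\
     forall g : R[i] -> R[i], holomorphic_disc g ->
       ((C^-1)%:E * Hinf_norm g
          <= operator_norm (dirichlet_norm p) (F_norm p (p - 1) 1) (mulop g))%E
       /\
       (operator_norm (dirichlet_norm p) (F_norm p (p - 1) 1) (mulop g)
          <= C%:E * Hinf_norm g)%E).
Proof.
have [C1 C10 upper] := @mulop_F_norm_le R p hp.
have [C2 C20 lower] := @multiplier_le R p hp.
have upperE g (G : R) : holomorphic_disc g -> Hinf_norm g = G%:E ->
    0 <= G /\ forall f, hol f -> (F_norm p (p - 1) 1 (mulop g f) <= (C1 * G)%:E * dirichlet_norm p f)%E.
  move=> /hol_holomorphic hg gG; have G0 : 0 <= G by rewrite -lee_fin -gG Hinf_norm_ge0.
  split=> // f hf; apply: upper => //; apply/Hinf_norm_leP; by rewrite gG.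
have NX0 f : (0 <= dirichlet_norm p f)%E by exact: poweR_ge0.
have Hfin g : (Hinf_norm g < +oo)%E -> exists G : R, Hinf_norm g = G%:E.
  have := Hinf_norm_ge0 g; case: (Hinf_norm g) => // r _ _; by exists r.
split=> [g hg|].
  have hg' := (hol_holomorphic g).2 hg.
  split=> [[_ [c Hc]]|[_ /Hfin[G gG]]].
    (* The bound [c] comes without a sign; with its absolute value the inequality |f|_D <= 1 can be
       multiplied through. *)
    split=> //; have [|c0 gc] := lower g `|c| hg'.
      move=> f hf f1; apply: (@le_trans _ _ (c%:E * dirichlet_norm p f)%E).
        by apply: Hc; split; [exact/hol_holomorphic|exact: le_lt_trans f1 (ltry 1)].
      apply: (@le_trans _ _ (`|c|%:E * dirichlet_norm p f)%E).
        by apply: lee_wpmul2r => //; rewrite lee_fin ler_norm.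
      by rewrite -[leRHS]mule1; apply: lee_wpmul2l; rewrite ?lee_fin.
    have /Hinf_norm_leP := gc; move=> /le_lt_trans; apply; exact: ltry.
  have [G0 H] := upperE g G hg gG.
  have CG0 : 0 <= C1 * G by rewrite mulr_ge0// ltW.
  split=> [f [/hol_holomorphic hf ffin]|].
    split; first by apply/hol_holomorphic; exact: hol_mulop.
    by apply: le_lt_trans (H f hf) _; apply: lte_mul_pinfty.
  by exists (C1 * G) => f [/hol_holomorphic hf _]; exact: H.
have C0 : 0 < C1 + C2 by rewrite addr_gt0.
(* The sum dominates both the constant [C1] of the upper bound and the constant [C2] of the lower
   one. *)
exists (C1 + C2); split=> // g hg; have hg' := (hol_holomorphic g).2 hg.
set opn := operator_norm _ _ _; split.
  have opnP f : hol f -> (dirichlet_norm p f <= 1)%E ->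
      (F_norm p (p - 1) 1 (mulop g f) <= opn)%E.
    move=> hf f1; have ff : holomorphic_disc f by exact/hol_holomorphic.
    have fD : space_of (dirichlet_norm p) f by split; last exact: le_lt_trans f1 (ltry 1).
    by apply: ereal_sup_ubound; exists f; [split|].
  move: opnP; case: opn => [N opnN|_|opnN].
  - have [N0 gN] := lower g N hg' opnN.
    have /Hinf_norm_leP H := gN.
    apply: le_trans (lee_wpmul2l _ H) _; first by rewrite lee_fin invr_ge0 ltW.
    rewrite -EFinM lee_fin mulrC ler_pdivrMr// mulrC ler_wpM2l//.
    by rewrite lerDr ltW.
  - exact: leey.
  (* A supremum equal to -oo would bound all the F-norms by -1, contrary to the sign in the
     conclusion of [lower]. *)
  - have [] := lower g (- 1) hg'; last by rewrite lerNr oppr0 ler10.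
    by move=> f hf /(opnN f hf) /le_trans; apply; exact: leNye.
have [goo|/Hfin[G gG]] := leP +oo%E (Hinf_norm g).
  have -> : Hinf_norm g = +oo%E by apply/eqP; rewrite -leye_eq.
  by rewrite gt0_muley ?leey// lte_fin.
have [G0 H] := upperE g G hg gG.
rewrite gG; apply: ge_ereal_sup => _ [f [[/hol_holomorphic hf _] f1] <-].
apply: le_trans (H f hf) _.
have CG0 : 0 <= C1 * G by rewrite mulr_ge0// ltW.
apply: (@le_trans _ _ (C1 * G)%:E).
  by rewrite -[leRHS]mule1; apply: lee_wpmul2l; rewrite ?lee_fin.
by rewrite -EFinM lee_fin ler_wpM2r// lerDl ltW.
Qed.
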